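(* Let $k\ge2$ and let $F:M\to M$, $F(b,x)=(Ab,f_b(x))$, be a boundary preserving skew product on $M=\mathbb{T}^d\times[0,1]$ as in the context, with each $f_b$ of class $C^k$ in $x$, and suppose there are constants $C_k,\beta>0$ with $\|f_b-f_{b'}\|_{C^k}\le C_k\|b-b'\|^{\beta}$ for all $b,b'\in\mathbb{T}^d$. Put $\lambda_b=f_b'(0)$, $F_0(b,x)=(Ab,\lambda_b x)$, let $\mu$ be the largest modulus of an eigenvalue of $A$, and suppose that $\lambda_b\le q<1$ for all $b\in\mathbb{T}^d$. Then there exist $\varepsilon>0$ and a continuous fiber preserving map $H$, defined on $M_\varepsilon=\mathbb{T}^d\times[0,\varepsilon]$, which is a homeomorphism onto its image in $M$, of the form $H(b,x)=(b,x+h_b(x))$ with $h_b(0)=\frac{\partial h_b}{\partial x}(0)=0$, such that: (i) $F\circ H=H\circ F_0$ on $M_\varepsilon$; (ii) for every $\alpha$ with $0<\alpha<\min(\beta,-\log_\mu q)$ there is a constant $\tilde C_0$ with $\sup_{x\in[0,\varepsilon]}|h_b(x)-h_{b'}(x)|\le\tilde C_0\|b-b'\|^{\alpha}$ for all $b,b'\in\mathbb{T}^d$; (iii) for each $b$, $H$ is of class $C^{k-2}$ in $x\in[0,\varepsilon]$; (iv) there exist constants $\tilde C_{k-2}>0$ and $\alpha$ with $0<\alpha<\min(\beta,-\log_\mu q)$ such that $$\|h_b-h_{b'}\|_{C^{k-2}([0,\varepsilon])}\le\tilde C_{k-2}\|b-b'\|^{\alpha}\qquad\text{for all } b,b'\in\mathbb{T}^d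 .$$
   Context: $\mathbb{T}^d=\mathbb{R}^d/\mathbb{Z}^d$, and $\|b-b'\|$ denotes the distance on $\mathbb{T}^d$. A boundary preserving skew product is a map $F:M\to M$, $M=\mathbb{T}^d\times[0,1]$, $F(b,x)=(Ab,f_b(x))$, where $A$ is a linear hyperbolic automorphism of $\mathbb{T}^d$ (induced by a matrix in $GL(d,\mathbb{Z})$ with no eigenvalue of modulus 1) and each $f_b:[0,1]\to[0,1]$ is an orientation preserving diffeomorphism with $f_b(0)=0$, $f_b(1)=1$. $C^k$-norms are taken with respect to the fiber variable $x$ (over $[0,1]$ for $f_b$). *)

(* Defs.v *)
From HB Require Import structures.
From mathcomp Require Import all_boot all_order all_algebra.
From mathcomp Require Import complex.
From mathcomp Require Import all_classical all_reals all_analysis.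

Set Implicit Arguments.
Unset Strict Implicit.
Unset Printing Implicit Defensive.

Import Order.TTheory GRing.Theory Num.Theory.
Import numFieldNormedType.Exports.

Local Open Scope classical_set_scope.
Local Open Scope ring_scope.

Section Torus.
Variables (R : realType) (d : nat).

Definition lattice : {pred 'cV[R]_d} := fun v => v \is a mxOver Num.int.

Lemma lattice_zmod_closed : zmod_closed lattice.
Proof.
split=> [|u v /mxOverP uI /mxOverP vI]; apply/mxOverP => i j; rewrite !mxE.
  exact: rpred0.
by apply: rpredB; [exact: uI | exact: vI].
Qed.

HB.instance Definition _ :=
  GRing.isZmodClosed.Build 'cV[R]_d lattice lattice_zmod_closed.

(* R^d / Z^d with the quotient topology. *)
Definition torus := quotient_topology (Quotient.quot lattice).

HB.instance Definition _ := Topological.on torus.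
HB.instance Definition _ := Quotient.on torus.

Definition eucl_norm (v : 'cV[R]_d) : R := Num.sqrt (\sum_i v i 0 ^+ 2).

(* The flat distance: the Euclidean distance between the two classes. *)
Definition torus_dist (b b' : torus) : R :=
  inf [set eucl_norm (v - v') | v in [set v | \pi_torus v = b]%qT
                              & v' in [set v' | \pi_torus v' = b']%qT].

(* Independent of the choice of representative: see [torus_mapE]. *)
Definition torus_map (A : 'M[int]_d) (b : torus) : torus :=
  (\pi_torus (map_mx intr A *m repr b))%qT.

Lemma torus_mapE (A : 'M[int]_d) (v : 'cV[R]_d) :
  torus_map A (\pi_torus v)%qT = (\pi_torus (map_mx intr A *m v))%qT.
Proof.
suff : map_mx intr A *m repr (\pi_torus v)%qT - map_mx intr A *m v \in lattice.
  by rewrite Quotient.idealrBE => /eqP.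
rewrite -mulmxBr.
have : repr (\pi_torus v)%qT - v \in lattice.
  by rewrite Quotient.idealrBE; apply/eqP; exact: (@reprK _ torus).
move=> /mxOverP vI; apply/mxOverP => i j; rewrite mxE; apply: rpred_sum => l _.
by apply: rpredM (vI l j); rewrite mxE; exact: intr_int.
Qed.

(* [eigenvalue] refers to row vectors; the spectrum is that of the action on
   column vectors. *)
Definition is_eigenvalue (A : 'M[int]_d) (z : R[i]) : bool :=
  eigenvalue (map_mx intr A : 'M[R[i]]_d) z.

Definition hyperbolic (A : 'M[int]_d) : Prop :=
  forall z : R[i], is_eigenvalue A z -> `|z| != 1.

Definition largest_modulus (A : 'M[int]_d) (mu : R) : Prop :=
  (exists2 z : R[i], is_eigenvalue A z & `|z| = mu%:C%C) /\
  (forall z : R[i], is_eigenvalue A z -> `|z| <= mu%:C%C).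

End Torus.

Section Interval.
Variables (R : realType) (a b : R).
Implicit Types (g : R -> R) (x l : R).

(* Only the values of g on [a, b] matter; the derivative is one-sided at a and
   at b. *)
Definition is_derive_in g x l : Prop :=
  (g y - g x) / (y - x) @[y --> within `[a, b] x^'] --> l.

Definition derive_in g x : R :=
  lim ((g y - g x) / (y - x) @[y --> within `[a, b] x^']).

Definition derive_in_n (n : nat) g : R -> R := iter n derive_in g.

(* Continuity of the derivatives of order < n follows from differentiability. *)
Definition class_C (n : nat) g : Prop :=
  (forall j x, (j < n)%N -> x \in `[a, b] ->
     exists l, is_derive_in (derive_in_n j g) x l) /\
  {within `[a, b], continuous (derive_in_n n g)}.

(* The maximum over j <= n of the sup norms of the j-th derivatives on [a, b];
   meaningful when g is of class C^n. *)
Definition C_norm (n : nat) g : \bar R :=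
  ereal_sup [set `|derive_in_n jx.1 g jx.2|%:E
            | jx in [set j | (j <= n)%N] `*` `[a, b]].

(* Orientation preserving C^1-diffeomorphisms of [a, b]. *)
Definition or_diffeo g : Prop :=
  [/\ {in `[a, b] &, {homo g : x y / x < y}},
      class_C 1 g &
      exists g' : R -> R,
        [/\ {in `[a, b], forall x, g x \in `[a, b]},
            {in `[a, b], forall x, g' x \in `[a, b]},
            {in `[a, b], cancel g g'}, {in `[a, b], cancel g' g} &
            class_C 1 g']].

End Interval.

(* H matters only on D, and the inverse G only on the image of D. *)
Definition homeo_onto_image (X Y : topologicalType) (D : set X) (H : X -> Y) :
    Prop :=
  {within D, continuous H} /\
  exists G : Y -> X, (forall p, D p -> G (H p) = p) /\
                     {within H @` D, continuous G}.

Section SkewProduct.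
Variables (R : realType) (d : nat).
Implicit Types (A : 'M[int]_d) (f h : torus R d -> R -> R).

(* The manifold M is [strip 1]. *)
Definition strip (e : R) : set (torus R d * R) := setT `*` `[0, e].

Definition skew_product A f (p : torus R d * R) : torus R d * R :=
  (torus_map A p.1, f p.1 p.2).

(* Fibre maps are total functions on R; only their values on [0, 1] matter. *)
Definition boundary_preserving f : Prop :=
  forall b, [/\ or_diffeo 0 1 (f b), f b 0 = 0 & f b 1 = 1].

Definition multiplier f (b : torus R d) : R := derive_in 0 1 (f b) 0.

Definition linear_part A f := skew_product A (fun b x => multiplier f b * x).

Definition fiber_shift h (p : torus R d * R) : torus R d * R :=
  (p.1, p.2 + h p.1 p.2).

End SkewProduct.

Arguments strip {R} d e _.

(* Main.v *)
(** Write [f_b(y) = l_b y + r_b(y)] with [r_b(y) = O(y^2)].  The conjugacy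
    equation for [H_b(x) = x + h_b(x)] becomes
    [h_b(x) = (h_{Ab}(l_b x) - r_b(x + h_b(x))) / l_b], a contraction of factor
    about [q] for the norm [sup |h_b(x)| / x^2] near [x = 0]; compactness of the
    torus bounds [l_b] away from 0.  Estimates on [h] are obtained by iterating
    an inequality [w(z) <= kappa(z) w(Tz) + c G(z)] along the skew product,
    for well chosen weights [G]: for instance [G = x^2 rho(b, b')] for the
    Hoelder estimate in [b], where [rho(Ab, Ab') <= theta rho(b, b')] and
    [q theta < 1].  Such a [rho], equivalent to [dist^alpha], exists when
    [alpha < - log_mu q] because [A^n] grows at most like [M^n] for every
    [M > mu]; that growth bound follows from Cayley-Hamilton by splitting off
    one linear factor of the characteristic polynomial at a time.

    The derivative [g = h'] solves the linear equation
    [g_b(x) = a_b(x) g_{Ab}(l_b x) + a_b(x) - 1] with [a = l / f'(H)], and every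
    further derivative solves an equation of the same kind with [a] replaced by
    [a l].  Hence [H] of class [C^j] makes [a], then [g], of class [C^j], so
    that [H] is of class [C^{j+1}]: the regularity bootstraps up to that of
    [f'].  The factors [a_b(x)], close to but possibly larger than 1, are
    absorbed by the weight [p(x) = 1 + K1 x], for which
    [a_b(x) p(l_b x) <= p(x)]. *)
Require Import Defs.
From HB Require Import structures.
From mathcomp Require Import all_boot all_order all_algebra.
From mathcomp Require Import complex.
From mathcomp Require Import all_classical all_reals all_analysis.
From mathcomp Require Import ring lra.

Set Implicit Arguments.
Unset Strict Implicit.
Unset Printing Implicit Defensive.

Import Order.TTheory GRing.Theory Num.Theory.
Import numFieldNormedType.Exports.

Local Open Scope classical_set_scope.
Local Open Scope ring_scope.

(** * Weighted contractions *)

(** Each unknown is expressed by its value one step further along the orbit, where the height has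
    shrunk by [l]. The equation for [h] divides by [l], so its weight must shrink by more than [l].
    A weight of order [x^2] shrinks by [l^2], and therefore [h] is sought as [O(x^2)] and its
    variations are measured by products of two small lengths. Comparing two base points costs
    [theta] per step; this is the source of the condition [q theta < 1], hence of the bound
    [- log_mu q] on the exponent.

    No limit is ever differentiated. A candidate derivative is solved from the formally
    differentiated equation, and the Taylor remainder of the original solution is then shown to
    satisfy an inequality that can be iterated, hence to be quadratically small.

    The class [k - 2] is the level at which [f'] enters: one derivative is spent on passing to [f'],
    and another because the top derivative must be Lipschitz in [x]. *)

Section Contraction.
Variables (R : realType) (X : Type) (T : X -> X) (D : X -> Prop).
Hypothesis DT : forall z, D z -> D (T z).

Lemma ler_geometric_eq0 (s C y : R) : 0 <= s < 1 ->
  (forall n, y <= C * s ^+ n) -> y <= 0.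
Proof.
move=> /andP[s0 s1] h.
have c0 : C * s ^+ n @[n --> \oo] --> (0 : R).
  rewrite -(mulr0 C); apply: cvgMl_tmp; apply: cvg_expr; by rewrite ger0_norm.
by apply: (ler_cvg_to (cvg_cst y) c0); apply: nearW => n; exact: h.
Qed.

(** Iterating [n] times leaves a remainder [K g s^n]. The a priori weight [g] is there to make it
    vanish and may be much cruder than [G]; neither [K] nor [g] enters the final bound. *)
Lemma discount (w g G k : X -> R) (K c s : R) :
  0 <= s < 1 -> 0 <= c -> (forall z, D z -> 0 <= G z) ->
  (forall z, D z -> 0 <= k z) ->
  (forall z, D z -> w z <= K * g z) ->
  (forall z, D z -> w z <= k z * w (T z) + c * G z) ->
  (forall z, D z -> k z * g (T z) <= s * g z) ->
  (forall z, D z -> k z * G (T z) <= s * G z) ->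
  0 <= K ->
  forall z, D z -> w z <= c / (1 - s) * G z.
Proof.
move=> /andP[s0 s1] c0 G0 k0 wg wT kg kG K0.
have s10 : 0 < 1 - s by lra.
have cs0 : 0 <= c / (1 - s) by rewrite divr_ge0 // ltW.
have step n : forall z, D z -> w z <= c / (1 - s) * G z + K * g z * s ^+ n.
  elim: n => [|n IH] z Dz.
    rewrite expr0 mulr1; have := wg _ Dz; have := mulr_ge0 cs0 (G0 _ Dz); lra.
  apply: (le_trans (wT _ Dz)).
  have h1 := ler_wpM2l (k0 _ Dz) (IH _ (DT Dz)).
  have sn : 0 <= K * s ^+ n by rewrite mulr_ge0 // exprn_ge0.
  have h2 := ler_wpM2l cs0 (kG _ Dz).
  have h3 := ler_wpM2l sn (kg _ Dz).
  have e : c / (1 - s) = c + c / (1 - s) * s by field; lra.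
  rewrite exprS [X in X * G z + _]e.
  nra.
move=> z Dz; rewrite -subr_le0.
apply: (@ler_geometric_eq0 s (K * g z)); first by rewrite s0.
move=> n; have := step n z Dz; lra.
Qed.

(** [Phi] sees both [u z] and [u (T z)] because the equation for [h] is implicit in the current
    value. Convergence is pointwise, through monotone real sequences, so [X] carries no structure;
    the regularity of the solution is recovered afterwards by [discount]. *)
Lemma weighted_fixpoint (Phi : X -> R -> R -> R) (g : X -> R) (K s : R) :
  0 <= s < 1 -> 0 <= K -> (forall z, D z -> 0 <= g z) ->
  (forall z a b, D z -> `|a| <= K * g z -> `|b| <= K * g (T z) ->
     `|Phi z a b| <= K * g z) ->
  (forall z a a' b b' r, D z -> 0 <= r ->
     `|a| <= K * g z -> `|a'| <= K * g z ->
     `|b| <= K * g (T z) -> `|b'| <= K * g (T z) ->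
     `|a - a'| <= r * g z -> `|b - b'| <= r * g (T z) ->
     `|Phi z a b - Phi z a' b'| <= s * r * g z) ->
  exists u : X -> R, forall z, D z ->
    `|u z| <= K * g z /\ u z = Phi z (u z) (u (T z)).
Proof.
move=> s01 K0 g0 Phib Phic.
have /andP[s0 s1] := s01.
have s10 : 0 < 1 - s by lra.
have [k [k0 kS]] : exists k : nat -> X -> R, (forall z, k 0%N z = 0) /\
    forall n z, k n.+1 z = Phi z (k n z) (k n (T z)).
  by exists (fun n => iter n (fun v z => Phi z (v z) (v (T z))) (fun=> 0)).
have kb n : forall z, D z -> `|k n z| <= K * g z.
  elim: n => [|n IH] z Dz; first by rewrite k0 normr0 mulr_ge0 // g0.
  rewrite kS.
  by apply: Phib => //; [exact: IH | exact: (IH _ (DT Dz))].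
have kd n : forall z, D z -> `|k n.+1 z - k n z| <= K * s ^+ n * g z.
  elim: n => [|n IH] z Dz.
    by rewrite k0 subr0 expr0 mulr1; exact: kb.
  rewrite (_ : K * s ^+ n.+1 = s * (K * s ^+ n)); last by rewrite exprS; ring.
  rewrite [k n.+2 z]kS [in X in _ - X]kS; apply: Phic => //; try by [exact: kb | exact: (kb _ _ (DT Dz))].
  - by rewrite mulr_ge0 // exprn_ge0.
  - exact: IH.
  - exact: (IH _ (DT Dz)).
(* [c z * s ^+ n] is the sum over [m >= n] of the bounds [K * s ^+ m * g z] on the increments;
   shifting the iterates down or up by it makes them monotone. *)
pose c z := K * g z / (1 - s).
pose low n z := k n z - c z * s ^+ n.
have lowS z : D z -> nondecreasing_seq (low^~ z).
  move=> Dz; apply/nondecreasing_seqP => n; rewrite /low /=.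
  have := kd n z Dz; rewrite ler_norml => /andP[h _].
  have -> : c z * s ^+ n.+1 = c z * s ^+ n - K * s ^+ n * g z.
    by rewrite /c exprS; field; lra.
  move: h; lra.
have c0 z : D z -> 0 <= c z.
  by move=> Dz; rewrite /c divr_ge0 ?mulr_ge0 ?g0 // ltW.
have lowb z n : D z -> low n z <= K * g z.
  move=> Dz; rewrite /low.
  have := kb n z Dz; rewrite ler_norml => /andP[_ h].
  have : 0 <= c z * s ^+ n by rewrite mulr_ge0 ?c0 ?exprn_ge0.
  lra.
have lowc z : D z -> cvgn (low^~ z).
  move=> Dz; apply: nondecreasing_is_cvgn; first exact: lowS.
  by exists (K * g z) => _ [n _ <-]; exact: lowb.
pose u z := limn (low^~ z).
have highS z : D z -> nonincreasing_seq (fun n => k n z + c z * s ^+ n).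
  move=> Dz; apply/nonincreasing_seqP => n.
  have := kd n z Dz; rewrite ler_norml => /andP[_ h].
  have -> : c z * s ^+ n.+1 = c z * s ^+ n - K * s ^+ n * g z.
    by rewrite /c exprS; field; lra.
  move: h; lra.
have ud n z : D z -> `|u z - k n z| <= c z * s ^+ n.
  move=> Dz; rewrite ler_norml; apply/andP; split.
    have : low n z <= u z.
      exact: (nondecreasing_cvgn_le (lowS _ Dz) (lowc _ Dz) n).
    rewrite /low; lra.
  have : u z <= k n z + c z * s ^+ n; last by lra.
  apply: limr_le; first exact: lowc.
  near=> m.
  have nm : (n <= m)%N by near: m; exact: nbhs_infty_ge.
  apply: le_trans (highS _ Dz _ _ nm).
  have : 0 <= c z * s ^+ m by rewrite mulr_ge0 ?c0 ?exprn_ge0.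
  rewrite /low; lra.
have ub z : D z -> `|u z| <= K * g z.
  move=> Dz; rewrite -subr_le0; apply: (ler_geometric_eq0 (C := c z) s01) => n.
  have := ud n z Dz; have := kb n z Dz; have := ler_normD (u z - k n z) (k n z).
  rewrite subrK; lra.
exists u => z Dz; split; first exact: ub.
apply/eqP; rewrite -subr_eq0 -normr_le0.
apply: (ler_geometric_eq0 (C := 2 * c z) s01) => n.
have h1 := ud n.+1 z Dz.
(* Here [r = K / (1 - s) * s ^+ n], the distance from the iterate to the limit in units of [g]. *)
have h2 : `|Phi z (k n z) (k n (T z)) - Phi z (u z) (u (T z))| <=
    s * (K / (1 - s) * s ^+ n) * g z.
  have e x : K / (1 - s) * s ^+ n * g x = c x * s ^+ n by rewrite /c; ring.
  apply: Phic => //; try by [exact: kb | exact: ub | exact: (kb _ _ (DT Dz))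
    | exact: (ub _ (DT Dz))].
  - by rewrite mulr_ge0 ?exprn_ge0 // divr_ge0 // ltW.
  - by rewrite distrC e; exact: ud.
  - by rewrite distrC e; exact: (ud n _ (DT Dz)).
have e : s * (K / (1 - s) * s ^+ n) * g z = c z * s ^+ n.+1.
  by rewrite /c exprS; ring.
have := ler_normD (u z - k n.+1 z) (k n.+1 z - Phi z (u z) (u (T z))).
rewrite addrA subrK => h3; apply: (le_trans h3).
have : c z * s ^+ n.+1 <= c z * s ^+ n.
  by apply: ler_wpM2l; [exact: c0 | rewrite exprS ler_piMl ?exprn_ge0 // ltW].
move: h1 h2; rewrite e kS; lra.
Unshelve. all: end_near.
Qed.

Lemma weighted_linear_fixpoint (a c g : X -> R) (C s : R) :
  0 <= s < 1 -> 0 <= C -> (forall z, D z -> 0 <= g z) ->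
  (forall z, D z -> `|a z| * g (T z) <= s * g z) ->
  (forall z, D z -> `|c z| <= C * g z) ->
  exists u : X -> R, forall z, D z ->
    `|u z| <= C / (1 - s) * g z /\ u z = a z * u (T z) + c z.
Proof.
move=> s01 C0 g0 ag cg; have /andP[s0 s1] := s01.
have s10 : 0 < 1 - s by lra.
have K0 : 0 <= C / (1 - s) by rewrite divr_ge0 // ltW.
(* The radius [C / (1 - s)] solves [t = C + s t], so the ball is mapped into itself. *)
have e : C = C / (1 - s) - s * (C / (1 - s)) by field; lra.
apply: (@weighted_fixpoint (fun z _ t => a z * t + c z) g _ s) => //.
- move=> z _ b Dz _ hb; apply: (le_trans (ler_normD _ _)); rewrite normrM.
  have h1 := ler_wpM2l (normr_ge0 (a z)) hb.
  have h2 := ler_wpM2l K0 (ag z Dz).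
  have h3 := cg z Dz; rewrite [in X in _ <= X]e in h3.
  nra.
- move=> z _ _ b b' r Dz r0 _ _ _ _ _ hb.
  rewrite (_ : _ - _ = a z * (b - b')); last by ring.
  rewrite normrM.
  have h1 := ler_wpM2l (normr_ge0 (a z)) hb.
  have h2 := ler_wpM2l r0 (ag z Dz).
  nra.
Qed.

End Contraction.

(** * Families of fiber maps *)

(* lra ignores section hypotheses (whence local copies such as [q1' := q1]),
   slows down with the size of the context, and rejects a context from which
   section variables have been cleared. *)
Ltac section_fact H := fail.

Ltac clear_facts := repeat match goal with
  | H : is_true _ |- _ => tryif section_fact H then fail else clear H
  | H : _ = _ |- _ => tryif section_fact H then fail else clear H
  end.

Ltac lra_only := clear_facts; lra.

Section Families.
Variables (R : realType) (B : Type) (rho : B -> B -> R).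
Hypothesis rho_ge0 : forall b b', 0 <= rho b b'.
Implicit Types (b : B) (u v : B -> R -> R) (e C x y : R).

(** A single constant serves the three bounds, so that algebraic operations need not track them
    separately. When [rho] is comparable to a power of the distance, the third bound is the Hoelder
    estimate in the base point. *)
Definition lipschitz_family e u : Prop :=
  exists2 C : R, 0 <= C & forall b b' (x x' : R), 0 <= x <= e -> 0 <= x' <= e ->
    [/\ `|u b x| <= C, `|u b x - u b x'| <= C * `|x - x'| &
        `|u b x - u b' x| <= C * rho b b'].

(* Derivatives are given by a quadratic remainder rather than by a limit: all
   closure properties are then plain inequalities. *)
Definition taylor1 e u v : Prop :=
  exists2 C : R, 0 <= C & forall b (x x' : R), 0 <= x <= e -> 0 <= x' <= e ->
    `|u b x' - u b x - v b x * (x' - x)| <= C * `|x' - x| ^+ 2.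

(** Level [j] is uniform class [C^{j,1}] in [x], with every derivative also [rho]-Lipschitz in [b].
    The derivative is existential, so that any solution of a differentiated equation can be supplied
    for it. *)
Fixpoint smooth_family (j : nat) e u : Prop :=
  lipschitz_family e u /\
  if j is i.+1 then exists v, smooth_family i e v /\ taylor1 e u v else True.

Lemma smooth_lipschitz j e u :
  smooth_family j e u -> lipschitz_family e u.
Proof. by case: j => [|j] []. Qed.

Lemma smooth_familyW j e u : smooth_family j.+1 e u -> smooth_family j e u.
Proof.
elim: j u => [|j IH] u [u0 [v [vs uv]]]; first by split.
by split=> //; exists v; split => //; exact: IH.
Qed.

Lemma smooth_family_le i j e u : (i <= j)%N ->
  smooth_family j e u -> smooth_family i e u.
Proof.
by move=> /subnK <-; elim: (j - i)%N => // n IH /smooth_familyW.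
Qed.

Lemma smooth_familyS j e u v : lipschitz_family e u -> taylor1 e u v ->
  smooth_family j e v -> smooth_family j.+1 e u.
Proof. by move=> *; split => //; exists v. Qed.

Lemma eq_lipschitz e u v :
  (forall b x, 0 <= x <= e -> u b x = v b x) ->
  lipschitz_family e u -> lipschitz_family e v.
Proof.
move=> uv [C C0 h]; exists C => // b b' x x' xe xe'.
by rewrite -!uv //; exact: h.
Qed.

Lemma eq_smooth_family j e u v :
  (forall b x, 0 <= x <= e -> u b x = v b x) ->
  smooth_family j e u -> smooth_family j e v.
Proof.
case: j => [|j] uv [/(eq_lipschitz uv) u0]; first by split.
move=> [w [ws [C C0 h]]]; split=> //; exists w; split => //.
by exists C => // b x x' xe xe'; rewrite -!uv //; exact: h.
Qed.

Lemma ler_normM (a b A D : R) : `|a| <= A -> `|b| <= D -> `|a * b| <= A * D.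
Proof. by move=> ? ?; rewrite normrM ler_pM. Qed.

Lemma ler_normMB (a a' b b' A D da db : R) :
  `|a| <= A -> `|b'| <= D -> `|a - a'| <= da -> `|b - b'| <= db ->
  `|a * b - a' * b'| <= A * db + da * D.
Proof.
move=> hA hB ha hb.
have -> : a * b - a' * b' = a * (b - b') + (a - a') * b' by ring.
by apply: le_trans (ler_normD _ _) _; apply: lerD; apply: ler_normM.
Qed.

Lemma ler_normD2 (a b A D : R) : `|a| <= A -> `|b| <= D -> `|a + b| <= A + D.
Proof. by move=> ? ?; apply: le_trans (ler_normD _ _) _; apply: lerD. Qed.

Lemma lipschitz_add e u v : lipschitz_family e u ->
  lipschitz_family e v -> lipschitz_family e (fun b x => u b x + v b x).
Proof.
move=> [C C0 hu] [C' C0' hv]; exists (C + C'); first exact: addr_ge0.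
move=> b b' x x' xe xe'.
have [u1 u2 u3] := hu b b' x x' xe xe'; have [v1 v2 v3] := hv b b' x x' xe xe'.
split; rewrite ?opprD ?mulrDl; [|rewrite addrACA..]; exact: ler_normD2.
Qed.

Lemma lipschitz_mul e u v : lipschitz_family e u ->
  lipschitz_family e v -> lipschitz_family e (fun b x => u b x * v b x).
Proof.
move=> [C C0 hu] [C' C0' hv].
have CC : 0 <= C * C' by exact: mulr_ge0.
exists (2 * (C * C')); first by lra.
move=> b b' x x' xe xe'.
have [u1 u2 u3] := hu b b' x x' xe xe'; have [v1 v2 v3] := hv b b' x x' xe xe'.
have [v1' _ _] := hv b b' x' x xe' xe; have [v1'' _ _] := hv b' b x x' xe xe'.
split.
- by apply: le_trans (ler_normM u1 v1) _; lra.
- by apply: le_trans (ler_normMB u1 v1' u2 v2) _; lra.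
- by apply: le_trans (ler_normMB u1 v1'' u3 v3) _; lra.
Qed.

Lemma lipschitz_inv e u (m : R) : 0 < m ->
  (forall b x, 0 <= x <= e -> m <= u b x) ->
  lipschitz_family e u -> lipschitz_family e (fun b x => (u b x)^-1).
Proof.
move=> m0 mu [C C0 hu].
have mi0 : 0 <= m^-1 by rewrite invr_ge0 ltW.
have mb b x : 0 <= x <= e -> `|(u b x)^-1| <= m^-1.
  move=> xe; have ux := mu b x xe; have u0 : 0 < u b x by lra.
  by rewrite ger0_norm ?lef_pV2 ?posrE // invr_ge0 ltW.
have md b b' x x' E : 0 <= x <= e -> 0 <= x' <= e ->
    `|u b x - u b' x'| <= E ->
    `|(u b x)^-1 - (u b' x')^-1| <= m^-1 * m^-1 * E.
  move=> xe xe' h.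
  have ux := mu b x xe; have u0 : 0 < u b x by lra.
  have ux' := mu b' x' xe'; have u0' : 0 < u b' x' by lra.
  have -> : (u b x)^-1 - (u b' x')^-1 =
    (u b x)^-1 * (u b' x')^-1 * - (u b x - u b' x') by field; lra.
  by apply: ler_normM; [apply: ler_normM; exact: mb | rewrite normrN].
exists (m^-1 + m^-1 * m^-1 * C); first by rewrite addr_ge0 ?mulr_ge0.
move=> b b' x x' xe xe'.
have [u1 u2 u3] := hu b b' x x' xe xe'.
have z1 := normr_ge0 (x - x'); have z2 := rho_ge0 b b'.
have h0 : 0 <= m^-1 * m^-1 * C by rewrite !mulr_ge0.
split.
- by have := mb b x xe; lra.
- apply: (le_trans (md _ _ _ _ _ xe xe' u2)).
  by rewrite mulrDl mulrA lerDr mulr_ge0.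
- apply: (le_trans (md _ _ _ _ _ xe xe u3)).
  by rewrite mulrDl mulrA lerDr mulr_ge0.
Qed.

Lemma lipschitz_comp e e1 phi u : lipschitz_family e1 phi ->
  (forall b x, 0 <= x <= e -> 0 <= u b x <= e1) ->
  lipschitz_family e u -> lipschitz_family e (fun b x => phi b (u b x)).
Proof.
move=> [C C0 hp] ue [C' C0' hu].
have CC : 0 <= C * C' by exact: mulr_ge0.
exists (C + C * C'); first exact: addr_ge0.
move=> b b' x x' xe xe'.
have [u1 u2 u3] := hu b b' x x' xe xe'.
have [p1 p2 p3] := hp b b' (u b x) (u b x') (ue _ _ xe) (ue _ _ xe').
have [_ p2' _] := hp b' b (u b x) (u b' x) (ue _ _ xe) (ue _ _ xe).
have h1 := ler_wpM2l C0 u2; have h2 := ler_wpM2l C0 u3.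
have z1 := mulr_ge0 C0 (normr_ge0 (x - x')).
have z2 := mulr_ge0 C0 (rho_ge0 b b').
split; [lra | rewrite mulrDl; lra |].
rewrite (_ : _ - _ = (phi b (u b x) - phi b' (u b x)) +
  (phi b' (u b x) - phi b' (u b' x))); last by ring.
by rewrite [X in _ <= X]mulrDl; apply: ler_normD2 => //; lra.
Qed.

Lemma smooth_add j e u v : smooth_family j e u -> smooth_family j e v ->
  smooth_family j e (fun b x => u b x + v b x).
Proof.
elim: j u v => [|j IH] u v [u0 hu] [v0 hv].
  by split=> //; exact: lipschitz_add.
have [u1 [u1s [C C0 hC]]] := hu; have [v1 [v1s [C' C0' hC']]] := hv.
apply: (smooth_familyS (v := fun b x => u1 b x + v1 b x)).
- exact: lipschitz_add.
- exists (C + C'); first exact: addr_ge0.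
  move=> b x x' xe xe'; rewrite [X in _ <= X]mulrDl.
  rewrite (_ : _ - _ = (u b x' - u b x - u1 b x * (x' - x)) +
    (v b x' - v b x - v1 b x * (x' - x))); last by ring.
  by apply: ler_normD2; auto.
- exact: IH.
Qed.

Lemma smooth_mul j e u v : smooth_family j e u -> smooth_family j e v ->
  smooth_family j e (fun b x => u b x * v b x).
Proof.
elim: j u v => [|j IH] u v hu hv.
  by split=> //; apply: lipschitz_mul; apply: (smooth_lipschitz (j := 0)).
have us := smooth_familyW hu; have vs := smooth_familyW hv.
have u0 := smooth_lipschitz us; have v0 := smooth_lipschitz vs.
have [_ [u1 [u1s [C C0 hC]]]] := hu; have [_ [v1 [v1s [C' C0' hC']]]] := hv.
apply: (smooth_familyS (v := fun b x => u b x * v1 b x + u1 b x * v b x)).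
- exact: lipschitz_mul.
- have [Cu Cu0 hu0] := u0; have [Cv Cv0 hv0] := v0.
  have [Dv Dv0 hv1] := smooth_lipschitz v1s.
  exists (Cu * C' + Cu * Dv + C * Cv); first by rewrite !addr_ge0 ?mulr_ge0.
  move=> b x x' xe xe'.
  rewrite (_ : _ - _ = u b x' * (v b x' - v b x - v1 b x * (x' - x)) +
    (u b x' - u b x) * (v1 b x * (x' - x)) +
    (u b x' - u b x - u1 b x * (x' - x)) * v b x); last by ring.
  have [k1 k2 _] := hu0 b b x' x xe' xe; have [k3 _ _] := hv0 b b x x xe xe.
  have [k4 _ _] := hv1 b b x x xe xe.
  rewrite [X in _ <= X]mulrDl [X in _ <= X + _]mulrDl; apply: ler_normD2; first apply: ler_normD2.
  + by rewrite -mulrA; apply: ler_normM => //; exact: hC'.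
  + rewrite (_ : Cu * Dv * _ = (Cu * `|x' - x|) * (Dv * `|x' - x|)); last ring.
    by apply: ler_normM => //; exact: ler_normM.
  + by rewrite mulrAC; apply: ler_normM => //; exact: hC.
- by apply: smooth_add; apply: IH.
Qed.

Lemma smooth_cst j e (l : B -> R) C : 0 <= C -> (forall b, `|l b| <= C) ->
  (forall b b', `|l b - l b'| <= C * rho b b') ->
  smooth_family j e (fun b _ => l b).
Proof.
elim: j l C => [|j IH] l C C0 lC lH.
  split=> //; exists C => // b b' x x' _ _; split => //.
  by rewrite subrr normr0 mulr_ge0.
apply: (smooth_familyS (v := fun _ _ => 0)).
- exists C => // b b' x x' _ _; split => //.
  by rewrite subrr normr0 mulr_ge0.
- by exists 0 => // b x x' _ _; rewrite subrr mul0r subr0 normr0 mul0r.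
- apply: (IH (fun=> 0) 0) => // *; first by rewrite normr0.
  by rewrite subrr normr0 mul0r.
Qed.

Lemma smooth_const j e (c : R) : smooth_family j e (fun _ _ => c).
Proof.
apply: (@smooth_cst j e (fun=> c) `|c|) => // *.
by rewrite subrr normr0 mulr_ge0.
Qed.

Lemma smooth_id j e : 0 <= e -> smooth_family j e (fun _ x => x).
Proof.
move=> e0.
have h0 : lipschitz_family e (fun _ x => x).
  exists (e + 1) => [|b b' x x' /andP[x0 xe] _]; first by lra.
  split; first by rewrite ger0_norm //; lra.
    by rewrite ler_peMl //; lra.
  by rewrite subrr normr0 mulr_ge0 //; lra.
case: j => [|j]; first by split.
apply: (smooth_familyS (v := fun _ _ => 1)) => //; last exact: smooth_const.
by exists 0 => // b x x' _ _; rewrite mul1r subrr normr0 mul0r.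
Qed.

Lemma smooth_inv j e u (m : R) : 0 < m ->
  (forall b x, 0 <= x <= e -> m <= u b x) ->
  smooth_family j e u -> smooth_family j e (fun b x => (u b x)^-1).
Proof.
move=> m0 mu; elim: j => [|j IH] hu.
  by split=> //; apply: (lipschitz_inv m0 mu); case: hu.
have us := smooth_familyW hu; have u0 := smooth_lipschitz us.
have [_ [u1 [u1s [C C0 hC]]]] := hu.
have mi0 : 0 <= m^-1 by rewrite invr_ge0 ltW.
have mb b x : 0 <= x <= e -> `|(u b x)^-1| <= m^-1.
  move=> xe; have ux := mu b x xe; have u0' : 0 < u b x by lra.
  by rewrite ger0_norm ?lef_pV2 ?posrE // invr_ge0 ltW.
apply: (smooth_familyS
  (v := fun b x => -1 * (u1 b x * ((u b x)^-1 * (u b x)^-1)))).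
- exact: (lipschitz_inv m0 mu u0).
- have [D D0 hD] := u0; set M := m^-1.
  exists (M * M * C + M * M * M * (D * D)).
    by rewrite !addr_ge0 ?mulr_ge0.
  move=> b x x' xe xe'.
  have ux := mu b x xe; have u0' : 0 < u b x by lra.
  have ux' := mu b x' xe'; have u0'' : 0 < u b x' by lra.
  rewrite (_ : _ - _ =
    (u b x)^-1 * (u b x)^-1 * - (u b x' - u b x - u1 b x * (x' - x)) +
    (u b x)^-1 * (u b x)^-1 * (u b x')^-1 *
      ((u b x' - u b x) * (u b x' - u b x))); last by field; lra.
  have [_ k _] := hD b b x' x xe' xe.
  rewrite [X in _ <= X]mulrDl; apply: ler_normD2.
    rewrite -[X in _ <= X]mulrA.
    apply: ler_normM; first by apply: ler_normM; exact: mb.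
    by rewrite normrN; exact: hC.
  rewrite (_ : _ * `|x' - x| ^+ 2 =
    M * M * M * ((D * `|x' - x|) * (D * `|x' - x|))); last by ring.
  apply: ler_normM; last exact: ler_normM.
  by apply: ler_normM; [apply: ler_normM|]; exact: mb.
- apply: smooth_mul; first exact: smooth_const.
  by apply: smooth_mul => //; apply: smooth_mul; exact: IH.
Qed.

Lemma smooth_comp j e e1 phi u : smooth_family j e1 phi ->
  (forall b x, 0 <= x <= e -> 0 <= u b x <= e1) ->
  smooth_family j e u -> smooth_family j e (fun b x => phi b (u b x)).
Proof.
(* The outer family is generalized and the inner one kept: the derivative is
   [p1 b (u b x) * u1 b x], where [p1] is one level below [phi]. *)
move=> hp ue; elim: j phi hp => [|j IH] phi hp hu.
  by split=> //; apply: lipschitz_comp ue _; [case: hp|case: hu].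
have us := smooth_familyW hu.
have [p0 [p1 [p1s [C C0 hC]]]] := hp.
have [u0 [u1 [u1s [C' C0' hC']]]] := hu.
apply: (smooth_familyS (v := fun b x => p1 b (u b x) * u1 b x)).
- exact: (lipschitz_comp p0 ue u0).
- have [D D0 hD] := u0; have [E E0 hE] := smooth_lipschitz p1s.
  exists (C * D ^+ 2 + E * C').
    by rewrite addr_ge0 ?mulr_ge0 ?exprn_ge0.
  move=> b x x' xe xe'.
  rewrite (_ : _ - _ =
    (phi b (u b x') - phi b (u b x) - p1 b (u b x) * (u b x' - u b x)) +
    p1 b (u b x) * (u b x' - u b x - u1 b x * (x' - x))); last by ring.
  have [_ k _] := hD b b x' x xe' xe.
  have [k' _ _] := hE b b (u b x) (u b x) (ue _ _ xe) (ue _ _ xe).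
  rewrite [X in _ <= X]mulrDl; apply: ler_normD2.
    apply: (le_trans (hC _ _ _ (ue _ _ xe) (ue _ _ xe'))).
    rewrite -mulrA -exprMn; apply: ler_wpM2l => //.
    by rewrite lerXn2r ?nnegrE // mulr_ge0.
  by rewrite -mulrA; apply: ler_normM => //; exact: hC'.
- by apply: smooth_mul => //; exact: IH.
Qed.

(** * Regularity of solutions of linear equations along the skew product *)

Section Cocycle.
Variables (T : B -> B) (theta : R) (lam : B -> R) (q Cl : R).
Hypothesis rhoT : forall b b', rho (T b) (T b') <= theta * rho b b'.
Hypothesis theta_ge1 : 1 <= theta.
Hypothesis lamP : forall b, 0 <= lam b <= q.
Hypothesis q1 : q < 1.
Hypothesis qtheta : q * theta < 1.
Hypothesis Cl0 : 0 <= Cl.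
Hypothesis lam_holder : forall b b', `|lam b - lam b'| <= Cl * rho b b'.
Variable e : R.

Ltac section_fact H ::=
  first [constr_eq H theta_ge1 | constr_eq H q1 | constr_eq H qtheta
        | constr_eq H Cl0].

Local Lemma lam_le1 b : lam b <= 1.
Proof. by have /andP[_ lq] := lamP b; apply: le_trans lq (ltW q1). Qed.

Local Lemma lamx b x : 0 <= x <= e -> 0 <= lam b * x <= e.
Proof.
have [q1' qtheta'] := (q1, qtheta); have [theta1 Cl0'] := (theta_ge1, Cl0).
move=> /andP[x0 xe]; have /andP[l0 lq] := lamP b.
rewrite mulr_ge0 //=; apply: le_trans xe; rewrite ler_piMl //; lra.
Qed.

Lemma lipschitz_shift u : lipschitz_family e u ->
  lipschitz_family e (fun b x => u (T b) (lam b * x)).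
Proof.
have [q1' qtheta'] := (q1, qtheta); have [theta1 Cl0'] := (theta_ge1, Cl0).
move=> [C C0 h]; have [e0|e0] := leP 0 e; last first.
  by exists 0 => // b b' x x' /andP[x0 xe]; lra.
exists (C + C * theta + C * (Cl * e)).
  by rewrite !addr_ge0 ?mulr_ge0 //; lra.
move=> b b' x x' xe xe'; have /andP[l0 lq] := lamP b.
have lx := lamx b xe; have lx' := lamx b xe'; have lxb := lamx b' xe.
have [h1 h2 h3] := h (T b) (T b') _ _ lx lx'.
have [_ h2' _] := h (T b') (T b') _ _ lx lxb.
have th0 : 0 <= theta by lra.
have z1 := mulr_ge0 C0 th0; have z2 := mulr_ge0 C0 (mulr_ge0 Cl0 e0).
have r0 := rho_ge0 b b'.
split; first by lra.
  rewrite -mulrBr normrM ger0_norm // in h2.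
  have n0 := normr_ge0 (x - x').
  have : lam b * `|x - x'| <= `|x - x'| by rewrite ler_piMl //; lra.
  move=> /(ler_wpM2l C0); have := mulr_ge0 z1 n0; have := mulr_ge0 z2 n0; lra.
rewrite (_ : _ - _ = (u (T b) (lam b * x) - u (T b') (lam b * x)) +
  (u (T b') (lam b * x) - u (T b') (lam b' * x))); last by ring.
have k1 := ler_wpM2l C0 (rhoT b b').
rewrite -mulrBl in h2'.
have /andP[x0 xle] := xe.
have k2 : `|(lam b - lam b') * x| <= Cl * rho b b' * e.
  by apply: ler_normM => //; rewrite ger0_norm.
have k3 := ler_wpM2l C0 k2.
have := ler_normD2 h3 h2'; have := mulr_ge0 C0 r0; lra.
Qed.

Lemma smooth_lam j : smooth_family j e (fun b _ => lam b).
Proof.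
have [q1' qtheta'] := (q1, qtheta); have [theta1 Cl0'] := (theta_ge1, Cl0).
apply: (@smooth_cst j e lam (1 + Cl)) => [|b|b b']; first by lra.
  by have /andP[l0 lq] := lamP b; rewrite ger0_norm //; lra.
by apply: (le_trans (lam_holder b b')); rewrite ler_wpM2r //; lra.
Qed.

Lemma smooth_shift j u : smooth_family j e u ->
  smooth_family j e (fun b x => u (T b) (lam b * x)).
Proof.
have [q1' qtheta'] := (q1, qtheta); have [theta1 Cl0'] := (theta_ge1, Cl0).
elim: j u => [|j IH] u hu.
  by split=> //; apply: lipschitz_shift; case: hu.
have [u0 [u1 [u1s [C C0 hC]]]] := hu.
apply: (smooth_familyS (v := fun b x => lam b * u1 (T b) (lam b * x))).
- exact: lipschitz_shift.
- exists C => // b x x' xe xe'; have /andP[l0 lq] := lamP b.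
  have := hC (T b) _ _ (lamx b xe) (lamx b xe').
  rewrite -mulrBr mulrCA -!mulrA normrM (ger0_norm l0) exprMn.
  move=> h; apply: (le_trans h); rewrite ler_wpM2l // ler_piMl ?exprn_ge0 //.
  by rewrite expr_le1 //; lra.
- by apply: smooth_mul; [exact: smooth_lam | exact: IH].
Qed.

Variables (p : R -> R) (P : R).
Hypothesis pP : forall x, 0 <= x <= e -> 1 <= p x <= P.

Local Lemma p_leP x : 0 <= x <= e -> p x <= P.
Proof. by move=> /pP /andP[]. Qed.

(** The difference of two values of [u] is iterated, for two points of one fibre and then for one
    height over two base points. The order matters: [lam b * x] and [lam b' * x] differ, so the
    second estimate uses the Lipschitz constant of the first. The factors per step are [q] and
    [q * theta]. *)
Lemma linear_lipschitz a c u (K : R) :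
  lipschitz_family e a -> lipschitz_family e c ->
  (forall b x, 0 <= x <= e -> `|a b x| * p (lam b * x) <= q * p x) ->
  (forall b x, 0 <= x <= e -> `|u b x| <= K) ->
  (forall b x, 0 <= x <= e ->
     u b x = a b x * u (T b) (lam b * x) + c b x) ->
  lipschitz_family e u.
Proof.
have [q1' qtheta'] := (q1, qtheta); have [theta1 Cl0'] := (theta_ge1, Cl0).
move=> [Ca Ca0 ha] [Cc Cc0 hc] aq uK uE.
have s1 : 0 <= 1 - q by rewrite subr_ge0 ltW.
have s2 : 0 <= 1 - q * theta by rewrite subr_ge0 ltW.
have th0 := le_trans ler01 theta_ge1.
have [e0|e0] := leP 0 e; last first.
  by exists 0 => // b b' x x' /andP[x0 xe]; lra.
have p0 x : 0 <= x <= e -> 0 <= p x by move=> /pP; lra.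
have P1 : 1 <= P.
  by have e00 : 0 <= (0 : R) <= e; [rewrite lexx | have := pP e00; lra].
(* A base point gives [0 <= q] and [0 <= K]; over an empty base the claim is vacuous. *)
have [[b0 _]|nb] := pselect (exists b : B, True); last first.
  by exists 0 => // b; case: nb; exists b.
have q0 : 0 <= q by have := lamP b0; lra.
have K0 : 0 <= K.
  by apply: (le_trans (normr_ge0 (u b0 0))); apply: uK; rewrite lexx.
have ger0M3 (x y z t : R) : 0 <= z -> x * y <= q * t -> x * (z * y) <= q * (z * t).
  by move=> z0 /(ler_wpM2l z0); lra.
pose L := (Ca * K + Cc) / (1 - q) * P.
have c1 : 0 <= Ca * K + Cc by rewrite addr_ge0 ?mulr_ge0.
have L0 : 0 <= L by rewrite mulr_ge0 ?divr_ge0 // (le_trans ler01 P1).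
have uL b x x' : 0 <= x <= e -> 0 <= x' <= e ->
    `|u b x - u b x'| <= L * `|x - x'|.
  move=> xe xe'.
  pose D (z : B * R * R) := 0 <= z.1.2 <= e /\ 0 <= z.2 <= e.
  have := @discount R _ (fun z : B * R * R =>
    (T z.1.1, lam z.1.1 * z.1.2, lam z.1.1 * z.2)) D.
  move=> /(_ _ (fun z => `|u z.1.1 z.1.2 - u z.1.1 z.2|) (fun z => p z.1.2)
    (fun z => `|z.1.2 - z.2| * p z.1.2) (fun z => `|a z.1.1 z.1.2|)
    (2 * K) (Ca * K + Cc) q).
  have -> : L * `|x - x'| = (Ca * K + Cc) / (1 - q) * (`|x - x'| * P).
    by rewrite /L; ring.
  move=> H; have {H} : `|u b x - u b x'| <=
      (Ca * K + Cc) / (1 - q) * (`|x - x'| * p x).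
    apply: (H _ _ _ _ _ _ _ _ _ _ (b, x, x')) => //.
    - by move=> [[b1 y] y'] [] /=; split; exact: lamx.
    - by rewrite q0.
    - by move=> [[b1 y] y'] [/= h1 h2]; rewrite mulr_ge0 // p0.
    - move=> [[b1 y] y'] [/= h1 h2]; have /andP[k _] := pP h1.
      apply: (le_trans (ler_normB _ _)).
      by move: (uK b1 y h1) (uK b1 y' h2) (ler_wpM2l K0 k); lra_only.
    - move=> [[b1 y] y'] [/= h1 h2].
      have k := uK (T b1) _ (lamx b1 h2).
      have [_ a1 _] := ha b1 b1 _ _ h1 h2; have [_ c2 _] := hc b1 b1 _ _ h1 h2.
      rewrite uE // [u b1 y']uE //.
      rewrite (_ : _ - _ = a b1 y * (u (T b1) (lam b1 * y) - u (T b1) (lam b1 * y'))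
        + ((a b1 y - a b1 y') * u (T b1) (lam b1 * y') + (c b1 y - c b1 y')));
        last by ring.
      apply: ler_normD2; first by rewrite normrM.
      apply: (le_trans (ler_normD2 (ler_normM a1 k) c2)).
      have /andP[p1 _] := pP h1.
      by move: (ler_wpM2l (mulr_ge0 c1 (normr_ge0 (y - y'))) p1); lra_only.
    - by move=> [[b1 y] y'] [/= h1 h2]; exact: aq.
    - move=> [[b1 y] y'] [/= h1 h2].
      apply: le_trans (ger0M3 _ _ _ _ (normr_ge0 _) (aq b1 y h1)).
      rewrite ler_wpM2l // ler_wpM2r ?p0 //; first exact: lamx.
      rewrite -mulrBr normrM; have /andP[l0 lq] := lamP b1.
      by rewrite ger0_norm // ler_piMl ?lam_le1.
    - by rewrite mulr_ge0.
  move=> h; apply: (le_trans h); apply: ler_wpM2l.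
    by rewrite divr_ge0.
  by rewrite ler_wpM2l // p_leP.
(* The first summand pays for the two heights [lam b * x] and [lam b' * x], the second for the
   variation of [a] and [c]. *)
pose c2 := Ca * (L * (Cl * e)) + (Ca * K + Cc).
have c20 : 0 <= c2 by apply: addr_ge0 => //; do !apply: mulr_ge0 => //.
pose N := c2 / (1 - q * theta) * P.
have N0 : 0 <= N by rewrite mulr_ge0 ?divr_ge0 // (le_trans ler01 P1).
have uN b b' x : 0 <= x <= e -> `|u b x - u b' x| <= N * rho b b'.
  move=> xe.
  pose D (z : B * B * R) := 0 <= z.2 <= e.
  have := @discount R _ (fun z : B * B * R =>
    (T z.1.1, T z.1.2, lam z.1.1 * z.2)) D.
  move=> /(_ _ (fun z => `|u z.1.1 z.2 - u z.1.2 z.2|) (fun z => p z.2)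
    (fun z => rho z.1.1 z.1.2 * p z.2) (fun z => `|a z.1.1 z.2|)
    (2 * K) c2 (q * theta)).
  have -> : N * rho b b' = c2 / (1 - q * theta) * (rho b b' * P).
    by rewrite /N; ring.
  move=> H; have {H} : `|u b x - u b' x| <=
      c2 / (1 - q * theta) * (rho b b' * p x).
    apply: (H _ _ _ _ _ _ _ _ _ _ (b, b', x)) => //.
    - by move=> [[b1 b2] y] /= h; exact: lamx.
    - by rewrite qtheta mulr_ge0.
    - by move=> [[b1 b2] y] /= h; rewrite mulr_ge0 // p0.
    - move=> [[b1 b2] y] /= h; have /andP[k _] := pP h.
      apply: (le_trans (ler_normB _ _)).
      by move: (uK b1 y h) (uK b2 y h) (ler_wpM2l K0 k); lra_only.
    - move=> [[b1 b2] y] /= h; rewrite /D /= in h.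
      have k := uK (T b2) _ (lamx b2 h).
      have [a0 _ a1] := ha b1 b2 _ _ h h; have [_ _ c3] := hc b1 b2 _ _ h h.
      have kL := uL (T b2) _ _ (lamx b1 h) (lamx b2 h).
      have /andP[y0 ye] := h.
      have kl : `|lam b1 * y - lam b2 * y| <= Cl * rho b1 b2 * e.
        by rewrite -mulrBl; apply: ler_normM => //; rewrite ger0_norm.
      have {kL kl} kL := le_trans kL (ler_wpM2l L0 kl).
      rewrite uE // [u b2 y]uE //.
      rewrite (_ : _ - _ = a b1 y * (u (T b1) (lam b1 * y) - u (T b2) (lam b1 * y))
        + (a b1 y * (u (T b2) (lam b1 * y) - u (T b2) (lam b2 * y)) +
        ((a b1 y - a b2 y) * u (T b2) (lam b2 * y) + (c b1 y - c b2 y))));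
        last by ring.
      apply: ler_normD2; first by rewrite normrM.
      apply: (le_trans (ler_normD2 (ler_normM a0 kL)
        (ler_normD2 (ler_normM a1 k) c3))).
      have /andP[p1 _] := pP h.
      by move: (ler_wpM2l (mulr_ge0 c20 (rho_ge0 b1 b2)) p1); rewrite /c2; lra_only.
    - move=> [[b1 b2] y] /= h; apply: (le_trans (aq b1 y h)).
      by rewrite ler_wpM2r ?p0 // ler_peMr.
    - move=> [[b1 b2] y] /= h.
      have z0 : 0 <= theta * rho b1 b2 by rewrite mulr_ge0.
      move: (ger0M3 _ _ _ _ z0 (aq b1 y h)).
      move: (ler_wpM2r (mulr_ge0 (normr_ge0 (a b1 y)) (p0 _ (lamx b1 h))) (rhoT b1 b2)).
      lra_only.
    - by rewrite mulr_ge0.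
  move=> h; apply: (le_trans h); apply: ler_wpM2l.
    by rewrite divr_ge0.
  by rewrite ler_wpM2l // p_leP.
exists (K + L + N); first by rewrite !addr_ge0.
move=> b b' x x' xe xe'; rewrite !mulrDl.
have r0 := rho_ge0 b b'; have n0 := normr_ge0 (x - x').
move: (mulr_ge0 K0 r0) (mulr_ge0 L0 r0) (mulr_ge0 K0 n0) (mulr_ge0 N0 n0).
move: L0 N0; move: (uK b x xe) (uL b _ _ xe xe') (uN b b' x xe).
by clear_facts; move=> k1 k2 k3 z1 z2 z3 z4 z5 z6; split; lra.
Qed.

Local Lemma ler_wpM4 (A s t P1 r Y : R) : 0 <= t -> 0 <= s -> 0 <= A * P1 ->
  s <= r -> A * P1 <= Y -> A * (s * t * P1) <= r * (t * Y).
Proof.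
move=> t0 s0 AP0 sr APY.
rewrite (_ : A * _ = t * (s * (A * P1))); last by ring.
by rewrite [r * _]mulrCA; apply: ler_wpM2l => //; apply: ler_pM.
Qed.

(** A weight preserved by [a] suffices here, because [u] is already Lipschitz and differentiation
    multiplies [a] by [lam]: the equation of the derivative does contract by [q]. It has the same
    form with other coefficients, hence an induction general in [a], [c], [u]. *)
Lemma linear_smooth j a c u :
  smooth_family j e a -> smooth_family j e c -> lipschitz_family e u ->
  (forall b x, 0 <= x <= e -> `|a b x| * p (lam b * x) <= p x) ->
  (forall b x, 0 <= x <= e ->
     u b x = a b x * u (T b) (lam b * x) + c b x) ->
  smooth_family j e u.
Proof.
have [q1' qtheta'] := (q1, qtheta); have [theta1 Cl0'] := (theta_ge1, Cl0).
have [e0|e0] := leP 0 e; last first.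
  move=> _ _ _ _ _; elim: j u => [|j IH] u; split=> //.
  - by exists 0 => // b b' x x' /andP[x0 xe]; lra.
  - by exists 0 => // b b' x x' /andP[x0 xe]; lra.
  - exists u; split; first exact: IH.
    by exists 0 => // b x x' /andP[x0 xe]; lra.
have p0 x : 0 <= x <= e -> 0 <= p x by move=> /pP; lra.
have P1 : 1 <= P.
  by have e00 : 0 <= (0 : R) <= e; [rewrite lexx | have := pP e00; lra].
have s1 : 0 <= 1 - q by rewrite subr_ge0 ltW.
elim: j a c u => [|j IH] a c u ha hc u0 ap uE; first by split.
(* First [u] itself at level [j], since the inhomogeneity [c'] of the differentiated equation
   contains [u]. *)
have us : smooth_family j e u.
  by apply: (IH a c) => //; exact: smooth_familyW.
have as_ := smooth_familyW ha.
have [_ [a1 [a1s [Ca Ca0 haC]]]] := ha; have [_ [c1 [c1s [Cc Cc0 hcC]]]] := hc.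
have [Ca1 Ca10 ha1] := smooth_lipschitz a1s.
have [Cu Cu0 hu0] := u0.
have [[b0 _]|nb] := pselect (exists b : B, True); last first.
  apply: (smooth_familyS (v := u)) => //.
  by exists 0 => // b; case: nb; exists b.
have q0 : 0 <= q by have := lamP b0; lra.
pose a' b x := a b x * lam b.
pose c' b x := a1 b x * u (T b) (lam b * x) + c1 b x.
have c's : smooth_family j e c'.
  by apply: smooth_add => //; apply: smooth_mul => //; exact: smooth_shift.
have a's : smooth_family j e a'.
  by apply: smooth_mul => //; exact: smooth_lam.
have a'p b x : 0 <= x <= e -> `|a' b x| * p (lam b * x) <= q * p x.
  move=> xe; have /andP[l0 lq] := lamP b.
  rewrite normrM (ger0_norm l0) mulrAC.
  have h := ap b x xe; have z := p0 _ xe.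
  have k0 := mulr_ge0 (normr_ge0 (a b x)) (p0 _ (lamx b xe)).
  by rewrite mulrC; apply: ler_pM.
have [Cc' Cc'0 hc'] := smooth_lipschitz c's.
(* Only a candidate: a solution of the differentiated equation. That it is the derivative of [u] is
   shown last, by iterating the Taylor remainder. *)
have [v vE] : exists v : B * R -> R, forall z, 0 <= z.2 <= e ->
    `|v z| <= Cc' / (1 - q) * p z.2 /\
    v z = a' z.1 z.2 * v (T z.1, lam z.1 * z.2) + c' z.1 z.2.
  apply: (@weighted_linear_fixpoint R _
    (fun z : B * R => (T z.1, lam z.1 * z.2)) (fun z => 0 <= z.2 <= e)
    _ (fun z => a' z.1 z.2) (fun z => c' z.1 z.2) (fun z => p z.2) Cc' q) => //.
  - by move=> [b x] /= h; exact: lamx.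
  - by rewrite q0.
  - by move=> [b x] /= h; exact: p0.
  - by move=> [b x] /= h; exact: a'p.
  - move=> [b x] /= h; have [k _ _] := hc' b b x x h h.
    by apply: (le_trans k); rewrite ler_peMr //; have := pP h; lra.
have v0 : lipschitz_family e (fun b x => v (b, x)).
  apply: (@linear_lipschitz a' c' _ (Cc' / (1 - q) * P)).
  - exact: smooth_lipschitz a's.
  - exact: smooth_lipschitz c's.
  - exact: a'p.
  - move=> b x xe; have [k _] := vE (b, x) xe; apply: (le_trans k).
    by rewrite ler_wpM2l ?divr_ge0 // p_leP.
  - by move=> b x xe; have [_ k] := vE (b, x) xe.
have vs : smooth_family j e (fun b x => v (b, x)).
  apply: (IH a' c') => //; last by move=> b x xe; have [_ k] := vE (b, x) xe.
  move=> b x xe; apply: (le_trans (a'p b x xe)).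
  by rewrite ler_piMl ?p0 // ltW.
apply: (smooth_familyS (v := fun b x => v (b, x))) => //.
have [Cv Cv0 hv] := v0.
pose CC := Ca * Cu + Ca1 * Cu + Cc.
have CC0 : 0 <= CC by rewrite !addr_ge0 ?mulr_ge0.
exists (CC / (1 - q) * P); first by rewrite mulr_ge0 ?divr_ge0 // (le_trans ler01 P1).
move=> b x x' xe xe'.
pose D (z : B * R * R) := 0 <= z.1.2 <= e /\ 0 <= z.2 <= e.
have := @discount R _ (fun z : B * R * R =>
  (T z.1.1, lam z.1.1 * z.1.2, lam z.1.1 * z.2)) D.
move=> /(_ _ (fun z => `|u z.1.1 z.2 - u z.1.1 z.1.2 -
    v (z.1.1, z.1.2) * (z.2 - z.1.2)|) (fun z => `|z.2 - z.1.2| * p z.1.2)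
  (fun z => `|z.2 - z.1.2| ^+ 2 * p z.1.2) (fun z => `|a z.1.1 z.1.2|)
  (Cu + Cv) CC q) H.
(* The remainder is a priori of order one in [y' - y] and is wanted of order two; for either power
   the scaling by [lam] yields a factor at most [q]. *)
have lp (n : nat) b1 y y' : 0 <= y <= e -> (0 < n)%N ->
    `|a b1 y| * (`|lam b1 * y' - lam b1 * y| ^+ n * p (lam b1 * y)) <=
    q * (`|y' - y| ^+ n * p y).
  move=> ye n0; rewrite -mulrBr normrM exprMn.
  have /andP[l0 lq] := lamP b1; rewrite (ger0_norm l0).
  have h := ap b1 y ye.
  have lnq : lam b1 ^+ n <= q.
    have l1 := lam_le1 b1.
    apply: le_trans lq; case: n n0 => // n _.
    by rewrite exprS ler_piMr // exprn_ile1.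
  have t0 : 0 <= `|y' - y| ^+ n by rewrite exprn_ge0.
  have s0 : 0 <= lam b1 ^+ n by rewrite exprn_ge0.
  have pl0 : 0 <= `|a b1 y| * p (lam b1 * y) by rewrite mulr_ge0 ?p0 //; exact: lamx.
  exact: ler_wpM4.
have {H} : `|u b x' - u b x - v (b, x) * (x' - x)| <=
    CC / (1 - q) * (`|x' - x| ^+ 2 * p x).
  apply: (H _ _ _ _ _ _ _ _ _ _ (b, x, x')) => //.
  - by move=> [[b1 y] y'] [] /=; split; exact: lamx.
  - by rewrite q0.
  - by move=> [[b1 y] y'] [/= h1 h2]; rewrite mulr_ge0 ?p0 ?exprn_ge0.
  - move=> [[b1 y] y'] [/= h1 h2]; have /andP[k _] := pP h1.
    have [_ k1 _] := hu0 b1 b1 _ _ h2 h1.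
    have [k2 _ _] := hv b1 b1 _ _ h1 h1.
    apply: (le_trans (ler_normB _ _)).
    rewrite normrM; have n0 := normr_ge0 (y' - y).
    move: k1 (ler_wpM2r n0 k2) (ler_wpM2l (mulr_ge0 (addr_ge0 Cu0 Cv0) n0) k).
    lra_only.
  - move=> [[b1 y] y'] [/= h1 h2].
    have [k1 _ _] := hu0 (T b1) (T b1) _ _ (lamx b1 h2) (lamx b1 h1).
    have [_ k2 _] := hu0 (T b1) (T b1) _ _ (lamx b1 h2) (lamx b1 h1).
    have [k3 _ _] := ha1 b1 b1 _ _ h1 h1.
    have [_ k4] := vE (b1, y) h1; rewrite k4 /= /a' /c'.
    rewrite [u b1 y']uE // [u b1 y]uE //.
    rewrite (_ : _ - _ = a b1 y * (u (T b1) (lam b1 * y') - u (T b1) (lam b1 * y)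
        - v (T b1, lam b1 * y) * (lam b1 * y' - lam b1 * y)) +
      ((a b1 y' - a b1 y - a1 b1 y * (y' - y)) * u (T b1) (lam b1 * y') +
       a1 b1 y * (y' - y) * (u (T b1) (lam b1 * y') - u (T b1) (lam b1 * y)) +
       (c b1 y' - c b1 y - c1 b1 y * (y' - y)))); last by ring.
    apply: ler_normD2; first by rewrite normrM.
    have n0 := normr_ge0 (y' - y).
    have k5 : `|u (T b1) (lam b1 * y') - u (T b1) (lam b1 * y)| <=
        Cu * `|y' - y|.
      apply: (le_trans k2); rewrite ler_wpM2l // -mulrBr normrM.
      by have /andP[l0 lq] := lamP b1; rewrite ger0_norm // ler_piMl ?lam_le1.
    have k6 : `|a1 b1 y * (y' - y)| <= Ca1 * `|y' - y| by exact: ler_normM.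
    apply: (le_trans (ler_normD2 (ler_normD2 (ler_normM (haC _ _ _ h1 h2) k1)
      (ler_normM k6 k5)) (hcC _ _ _ h1 h2))).
    have /andP[p1 _] := pP h1.
    by move: (ler_wpM2l (mulr_ge0 CC0 (exprn_ge0 2 n0)) p1); rewrite /CC; lra_only.
  - by move=> [[b1 y] y'] [/= h1 h2]; have := lp 1%N b1 y y' h1 isT; rewrite !expr1.
  - by move=> [[b1 y] y'] [/= h1 h2]; exact: lp.
  - by rewrite addr_ge0.
move=> h; apply: (le_trans h).
rewrite -[X in _ <= X]mulrA [P * _]mulrC; apply: ler_wpM2l; first by rewrite divr_ge0.
by rewrite ler_wpM2l ?exprn_ge0 // p_leP.
Qed.

End Cocycle.
End Families.

(** * Linearization of an abstract skew product *)

Section Linearization.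
Variables (R : realType) (B : Type) (T : B -> B) (f f1 : B -> R -> R).
Variables (lam : B -> R) (lm q K eta K1 eps : R).
Implicit Types (b : B) (x y m : R) (h : B -> R -> R).
Hypothesis lm0 : 0 < lm.
Hypothesis lamP : forall b, lm <= lam b <= q.
Hypothesis q0 : 0 < q.
Hypothesis q1 : q < 1.
Hypothesis K0 : 0 < K.
Hypothesis f_0 : forall b, f b 0 = 0.
Hypothesis f1_0 : forall b, f1 b 0 = lam b.
Hypothesis f1_lip : forall b y y', 0 <= y <= 1 -> 0 <= y' <= 1 ->
  `|f1 b y - f1 b y'| <= K * `|y - y'|.
Hypothesis f_taylor : forall b y y', 0 <= y <= 1 -> 0 <= y' <= 1 ->
  `|f b y' - f b y - f1 b y * (y' - y)| <= K * `|y' - y| ^+ 2.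
(* [eta = 4 K / lm] and [K1 = 2 eta / (1 - q)], without divisions. *)
Hypothesis etaE : eta * lm = 4 * K.
Hypothesis K1E : K1 * (1 - q) = 2 * eta.
Hypothesis eps0 : 0 < eps.
Hypothesis eps1 : 2 * eps <= 1.
Hypothesis eta_eps : 8 * (eta * eps) <= 1 - q.

Ltac section_fact H ::=
  first [constr_eq H lm0 | constr_eq H q0 | constr_eq H q1 | constr_eq H K0
        | constr_eq H etaE | constr_eq H K1E | constr_eq H eps0
        | constr_eq H eps1 | constr_eq H eta_eps].

Local Notation r b y := (f b y - lam b * y).

Local Lemma eta0 : 0 < eta.
Proof. by rewrite -(pmulr_lgt0 _ lm0) etaE mulr_gt0. Qed.

Local Lemma K1_gt0 : 0 < K1.
Proof.
have q1' : 0 < 1 - q by rewrite subr_gt0.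
by rewrite -(pmulr_lgt0 _ q1') K1E mulr_gt0 ?eta0.
Qed.

Local Lemma K1_eps : 4 * (K1 * eps) <= 1.
Proof.
have q1' : 0 < 1 - q by rewrite subr_gt0.
rewrite -(ler_pM2r q1') mul1r; have := eta_eps.
by rewrite (_ : 4 * _ * _ = 4 * (K1 * (1 - q) * eps)); [rewrite K1E; lra | ring].
Qed.

Local Lemma lam_gt0 b : 0 < lam b.
Proof. by have /andP[? _] := lamP b; apply: lt_le_trans lm0 _. Qed.

Local Lemma lam_lt1 b : lam b < 1.
Proof. by have /andP[_ ?] := lamP b; apply: le_lt_trans q1. Qed.

Local Lemma K_lam b : 4 * K <= eta * lam b.
Proof.
by rewrite -etaE ler_wpM2l ?(ltW eta0) //; have /andP[] := lamP b.
Qed.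

Local Lemma scale_dom b x m : 0 <= x <= m -> 0 <= lam b * x <= lam b * m.
Proof.
have l0 := ltW (lam_gt0 b).
by move=> /andP[x0 xm]; rewrite mulr_ge0 //= ler_wpM2l.
Qed.

Local Lemma scale_eps b x : 0 <= x <= eps -> 0 <= lam b * x <= eps.
Proof.
move=> /(scale_dom b) /andP[-> h] /=; apply: (le_trans h).
by rewrite ler_piMl ?(ltW eps0) // ltW // lam_lt1.
Qed.

Local Lemma eta_le x : 0 <= x <= eps -> 8 * (eta * x) <= 1 - q.
Proof.
move=> /andP[x0 xe]; have := eta_eps.
have := ler_wpM2l (ltW eta0) xe; lra.
Qed.

(** The derivative of [r] vanishes at 0, hence is at most [K m] on [[0, m]]; the quadratic remainder
    of [f] adds as much again. *)
Local Lemma r_lip b y y' m : 0 <= y <= m -> 0 <= y' <= m -> m <= 1 ->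
  `|r b y - r b y'| <= 2 * K * m * `|y - y'|.
Proof.
move=> /andP[y0 ym] /andP[y0' ym'] m1.
have hy : 0 <= y <= 1 by rewrite y0 (le_trans ym).
have hy' : 0 <= y' <= 1 by rewrite y0' (le_trans ym').
have h1 := f_taylor b hy' hy.
have h0 : 0 <= (0 : R) <= 1 by rewrite lexx ler01.
have h2 := f1_lip b hy' h0; rewrite f1_0 subr0 (ger0_norm y0') in h2.
rewrite (_ : _ - _ = (f b y - f b y' - f1 b y' * (y - y')) +
  (f1 b y' - lam b) * (y - y')); last by ring.
apply: (le_trans (ler_normD2 h1 (ler_normM h2 (lexx _)))).
have n0 := normr_ge0 (y - y').
have n1 : `|y - y'| <= m.
  by rewrite ler_norml; apply/andP; split; lra.
have k1 := ler_wpM2l (mulr_ge0 (ltW K0) n0) n1.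
have k2 := ler_wpM2l (mulr_ge0 (ltW K0) n0) ym'.
lra.
Qed.

Local Lemma r_0 b : r b 0 = 0.
Proof. by rewrite f_0 mulr0 subr0. Qed.

(** Since [K1 * eps <= 1 / 4], the shift is at most [x / 4]. Thus [r] is evaluated on [[0, 2 x]],
    where its Lipschitz constant is [4 K x]. *)
Local Lemma shift_dom x (s : R) : 0 <= x <= eps -> `|s| <= K1 * x ^+ 2 ->
  0 <= x + s <= 2 * x.
Proof.
move=> /andP[x0 xe]; rewrite ler_norml => /andP[h1 h2].
have := K1_eps; have k := ler_wpM2l (mulr_ge0 (ltW K1_gt0) x0) xe.
move=> k1; have := ler_wpM2l x0 k1.
have : K1 * x * x <= K1 * x * eps by exact: k.
rewrite expr2 in h1 h2.
lra.
Qed.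

(** The equation is [f b (x + h b x) = lam b * x + h (T b) (lam b * x)], that is [F o H = H o F_0],
    with the linear terms moved. The quadratic bound contains [h = h' = 0] at 0 and supplies a
    priori estimates for later iterations. *)
Definition conjugacy_shift h := forall b x, 0 <= x <= eps ->
  `|h b x| <= K1 * x ^+ 2 /\
  lam b * h b x = h (T b) (lam b * x) - r b (x + h b x).

Local Lemma ler_norm_invM (l s A : R) : 0 < l -> `|s| <= l * A ->
  `|l^-1 * s| <= A.
Proof.
by move=> l0 h; rewrite normrM gtr0_norm ?invr_gt0 // ler_pdivrMl.
Qed.

(** For the weight [x^2], the term [h (T b)] costs [lam^2 / lam <= q] and the remainder
    [8 K / lam <= 2 eta]. The ball of radius [K1] is preserved as soon as [q K1 + 2 eta <= K1],
    whence the choice of [K1]. For differences the remainder costs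
    [4 K x / lam <= eta x <= (1 - q) / 8], so the total factor is below [(1 + q) / 2]. *)
Lemma conjugacy_shift_exists : exists h, conjugacy_shift h.
Proof.
have [q1' q0'] := (q1, q0); have Kp := ltW K0; have K1p := ltW K1_gt0.
have hK1 := K1E; have etap := ltW eta0; have e1 := eps1.
have [u hu] : exists u : B * R -> R, forall z, 0 <= z.2 <= eps ->
    `|u z| <= K1 * z.2 ^+ 2 /\
    u z = (lam z.1)^-1 * (u (T z.1, lam z.1 * z.2) - r z.1 (z.2 + u z)).
  apply: (@weighted_fixpoint R (B * R)%type
    (fun z => (T z.1, lam z.1 * z.2)) (fun z => 0 <= z.2 <= eps) _
    (fun z s t => (lam z.1)^-1 * (t - r z.1 (z.2 + s))) (fun z => z.2 ^+ 2)
    K1 ((1 + q) / 2)) => [[b x] /= xe|||z _|[b x] s t /= xe hs ht|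
    [b x] s s' t t' d /= xe d0 hs hs' ht ht' hd hd'] //.
  - exact: scale_eps.
  - by apply/andP; split; lra.
  - exact: sqr_ge0.
  - have /andP[x0 xle] := xe; have l0 := lam_gt0 b; have /andP[_ lq] := lamP b.
    have hx := shift_dom xe hs; have h0 : 0 <= (0 : R) <= 2 * x.
      by rewrite lexx mulr_ge0.
    have x1 : 2 * x <= 1 by lra.
    have h1 := r_lip b hx h0 x1; rewrite r_0 !subr0 in h1.
    have /andP[hx0 hx1] := hx; rewrite (ger0_norm hx0) in h1.
    have c0 : 0 <= 2 * K * (2 * x) by rewrite !mulr_ge0.
    have h2 := ler_wpM2l c0 hx1.
    apply: ler_norm_invM => //; apply: (le_trans (ler_normB _ _)).
    apply: (le_trans (lerD ht (le_trans h1 h2))).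
    have X0 := sqr_ge0 x.
    have k1 := ler_wpM2l (mulr_ge0 (mulr_ge0 K1p (ltW l0)) X0) lq.
    have k2 := ler_wpM2r X0 (K_lam b).
    have k3 : K1 * (1 - q) * (lam b * x ^+ 2) = 2 * eta * (lam b * x ^+ 2).
      by rewrite hK1.
    rewrite !expr2 in k1 k2 k3 *; lra.
  - have /andP[x0 xle] := xe; have l0 := lam_gt0 b; have /andP[_ lq] := lamP b.
    have hx := shift_dom xe hs; have hx' := shift_dom xe hs'.
    have x1 : 2 * x <= 1 by lra.
    have h1 := r_lip b hx hx' x1.
    rewrite (_ : x + s - (x + s') = s - s') in h1; last by ring.
    have c0 : 0 <= 2 * K * (2 * x) by rewrite !mulr_ge0.
    have h2 := ler_wpM2l c0 hd.
    rewrite -mulrBr; apply: ler_norm_invM => //.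
    rewrite (_ : _ - _ = (t - t') - (r b (x + s) - r b (x + s'))); last by ring.
    apply: (le_trans (ler_normB _ _)).
    apply: (le_trans (lerD hd' (le_trans h1 h2))).
    have X0 := mulr_ge0 d0 (sqr_ge0 x).
    have k1 := ler_wpM2l (mulr_ge0 (ltW l0) X0) lq.
    have k2 := ler_wpM2r (mulr_ge0 x0 X0) (K_lam b).
    have k3 := ler_wpM2r (mulr_ge0 (ltW l0) X0) (eta_le xe).
    have k4 : 0 <= (1 - q) * (lam b * (d * x ^+ 2)).
      by rewrite !mulr_ge0 ?(ltW l0) ?sqr_ge0 // subr_ge0 ltW.
    by rewrite !expr2 in k1 k2 k3 k4 *; move: k1 k2 k3 k4; lra_only.
exists (fun b x => u (b, x)) => b x xe; have [h1 h2] := hu (b, x) xe.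
split=> //; have l0 := lam_gt0 b.
by rewrite [in LHS]h2 /= mulrA divff ?mul1r // gt_eqF.
Qed.

(** * Regularity of the conjugacy along the fibres *)

Section Solution.
Variable h : B -> R -> R.
Hypothesis hP : conjugacy_shift h.
Local Notation H b x := (x + h b x).

Local Lemma H_dom b x : 0 <= x <= eps -> 0 <= H b x <= 2 * x.
Proof. by move=> xe; apply: shift_dom => //; have [] := hP b xe. Qed.

Local Lemma H_dom1 b x : 0 <= x <= eps -> 0 <= H b x <= 1.
Proof.
move=> xe; have /andP[-> h1] /= := H_dom b xe.
by have /andP[_ xe'] := xe; have := eps1; lra.
Qed.

(** The common bound [m] travels along the orbit and is scaled like the points: [m * |x - x'|]
    shrinks by [lam^2], which beats the factor [1 / lam] of the equation, as [|x - x'|] alone would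
    not. *)
Lemma shift_lip_max b x x' m : 0 <= x <= m -> 0 <= x' <= m -> m <= eps ->
  `|h b x - h b x'| <= K1 * (m * `|x - x'|).
Proof.
move=> xm xm' me.
have [q1' q0'] := (q1, q0); have Kp := ltW K0; have K1p := ltW K1_gt0.
have hK1 := K1E; have etap := ltW eta0; have e1 := eps1; have ee := eta_eps.
(* [d] absorbs the part of the remainder proportional to the unknown difference [w]: the term
   [4 K m w], at most [lam eta eps w], is moved to the left-hand side. *)
pose d := 1 - eta * eps; have dq : (1 + 7 * q) / 8 <= 1 - eta * eps by lra.
have d0 : 0 < d by rewrite /d; lra.
have qd : q / d < 1 by rewrite ltr_pdivrMr // /d; lra.
pose D (z : B * R * R * R) :=
  [/\ 0 <= z.1.1.2 <= z.2, 0 <= z.1.2 <= z.2 & z.2 <= eps].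
have := @discount R _ (fun z : B * R * R * R => (T z.1.1.1,
  lam z.1.1.1 * z.1.1.2, lam z.1.1.1 * z.1.2, lam z.1.1.1 * z.2)) D.
move=> /(_ _ (fun z => `|h z.1.1.1 z.1.1.2 - h z.1.1.1 z.1.2|)
  (fun z => z.2 ^+ 2) (fun z => z.2 * `|z.1.1.2 - z.1.2|)
  (fun z => (lam z.1.1.1 * d)^-1) (2 * K1) (eta / d) (q / d)) HH.
have {HH} : `|h b x - h b x'| <= eta / d / (1 - q / d) * (m * `|x - x'|).
  apply: (HH _ _ _ _ _ _ _ _ _ _ (b, x, x', m)) => {HH} //.
  - move=> [[[b1 y] y'] n] [/= h1 h2 h3]; split; try exact: scale_dom.
    apply: le_trans h3; rewrite ler_piMl ?(ltW (lam_lt1 b1)) //.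
    by have /andP[a1 a2] := h1; apply: le_trans a2.
  - by rewrite qd andbT divr_ge0 ?(ltW d0) ?(ltW q0').
  - by rewrite divr_ge0 ?(ltW d0).
  - move=> [[[b1 y] y'] n] [/= /andP[h1 h2] _ _].
    by rewrite mulr_ge0 // (le_trans h1).
  - move=> [[[b1 y] y'] n] _ /=.
    by rewrite invr_ge0 mulr_ge0 ?(ltW d0) ?(ltW (lam_gt0 b1)).
  - move=> [[[b1 y] y'] n] [/= h1 h2 h3].
    have /andP[y0 yn] := h1; have /andP[y0' yn'] := h2.
    have [|k1 _] := @hP b1 y; first by rewrite y0 (le_trans yn).
    have [|k2 _] := @hP b1 y'; first by rewrite y0' (le_trans yn').
    apply: (le_trans (ler_normB _ _)).
    have n0 : 0 <= n by apply: le_trans yn.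
    have s1 : y ^+ 2 <= n ^+ 2 by rewrite lerXn2r.
    have s2 : y' ^+ 2 <= n ^+ 2 by rewrite lerXn2r.
    by move: k1 k2 (ler_wpM2l K1p s1) (ler_wpM2l K1p s2); lra_only.
  - move=> [[[b1 y] y'] n] [/= h1 h2 h3].
    have /andP[y0 yn] := h1; have /andP[y0' yn'] := h2.
    have n0 : 0 <= n by apply: le_trans yn.
    have ye : 0 <= y <= eps by rewrite y0 (le_trans yn).
    have ye' : 0 <= y' <= eps by rewrite y0' (le_trans yn').
    have l0 := lam_gt0 b1.
    have [_ E1] := @hP b1 y ye; have [_ E2] := @hP b1 y' ye'.
    have Hn : 0 <= H b1 y <= 2 * n.
      by have /andP[-> a2] /= := H_dom b1 ye; rewrite (le_trans a2) ?ler_wpM2l.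
    have Hn' : 0 <= H b1 y' <= 2 * n.
      by have /andP[-> a2] /= := H_dom b1 ye'; rewrite (le_trans a2) ?ler_wpM2l.
    have n1 : 2 * n <= 1 by move: h3 e1; lra_only.
    have k1 := r_lip b1 Hn Hn' n1.
    set w := `|h b1 y - h b1 y'|.
    have k2 : `|H b1 y - H b1 y'| <= `|y - y'| + w.
      rewrite (_ : _ - _ = (y - y') + (h b1 y - h b1 y')); last by ring.
      exact: ler_normD.
    have w0 : 0 <= w by exact: normr_ge0.
    have k3 : lam b1 * w <= `|h (T b1) (lam b1 * y) - h (T b1) (lam b1 * y')| +
        2 * K * (2 * n) * (`|y - y'| + w).
      rewrite -[X in X * w](gtr0_norm l0) /w -normrM mulrBr E1 E2.
      rewrite (_ : _ - _ = (h (T b1) (lam b1 * y) - h (T b1) (lam b1 * y')) -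
        (r b1 (H b1 y) - r b1 (H b1 y'))); last by ring.
      apply: (le_trans (ler_normB _ _)); rewrite lerD2l.
      by apply: (le_trans k1); rewrite ler_wpM2l // !mulr_ge0.
    rewrite (_ : _ + _ = (lam b1 * d)^-1 *
      (`|h (T b1) (lam b1 * y) - h (T b1) (lam b1 * y')| +
      lam b1 * eta * (n * `|y - y'|))); last by field; rewrite (gt_eqF d0) (gt_eqF l0).
    rewrite ler_pdivlMl ?mulr_gt0 //.
    have a0 := normr_ge0 (y - y').
    have k4 := ler_wpM2r (mulr_ge0 n0 a0) (K_lam b1).
    have k5 := ler_wpM2r (mulr_ge0 n0 w0) (K_lam b1).
    have k6 := ler_wpM2l (mulr_ge0 (mulr_ge0 (ltW l0) etap) w0) h3.
    by move: k3 k4 k5 k6; rewrite /d; lra_only.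
  - move=> [[[b1 y] y'] n] [/= h1 h2 h3].
    have l0 := lam_gt0 b1; have /andP[_ lq] := lamP b1.
    rewrite (_ : _ * _ = lam b1 / d * n ^+ 2); last by field; rewrite (gt_eqF d0) (gt_eqF l0).
    by rewrite ler_wpM2r ?sqr_ge0 // ler_wpM2r // invr_ge0 ltW.
  - move=> [[[b1 y] y'] n] [/= h1 h2 h3].
    have l0 := lam_gt0 b1; have /andP[_ lq] := lamP b1.
    have /andP[y0 yn] := h1; have n0 : 0 <= n by apply: le_trans yn.
    rewrite -mulrBr normrM (gtr0_norm l0).
    rewrite (_ : _ * _ = lam b1 / d * (n * `|y - y'|)); last by field; rewrite (gt_eqF d0) (gt_eqF l0).
    by rewrite ler_wpM2r ?mulr_ge0 // ler_wpM2r // invr_ge0 ltW.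
  - by rewrite mulr_ge0.
move=> hh; apply: (le_trans hh).
have m0 : 0 <= m by have /andP[a1 a2] := xm; apply: le_trans a2.
rewrite ler_wpM2r ?mulr_ge0 //.
(* The constant equals [eta / (d - q)]; it is at most [K1] because [d - q >= (1 - q) / 2] and
   [K1 * (1 - q) / 2 = eta]. *)
have dq0 : 0 < d - q by rewrite /d; lra.
rewrite (_ : eta / d / (1 - q / d) = eta / (d - q)); last first.
  by field; rewrite (gt_eqF d0) (gt_eqF dq0).
rewrite ler_pdivrMr //.
have k : (1 - q) / 2 <= d - q by rewrite /d; lra.
have := ler_wpM2l K1p k.
by rewrite (_ : K1 * ((1 - q) / 2) = eta) // mulrA hK1; field.
Qed.

(** This makes [x + h b x] injective on each fibre with a Lipschitz inverse. *)
Lemma shift_half_lip b x x' : 0 <= x <= eps -> 0 <= x' <= eps ->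
  4 * `|h b x - h b x'| <= `|x - x'|.
Proof.
move=> xe xe'; have := shift_lip_max b xe xe' (lexx _).
have := ler_wpM2r (normr_ge0 (x - x')) K1_eps; lra.
Qed.

Local Lemma H_lip b x x' : 0 <= x <= eps -> 0 <= x' <= eps ->
  `|H b x - H b x'| <= 2 * `|x - x'|.
Proof.
move=> xe xe'; have := shift_half_lip b xe xe'.
have := ler_normD (x - x') (h b x - h b x').
rewrite (_ : x - x' + _ = H b x - H b x'); last by ring.
have := normr_ge0 (x - x'); lra.
Qed.

Local Notation p x := (1 + K1 * x).

Local Lemma p_ge1 x : 0 <= x <= eps -> 1 <= p x <= 2.
Proof.
move=> /andP[x0 xe]; have K1p := ltW K1_gt0.
have k1 := mulr_ge0 K1p x0; have k2 := ler_wpM2l K1p xe.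
by have k3 := K1_eps; apply/andP; split; lra.
Qed.

Local Lemma p_ge0 x : 0 <= x <= eps -> 0 <= p x.
Proof. by move=> /p_ge1 /andP[p1 _]; apply: le_trans p1. Qed.

(** Scaling by [lam <= q] lowers [p] by at least [K1 (1 - q) x = 2 eta x], while the loss allowed
    for is [eta x * p x], at most [5 / 4 * eta x]. *)
Local Lemma p_scale b x : 0 <= x <= eps ->
  p (lam b * x) <= (1 - eta * x) * p x.
Proof.
move=> xe; have /andP[x0 xle] := xe; have /andP[_ lq] := lamP b.
have K1p := ltW K1_gt0; have etap := ltW eta0.
have k1 := ler_wpM2l (mulr_ge0 x0 K1p) lq.
have k2 := ler_wpM2l (mulr_ge0 (mulr_ge0 etap x0) K1p) xle.
have k3 := ler_wpM2l (mulr_ge0 etap x0) K1_eps.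
have k4 : K1 * (1 - q) * x = 2 * eta * x by rewrite K1E.
have k5 := mulr_ge0 etap x0; lra.
Qed.

Local Lemma one_eta x : 0 <= x <= eps -> 2^-1 <= 1 - eta * x.
Proof. by move=> /eta_le; have := q0; lra. Qed.

(** [Y] stands for a product of two lengths, which scales by [lam^2], and [D^-1] for the factor of
    the equation. One [lam] cancels against [D], the drop of [p] compensates [1 - eta * x], and the
    other [lam] contracts. *)
Local Lemma weight_contract b x (Y D : R) : 0 <= x <= eps -> 0 <= Y ->
  lam b * (1 - eta * x) <= D ->
  D^-1 * (lam b ^+ 2 * Y * p (lam b * x)) <= q * (Y * p x).
Proof.
move=> xe Y0 hD; have h1 := one_eta xe; have l0 := lam_gt0 b.
have /andP[_ lq] := lamP b.
have e0 : 0 < 1 - eta * x by lra.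
have D0 : 0 < D by apply: lt_le_trans hD; rewrite mulr_gt0.
have px := p_ge0 xe.
rewrite ler_pdivrMl //.
apply: (@le_trans _ _ (lam b ^+ 2 * Y * ((1 - eta * x) * p x))).
  by rewrite ler_wpM2l ?p_scale // mulr_ge0 // sqr_ge0.
rewrite (_ : _ * _ = (lam b * (1 - eta * x)) * (lam b * (Y * p x))); last ring.
have YP : 0 <= Y * p x by rewrite mulr_ge0.
apply: ler_pM => //; first by rewrite mulr_ge0 // ltW.
  by rewrite mulr_ge0 // ltW.
by rewrite ler_wpM2r.
Qed.

Local Lemma f1_H b x : 0 <= x <= eps ->
  `|f1 b (H b x) - lam b| <= 2 * K * x /\
  lam b * (1 - eta * x) <= f1 b (H b x).
Proof.
move=> xe; have /andP[x0 xle] := xe.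
have h0 : 0 <= (0 : R) <= 1 by rewrite lexx ler01.
have k := f1_lip b (H_dom1 b xe) h0; rewrite f1_0 subr0 in k.
have /andP[H0 H1] := H_dom b xe; rewrite (ger0_norm H0) in k.
have k1 := ler_wpM2l (ltW K0) H1.
have k2 := ler_wpM2r x0 (K_lam b).
have k3 := mulr_ge0 (mulr_ge0 (ltW eta0) (ltW (lam_gt0 b))) x0.
split; first lra.
move: k; rewrite ler_norml => /andP[k4 k5]; lra.
Qed.

Local Lemma f1_H_ge b x : 0 <= x <= eps -> lm / 2 <= f1 b (H b x).
Proof.
move=> xe; have [_ k] := f1_H b xe; have h1 := one_eta xe.
have /andP[lml _] := lamP b; have := ler_wpM2l (ltW (lam_gt0 b)) h1; lra.
Qed.

Local Notation a b x := (lam b * (f1 b (H b x))^-1).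

Local Lemma a_weight b x : 0 <= x <= eps ->
  `|a b x| * p (lam b * x) <= p x.
Proof.
move=> xe; have [_ k] := f1_H b xe; have F := f1_H_ge b xe.
have lm0' := lm0; have F0 : 0 < f1 b (H b x) by lra.
have px := p_ge0 xe.
rewrite ger0_norm; last by rewrite mulr_ge0 ?invr_ge0 ?ltW ?lam_gt0.
rewrite mulrAC ler_pdivrMr //.
have k1 := ler_wpM2l (ltW (lam_gt0 b)) (p_scale b xe).
have := ler_wpM2r px k; lra.
Qed.

Local Lemma a_sub1 b x : 0 <= x <= eps -> `|a b x - 1| <= eta * x.
Proof.
move=> xe; have [k1 k] := f1_H b xe; have F := f1_H_ge b xe.
have lm0' := lm0; have F0 : 0 < f1 b (H b x) by lra.
have /andP[x0 xle] := xe.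
rewrite (_ : _ - 1 = (f1 b (H b x))^-1 * - (f1 b (H b x) - lam b)); last first.
  by field; lra.
apply: ler_norm_invM => //; rewrite normrN; apply: (le_trans k1).
have h1 := ler_wpM2l (ltW (lam_gt0 b)) (one_eta xe).
have h2 := ler_wpM2r x0 (K_lam b).
have h3 := ler_wpM2l (mulr_ge0 (ltW eta0) x0) (le_trans h1 k).
lra.
Qed.

(** Differentiating the conjugacy gives [1 + g = a * (1 + g o F_0)]. The bound selects the solution
    vanishing at 0. *)
Definition shift_derivative (g : B -> R -> R) := forall b x, 0 <= x <= eps ->
  `|g b x| <= K1 * x /\
  g b x = a b x * g (T b) (lam b * x) + (a b x - 1).

(** The weight is [x * p x]: [p] absorbs [a], and the factor [x] contracts by [lam <= q]. The
    constant is [eta / (1 - q) = K1 / 2], and [p <= 2]. *)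
Lemma shift_derivative_exists : exists g, shift_derivative g.
Proof.
have [q1' q0'] := (q1, q0).
have [u hu] : exists u : B * R -> R, forall z, 0 <= z.2 <= eps ->
    `|u z| <= eta / (1 - q) * (z.2 * p z.2) /\
    u z = a z.1 z.2 * u (T z.1, lam z.1 * z.2) + (a z.1 z.2 - 1).
  apply: weighted_linear_fixpoint => [[b x] xe||| [b x] /= xe|
      [b x] /= xe|[b x] /= xe].
  - exact: scale_eps.
  - by rewrite q1' ltW.
  - exact: (ltW eta0).
  - by have /andP[x0 _] := xe; rewrite mulr_ge0 // p_ge0.
  - have /andP[x0 _] := xe; have /andP[_ lq] := lamP b.
    have px : 0 <= x * p x.
      by rewrite mulr_ge0 // p_ge0.
    have k := ler_wpM2l (mulr_ge0 (ltW (lam_gt0 b)) x0) (a_weight b xe).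
    have := ler_wpM2r px lq; lra.
  - apply: (le_trans (a_sub1 b xe)); have /andP[x0 _] := xe.
    have /andP[p1 _] := p_ge1 xe.
    have := ler_wpM2l (mulr_ge0 (ltW eta0) x0) p1; lra.
exists (fun b x => u (b, x)) => b x xe; have [h1 h2] := hu (b, x) xe.
split => //; apply: (le_trans h1) => /=.
rewrite (_ : eta / (1 - q) = K1 / 2); last first.
  by apply: (canLR (mulfK _)); [lra | rewrite mulrAC K1E; field].
have /andP[_ p2] := p_ge1 xe; have /andP[x0 _] := xe.
have := ler_wpM2l (mulr_ge0 (ltW K1_gt0) x0) p2; lra.
Qed.

Section Derivative.
Variable g : B -> R -> R.
Hypothesis gP : shift_derivative g.

(** Division by [f1 (H)], of order [lam], is outweighed by the scaling of [|x' - x|^2]. The a priori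
    bound must scale by [lam^2] as well, so it is [m * |x' - x|] with a travelling bound [m] that
    starts at [eps]. *)
Lemma shift_taylor : taylor1 eps h g.
Proof.
have [q1' q0'] := (q1, q0); have e1 := eps1; have e0 := eps0.
have Kp := ltW K0; have K1p := ltW K1_gt0; have etap := ltW eta0.
have lm0' := lm0.
exists (2 * (2 * eta / (1 - q))).
  by rewrite !mulr_ge0 // invr_ge0; lra.
move=> b x x' xe xe'.
pose D (z : B * R * R * R) :=
  [/\ 0 <= z.1.1.2 <= z.2, 0 <= z.1.2 <= z.2 & z.2 <= eps].
have := @discount R _ (fun z : B * R * R * R => (T z.1.1.1,
  lam z.1.1.1 * z.1.1.2, lam z.1.1.1 * z.1.2, lam z.1.1.1 * z.2)) D.
move=> /(_ _ (fun z => `|h z.1.1.1 z.1.2 - h z.1.1.1 z.1.1.2 -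
    g z.1.1.1 z.1.1.2 * (z.1.2 - z.1.1.2)|)
  (fun z => z.2 * `|z.1.2 - z.1.1.2| * p z.1.1.2)
  (fun z => `|z.1.2 - z.1.1.2| ^+ 2 * p z.1.1.2)
  (fun z => (f1 z.1.1.1 (H z.1.1.1 z.1.1.2))^-1) (2 * K1) (2 * eta) q) HH.
have {HH} : `|h b x' - h b x - g b x * (x' - x)| <=
    2 * eta / (1 - q) * (`|x' - x| ^+ 2 * p x).
  apply: (HH _ _ _ _ _ _ _ _ _ _ (b, x, x', eps)) => {HH} //.
  - move=> [[[b1 y] y'] n] [/= h1 h2 h3]; split; try exact: scale_dom.
    apply: le_trans h3; rewrite ler_piMl ?(ltW (lam_lt1 b1)) //.
    by have /andP[a1 a2] := h1; apply: le_trans a2.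
  - by rewrite q1' ltW.
  - by rewrite mulr_ge0.
  - move=> [[[b1 y] y'] n] [/= /andP[h1 h2] _ h3].
    have ye : 0 <= y <= eps by rewrite h1 (le_trans h2).
    by rewrite mulr_ge0 ?sqr_ge0 // p_ge0.
  - move=> [[[b1 y] y'] n] [/= /andP[h1 h2] _ h3].
    have ye : 0 <= y <= eps by rewrite h1 (le_trans h2).
    by rewrite invr_ge0; have := f1_H_ge b1 ye; lra.
  - move=> [[[b1 y] y'] n] [/= h1 h2 h3].
    have /andP[y0 yn] := h1; have n0 : 0 <= n by apply: le_trans yn.
    have ye : 0 <= y <= eps by rewrite y0 (le_trans yn).
    have k1 := shift_lip_max b1 h2 h1 h3.
    have [k2 _] := gP b1 ye.
    have d0 := normr_ge0 (y' - y).
    apply: (le_trans (ler_normB _ _)); rewrite normrM.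
    have k3 := ler_wpM2r d0 k2.
    have k4 := ler_wpM2r d0 (ler_wpM2l K1p yn).
    have /andP[p1 _] := p_ge1 ye.
    have := ler_wpM2l (mulr_ge0 K1p (mulr_ge0 n0 d0)) p1; lra.
  - move=> [[[b1 y] y'] n] [/= h1 h2 h3].
    have /andP[y0 yn] := h1; have /andP[y0' yn'] := h2.
    have ye : 0 <= y <= eps by rewrite y0 (le_trans yn).
    have ye' : 0 <= y' <= eps by rewrite y0' (le_trans yn').
    have [_ E1] := hP b1 ye; have [_ E2] := hP b1 ye'.
    have [_ Eg] := gP b1 ye.
    have F := f1_H_ge b1 ye; have F0 : 0 < f1 b1 (H b1 y) by lra.
    have Hy := H_dom1 b1 ye; have Hy' := H_dom1 b1 ye'.
    have k1 := f_taylor b1 Hy Hy'.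
    have k2 := H_lip b1 ye' ye.
    have k3 : `|H b1 y' - H b1 y| ^+ 2 <= (2 * `|y' - y|) ^+ 2.
      by rewrite lerXn2r ?nnegrE // mulr_ge0.
    have {k3}k1 := le_trans k1 (ler_wpM2l Kp k3).
    set hT' := h (T b1) _ in E2 *; set hT := h (T b1) _ in E1 *.
    set gT := g (T b1) _ in Eg *.
    have Eg' : g b1 y * f1 b1 (H b1 y) = lam b1 * gT + lam b1 - f1 b1 (H b1 y).
      by rewrite Eg; field; rewrite gt_eqF.
    (* Multiplied by [f1 (H)], the remainder of [h] is its remainder one step further minus that of
       [f] between [H b1 y] and [H b1 y']; the equation of [g] cancels the linear terms. *)
    have E : f1 b1 (H b1 y) * (h b1 y' - h b1 y - g b1 y * (y' - y)) =
        (hT' - hT - gT * (lam b1 * y' - lam b1 * y)) -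
        (f b1 (H b1 y') - f b1 (H b1 y) -
           f1 b1 (H b1 y) * (H b1 y' - H b1 y)).
      have -> : f1 b1 (H b1 y) * (h b1 y' - h b1 y - g b1 y * (y' - y)) =
        f1 b1 (H b1 y) * (h b1 y' - h b1 y) -
        (g b1 y * f1 b1 (H b1 y)) * (y' - y) by ring.
      rewrite Eg'.
      have -> : hT' = lam b1 * h b1 y' + r b1 (H b1 y') by rewrite E2; ring.
      have -> : hT = lam b1 * h b1 y + r b1 (H b1 y) by rewrite E1; ring.
      ring.
    have -> : h b1 y' - h b1 y - g b1 y * (y' - y) = (f1 b1 (H b1 y))^-1 *
        (f1 b1 (H b1 y) * (h b1 y' - h b1 y - g b1 y * (y' - y))).
      by rewrite mulKf // gt_eqF.
    apply: ler_norm_invM => //; rewrite E.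
    apply: (le_trans (ler_normB _ _)).
    rewrite [X in _ <= X]mulrDr mulVKf ?gt_eqF // lerD2l.
    apply: (le_trans k1).
    have d0 : 0 <= `|y' - y| ^+ 2 by exact: sqr_ge0.
    have /andP[p1 _] := p_ge1 ye.
    have [_ k4] := f1_H b1 ye.
    have k5 := ler_wpM2l (ltW (lam_gt0 b1)) (one_eta ye).
    have k6 := ler_wpM2l (mulr_ge0 etap d0) (le_trans k5 k4).
    have k7 := ler_wpM2r d0 (K_lam b1).
    have k8 := ler_wpM2l (mulr_ge0 (mulr_ge0 (ltW F0) etap) d0) p1.
    by move: k6 k7 k8; rewrite exprMn; lra_only.
  - move=> [[[b1 y] y'] n] [/= h1 h2 h3].
    have /andP[y0 yn] := h1; have n0 : 0 <= n by apply: le_trans yn.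
    have ye : 0 <= y <= eps by rewrite y0 (le_trans yn).
    have [_ k4] := f1_H b1 ye.
    have Y0 : 0 <= n * `|y' - y| by rewrite mulr_ge0.
    have := weight_contract ye Y0 k4.
    rewrite -mulrBr normrM (gtr0_norm (lam_gt0 b1)).
    by rewrite (_ : lam b1 * n * _ = lam b1 ^+ 2 * (n * `|y' - y|)) //; ring.
  - move=> [[[b1 y] y'] n] [/= h1 h2 h3].
    have /andP[y0 yn] := h1; have n0 : 0 <= n by apply: le_trans yn.
    have ye : 0 <= y <= eps by rewrite y0 (le_trans yn).
    have [_ k4] := f1_H b1 ye.
    have := weight_contract ye (sqr_ge0 `|y' - y|) k4.
    by rewrite -mulrBr normrM (gtr0_norm (lam_gt0 b1)) exprMn.
  - by rewrite mulr_ge0.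
move=> hh; apply: (le_trans hh).
have c0 : 0 <= 2 * eta / (1 - q) * `|x' - x| ^+ 2.
  by rewrite !mulr_ge0 ?sqr_ge0 // invr_ge0; lra.
by have /andP[_ p2] := p_ge1 xe; have := ler_wpM2l c0 p2; lra.
Qed.

End Derivative.

(** * Dependence on the base point, and the bootstrap *)

Section Holder.
Variables (rho : B -> B -> R) (theta C : R).
Hypothesis rho_ge0 : forall b b', 0 <= rho b b'.
Hypothesis rhoT : forall b b', rho (T b) (T b') <= theta * rho b b'.
Hypothesis theta_ge1 : 1 <= theta.
Hypothesis qtheta : q * theta < 1.
Hypothesis C0 : 0 <= C.
Hypothesis lam_holder : forall b b', `|lam b - lam b'| <= C * rho b b'.
Hypothesis r_holder : forall b b' y, 0 <= y <= 1 ->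
  `|r b y - r b' y| <= C * (y ^+ 2 * rho b b').
Hypothesis f1_holder : forall b b' y, 0 <= y <= 1 ->
  `|(f1 b y - lam b) - (f1 b' y - lam b')| <= C * (y * rho b b').

Ltac section_fact H ::=
  first [constr_eq H lm0 | constr_eq H q0 | constr_eq H q1 | constr_eq H K0
        | constr_eq H etaE | constr_eq H K1E | constr_eq H eps0
        | constr_eq H eps1 | constr_eq H eta_eps | constr_eq H theta_ge1
        | constr_eq H qtheta | constr_eq H C0].

Local Lemma weight_contract_rho b b' x (Y D : R) : 0 <= x <= eps -> 0 <= Y ->
  lam b * (1 - eta * x) <= D ->
  D^-1 * (lam b ^+ 2 * (Y * rho (T b) (T b')) * p (lam b * x)) <=
    q * theta * (Y * rho b b' * p x).
Proof.
move=> xe Y0 hD.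
apply: (le_trans (weight_contract xe (mulr_ge0 Y0 (rho_ge0 _ _)) hD)).
have q0' := ltW q0.
have px := p_ge0 xe.
have := ler_wpM2l (mulr_ge0 (mulr_ge0 q0' Y0) px) (rhoT b b'); lra.
Qed.

Lemma shift_holder : exists2 Q : R, 0 <= Q & forall b b' x, 0 <= x <= eps ->
  `|h b x - h b' x| <= Q * (x ^+ 2 * rho b b').
Proof.
have [q1' q0'] := (q1, q0); have e1 := eps1; have e0 := eps0.
have Kp := ltW K0; have K1p := ltW K1_gt0; have etap := ltW eta0.
have lm0' := lm0; have [th1 qth] := (theta_ge1, qtheta).
(* Each [K1] comes from the variation of [lam], once inside [h (T b)] and once in front of [h]; the
   4 from [r] at a height at most [2 x]; [2 / lm] from dividing by [lam b * (1 - eta * x)], which is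
   at least [lm / 2]. *)
pose c := C * (2 * K1 + 4) * (2 / lm).
have c0 : 0 <= c.
  rewrite /c; do !apply: mulr_ge0 => //; last by rewrite invr_ge0 ltW.
  by rewrite addr_ge0 ?mulr_ge0.
exists (c / (1 - q * theta) * 2).
  by rewrite mulr_ge0 ?divr_ge0 //; lra.
move=> b b' x xe.
have := @discount R _ (fun z : B * B * R =>
  (T z.1.1, T z.1.2, lam z.1.1 * z.2)) (fun z => 0 <= z.2 <= eps).
move=> /(_ _ (fun z => `|h z.1.1 z.2 - h z.1.2 z.2|)
  (fun z => z.2 ^+ 2 * p z.2) (fun z => z.2 ^+ 2 * rho z.1.1 z.1.2 * p z.2)
  (fun z => (lam z.1.1 * (1 - eta * z.2))^-1) (2 * K1) c (q * theta)) HH.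
have {HH} : `|h b x - h b' x| <=
    c / (1 - q * theta) * (x ^+ 2 * rho b b' * p x).
  apply: (HH _ _ _ _ _ _ _ _ _ _ (b, b', x)) => {HH} //.
  - by move=> [[b1 b2] y] /= ye; exact: scale_eps.
  - by rewrite qth andbT mulr_ge0 //; lra.
  - move=> [[b1 b2] y] /= ye; by apply: mulr_ge0; [rewrite mulr_ge0 ?sqr_ge0 | exact: p_ge0].
  - move=> [[b1 b2] y] /= ye; have k := one_eta ye.
    by rewrite invr_ge0 mulr_ge0 ?(ltW (lam_gt0 _)) //; lra.
  - move=> [[b1 b2] y] /= ye; have [k1 _] := hP b1 ye; have [k2 _] := hP b2 ye.
    apply: (le_trans (ler_normB _ _)); have /andP[p1 _] := p_ge1 ye.
    have := ler_wpM2l (mulr_ge0 K1p (sqr_ge0 y)) p1; lra.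
  - move=> [[b1 b2] y] /= ye; have /andP[y0 yle] := ye.
    have [_ E1] := hP b1 ye; have [h2 E2] := hP b2 ye.
    have l0 := lam_gt0 b1; have k := one_eta ye.
    have r0 := rho_ge0 b1 b2.
    set w := `|h b1 y - h b2 y|; have w0 : 0 <= w by exact: normr_ge0.
    set wT := `|h (T b1) (lam b1 * y) - h (T b2) (lam b1 * y)|.
    have k1 : `|(lam b1 - lam b2) * h b2 y| <= C * rho b1 b2 * (K1 * y ^+ 2).
      by apply: ler_normM.
    have ly : 0 <= lam b1 * y <= y.
      by rewrite mulr_ge0 ?(ltW l0) // ler_piMl ?(ltW (lam_lt1 _)).
    have ly' : 0 <= lam b2 * y <= y.
      by rewrite mulr_ge0 ?(ltW (lam_gt0 _)) // ler_piMl ?(ltW (lam_lt1 _)).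
    have k2 := shift_lip_max (T b2) ly ly' yle.
    rewrite -mulrBl normrM (ger0_norm y0) in k2.
    have k3 := ler_wpM2l (mulr_ge0 K1p (sqr_ge0 y)) (lam_holder b1 b2).
    have Hy := H_dom1 b1 ye.
    have k4 := r_holder b1 b2 Hy.
    have /andP[Hy0 Hy2] := H_dom b1 ye.
    have k5 : (H b1 y) ^+ 2 <= (2 * y) ^+ 2.
      by rewrite lerXn2r ?nnegrE // mulr_ge0.
    have k6 := ler_wpM2l (mulr_ge0 C0 r0) k5.
    have y1 : 2 * y <= 1 by move: yle e1; lra_only.
    have k7 := r_lip b2 (H_dom b1 ye) (H_dom b2 ye) y1.
    rewrite (_ : H b1 y - H b2 y = h b1 y - h b2 y) in k7; last by ring.
    have E : lam b1 * (h b1 y - h b2 y) =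
        (h (T b1) (lam b1 * y) - h (T b2) (lam b1 * y)) +
        ((h (T b2) (lam b1 * y) - h (T b2) (lam b2 * y)) -
        ((lam b1 - lam b2) * h b2 y +
        ((r b1 (H b1 y) - r b2 (H b1 y)) +
         (r b2 (H b1 y) - r b2 (H b2 y))))).
      have -> : (lam b1 - lam b2) * h b2 y = lam b1 * h b2 y - lam b2 * h b2 y.
        by rewrite mulrBl.
      by rewrite mulrBr E1 E2; ring.
    have k8 : lam b1 * w <= wT + (K1 * (y * (`|lam b1 - lam b2| * y)) +
        (C * rho b1 b2 * (K1 * y ^+ 2) + (C * (H b1 y ^+ 2 * rho b1 b2) +
        2 * K * (2 * y) * w))).
      rewrite -[X in X * w](gtr0_norm l0) /w -normrM E.
      apply: ler_normD2 => //; apply: (le_trans (ler_normB _ _)).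
      by apply: lerD => //; apply: ler_normD2 => //; apply: ler_normD2.
    have k9 := ler_wpM2r (mulr_ge0 y0 w0) (K_lam b1).
    have ek : 0 < lam b1 * (1 - eta * y).
      by rewrite mulr_gt0 //; move: k; lra_only.
    have px := p_ge0 ye.
    have k10 : C * (2 * K1 + 4) * (y ^+ 2 * rho b1 b2) <=
        lam b1 * (1 - eta * y) * (c * (y ^+ 2 * rho b1 b2 * p y)).
      have /andP[lml _] := lamP b1; have /andP[p1 _] := p_ge1 ye.
      have Y0 : 0 <= C * (2 * K1 + 4) * (y ^+ 2 * rho b1 b2).
        by rewrite !mulr_ge0 ?sqr_ge0 // addr_ge0 ?mulr_ge0.
      have j1 : lm * 2^-1 <= lam b1 * (1 - eta * y).
        by apply: ler_pM; rewrite ?(ltW lm0') ?invr_ge0 ?ler0n.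
      have j2 : 1 * 1 <= (lam b1 * (1 - eta * y) * (2 / lm)) * p y.
        apply: ler_pM => //.
        have := ler_wpM2r (_ : 0 <= 2 / lm) j1.
        rewrite (_ : lm * 2^-1 * (2 / lm) = 1); last by field; rewrite gt_eqF.
        by apply; rewrite divr_ge0 ?ltW.
      by move: (ler_wpM2l Y0 j2); rewrite /c; lra_only.
    rewrite (_ : _ + _ = (lam b1 * (1 - eta * y))^-1 *
      (wT + lam b1 * (1 - eta * y) * (c * (y ^+ 2 * rho b1 b2 * p y))));
      last by rewrite [RHS]mulrDr mulKf // gt_eqF.
    rewrite ler_pdivlMl //.
    rewrite expr2 in k3 k5 k6 k8 k10 *.
    by move: k3 k6 k8 k9 k10; lra_only.
  - move=> [[b1 b2] y] /= ye.
    have := @weight_contract b1 _ _ _ ye (sqr_ge0 y) (lexx _).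
    rewrite exprMn => k; apply: (le_trans k).
    have px := p_ge0 ye.
    apply: ler_wpM2r; first by rewrite mulr_ge0 ?sqr_ge0.
    by rewrite ler_peMr // ltW.
  - move=> [[b1 b2] y] /= ye.
    have := @weight_contract_rho b1 b2 _ _ _ ye (sqr_ge0 y) (lexx _).
    by rewrite exprMn -[lam b1 ^+ 2 * y ^+ 2 * _]mulrA.
  - by rewrite mulr_ge0.
move=> hh; apply: (le_trans hh); rewrite -[X in _ <= X]mulrA.
apply: ler_wpM2l; first by rewrite divr_ge0 //; lra.
have Y0 : 0 <= x ^+ 2 * rho b b' by rewrite mulr_ge0 ?sqr_ge0.
by have /andP[_ p2] := p_ge1 xe; have := ler_wpM2l Y0 p2; lra.
Qed.

Lemma conjugacy_lipschitz : lipschitz_family rho eps (fun b x => H b x).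
Proof.
have [Q Q0 hQ] := shift_holder.
exists (2 + Q); first by rewrite addr_ge0.
move=> b b' x x' xe xe'; have k := H_dom1 b xe; have /andP[k0 k1] := k.
split; first by rewrite ger0_norm //; lra.
  by have := H_lip b xe xe'; have := mulr_ge0 Q0 (normr_ge0 (x - x')); lra.
rewrite (_ : H b x - H b' x = h b x - h b' x); last by ring.
apply: (le_trans (hQ b b' x xe)); have e1 := eps1.
have /andP[x0 xle] := xe; have r0 := rho_ge0 b b'.
have x1 : x ^+ 2 <= 1 by rewrite expr_le1 //; lra.
have := ler_wpM2l (mulr_ge0 Q0 r0) x1; lra.
Qed.

Local Lemma lamP0 b : 0 <= lam b <= q.
Proof. by have /andP[_ ->] := lamP b; rewrite ltW ?lam_gt0. Qed.

Local Lemma a_smooth n j : (j <= n)%N -> smooth_family rho n 1 f1 ->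
  smooth_family rho j eps (fun b x => H b x) ->
  smooth_family rho j eps (fun b x => a b x).
Proof.
move=> jn hf hH; apply: smooth_mul.
  exact: (smooth_lam rho_ge0 theta_ge1 lamP0 q1 qtheta C0 lam_holder).
have lm2 : 0 < lm / 2 by have := lm0; lra.
apply: (smooth_inv rho_ge0 lm2 f1_H_ge).
apply: (smooth_comp rho_ge0 _ H_dom1 hH).
exact: smooth_family_le hf.
Qed.

(** The factor [x], present because [a = 1] at [x = 0] for every [b], is essential: the estimate for
    [g] is run with the weight [x * rho], so its source term must carry [x] too. *)
Local Lemma a_holder : exists2 Ca : R, 0 <= Ca & forall b b' x,
  0 <= x <= eps -> `|a b x - a b' x| <= Ca * (x * rho b b').
Proof.
have [Q Q0 hQ] := shift_holder.
have lm0' := lm0; have Kp := ltW K0; have [q1' q0'] := (q1, q0).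
pose E := (2 * C + K * Q) + C * (2 * K).
have E0 : 0 <= E.
  by rewrite /E; apply: addr_ge0; [apply: addr_ge0|]; do ?apply: mulr_ge0.
exists (4 / lm ^+ 2 * E); first by rewrite mulr_ge0 // divr_ge0 ?sqr_ge0.
move=> b b' x xe; have /andP[x0 xle] := xe.
have F := f1_H_ge b xe; have F' := f1_H_ge b' xe.
have F0 : 0 < f1 b (H b x) by lra. have F0' : 0 < f1 b' (H b' x) by lra.
have r0 := rho_ge0 b b'.
(* [a = lam / (lam + psi)] with [psi] of order [x]: written through [psi], every term of the
   difference carries [x]. *)
set psi := f1 b (H b x) - lam b; set psi' := f1 b' (H b' x) - lam b'.
have k1 : `|psi| <= 2 * K * x by have [] := f1_H b xe.
have k2 := f1_holder b b' (H_dom1 b xe).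
have k3 := f1_lip b' (H_dom1 b xe) (H_dom1 b' xe).
rewrite (_ : H b x - H b' x = h b x - h b' x) in k3; last by ring.
have {k3} k3 := le_trans k3 (ler_wpM2l Kp (hQ b b' x xe)).
have k4 : `|psi - psi'| <= (2 * C + K * Q) * (x * rho b b').
  rewrite (_ : psi - psi' = (f1 b (H b x) - lam b - (f1 b' (H b x) - lam b')) +
    (f1 b' (H b x) - f1 b' (H b' x))); last by rewrite /psi /psi'; ring.
  apply: (le_trans (ler_normD2 k2 k3)).
  have /andP[_ k5] := H_dom b xe.
  have k6 := ler_wpM2l (mulr_ge0 C0 r0) k5.
  have x1 : x <= 1 by have := eps1; have := eps0; lra.
  have k7 := ler_wpM2l (mulr_ge0 (mulr_ge0 (mulr_ge0 Kp Q0) x0) r0) x1.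
  rewrite expr2; lra.
have lb1 : `|lam b| <= 1.
  by rewrite gtr0_norm ?lam_gt0 // ltW // lam_lt1.
have k8 := lam_holder b b'.
have inv_le (b1 : B) : lm / 2 <= f1 b1 (H b1 x) ->
    `|(f1 b1 (H b1 x))^-1| <= 2 / lm.
  move=> h1; have h2 : 0 < f1 b1 (H b1 x) by lra.
  rewrite gtr0_norm ?invr_gt0 // -[2 / lm]invrK lef_pV2 ?posrE //.
    by rewrite invf_div.
  by rewrite invr_gt0 divr_gt0.
rewrite (_ : a b x - a b' x = (f1 b (H b x))^-1 * (f1 b' (H b' x))^-1 *
  (lam b * - (psi - psi') + (lam b - lam b') * psi)); last first.
  by rewrite /psi /psi'; field; rewrite (gt_eqF F0) (gt_eqF F0').
rewrite (_ : 4 / lm ^+ 2 * E * _ = 2 / lm * (2 / lm) * (E * (x * rho b b'))).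
  apply: ler_normM; first by apply: ler_normM; exact: inv_le.
  rewrite /E [X in _ <= X]mulrDl; apply: ler_normD2.
    by rewrite -[X in _ <= X]mul1r; apply: ler_normM; rewrite ?normrN.
  rewrite (_ : C * (2 * K) * _ = C * rho b b' * (2 * K * x)); last by ring.
  exact: ler_normM.
by field; rewrite gt_eqF.
Qed.

(** [linear_lipschitz] would require [a] to contract by [q], while [a] merely preserves [p]. The
    missing factor [lam] is found in the weights: [m], [|x - x'|] and [x] all scale by [lam], and
    they are admissible because [g] vanishes at 0. *)
Lemma shift_derivative_lipschitz g : shift_derivative g ->
  smooth_family rho 0 1 f1 -> lipschitz_family rho eps g.
Proof.
move=> gP hf.
have [q1' q0'] := (q1, q0); have e1 := eps1; have e0 := eps0.
have Kp := ltW K0; have K1p := ltW K1_gt0; have etap := ltW eta0.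
have lm0' := lm0; have [th1 qth] := (theta_ge1, qtheta).
have s1 : 0 <= 1 - q by rewrite subr_ge0 ltW.
have s2 : 0 <= 1 - q * theta by rewrite subr_ge0 ltW.
have [th0 qge0] := (le_trans ler01 th1, ltW q0').
have hH : smooth_family rho 0 eps (fun b x => H b x).
  by split=> //; exact: conjugacy_lipschitz.
have [A A0 hA] := smooth_lipschitz (a_smooth (leqnn 0) hf hH).
have [Ca Ca0 hCa] := a_holder.
have gK1 b x : 0 <= x <= eps -> `|g b x| <= K1.
  move=> xe; have [k _] := gP b _ xe; apply: (le_trans k).
  by have /andP[x0 xle] := xe; rewrite ler_piMr //; lra.
have aw b x : 0 <= x <= eps -> `|a b x| * p (lam b * x) <= p x.
  exact: a_weight.
have wt b x (Y : R) : 0 <= x <= eps -> 0 <= Y ->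
    `|a b x| * (lam b * Y * p (lam b * x)) <= q * (Y * p x).
  move=> xe Y0; have /andP[_ lq] := lamP b.
  have k1 := ler_wpM2l (mulr_ge0 (ltW (lam_gt0 b)) Y0) (aw b x xe).
  have px := p_ge0 xe.
  by move: k1 (ler_wpM2l (mulr_ge0 Y0 px) lq); lra_only.
pose c := A * (K1 + 1).
have c0 : 0 <= c by rewrite mulr_ge0 // addr_ge0.
pose L := c / (1 - q) * 2.
have L0 : 0 <= L by rewrite mulr_ge0 // divr_ge0.
have gL b x x' : 0 <= x <= eps -> 0 <= x' <= eps ->
    `|g b x - g b x'| <= L * `|x - x'|.
  move=> xe xe'.
  pose D (z : B * R * R * R) :=
    [/\ 0 <= z.1.1.2 <= z.2, 0 <= z.1.2 <= z.2 & z.2 <= eps].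
  have := @discount R _ (fun z : B * R * R * R => (T z.1.1.1,
    lam z.1.1.1 * z.1.1.2, lam z.1.1.1 * z.1.2, lam z.1.1.1 * z.2)) D.
  move=> /(_ _ (fun z => `|g z.1.1.1 z.1.1.2 - g z.1.1.1 z.1.2|)
    (fun z => z.2 * p z.1.1.2) (fun z => `|z.1.1.2 - z.1.2| * p z.1.1.2)
    (fun z => `|a z.1.1.1 z.1.1.2|) (2 * K1) c q) HH.
  have {HH} : `|g b x - g b x'| <= c / (1 - q) * (`|x - x'| * p x).
    apply: (HH _ _ _ _ _ _ _ _ _ _ (b, x, x', eps)) => {HH} //.
    - move=> [[[b1 y] y'] n] [/= h1 h2 h3]; split; try exact: scale_dom.
      apply: le_trans h3; rewrite ler_piMl ?(ltW (lam_lt1 b1)) //.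
      by have /andP[a1 a2] := h1; apply: le_trans a2.
    - by rewrite q1' ltW.
    - move=> [[[b1 y] y'] n] [/= /andP[h1 h2] _ h3].
      have ye : 0 <= y <= eps by rewrite h1 (le_trans h2).
      by rewrite mulr_ge0 // p_ge0.
    - move=> [[[b1 y] y'] n] [/= h1 h2 h3].
      have /andP[y0 yn] := h1; have /andP[y0' yn'] := h2.
      have n0 : 0 <= n by apply: le_trans yn.
      have ye : 0 <= y <= eps by rewrite y0 (le_trans yn).
      have ye' : 0 <= y' <= eps by rewrite y0' (le_trans yn').
      have [k1 _] := gP b1 _ ye; have [k2 _] := gP b1 _ ye'.
      apply: (le_trans (ler_normB _ _)).
      have k3 := ler_wpM2l K1p yn; have k4 := ler_wpM2l K1p yn'.
      have /andP[p1 _] := p_ge1 ye.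
      by move: k1 k2 k3 k4 (ler_wpM2l (mulr_ge0 K1p n0) p1); lra_only.
    - move=> [[[b1 y] y'] n] [/= h1 h2 h3].
      have /andP[y0 yn] := h1; have /andP[y0' yn'] := h2.
      have ye : 0 <= y <= eps by rewrite y0 (le_trans yn).
      have ye' : 0 <= y' <= eps by rewrite y0' (le_trans yn').
      have [_ E1] := gP b1 _ ye; have [_ E2] := gP b1 _ ye'.
      have [_ k1 _] := hA b1 b1 _ _ ye ye'.
      have k2 := gK1 (T b1) _ (scale_eps b1 ye').
      have k3 : `|g (T b1) (lam b1 * y') + 1| <= K1 + 1.
        by apply: ler_normD2 => //; rewrite normr1.
      rewrite E1 E2 (_ : _ - _ =
        a b1 y * (g (T b1) (lam b1 * y) - g (T b1) (lam b1 * y')) +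
        (a b1 y - a b1 y') * (g (T b1) (lam b1 * y') + 1)); last by ring.
      apply: ler_normD2; first by rewrite normrM.
      apply: (le_trans (ler_normM k1 k3)).
      have /andP[p1 _] := p_ge1 ye.
      by move: (ler_wpM2l (mulr_ge0 c0 (normr_ge0 (y - y'))) p1); rewrite /c; lra_only.
    - move=> [[[b1 y] y'] n] [/= h1 h2 h3].
      have /andP[y0 yn] := h1; have n0 : 0 <= n by apply: le_trans yn.
      by apply: wt => //; rewrite y0 (le_trans yn).
    - move=> [[[b1 y] y'] n] [/= h1 h2 h3].
      have /andP[y0 yn] := h1.
      rewrite -mulrBr [`|lam b1 * (y - y')|]normrM (gtr0_norm (lam_gt0 b1)).
      by apply: wt => //; rewrite y0 (le_trans yn).
    - by rewrite mulr_ge0.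
  move=> hh; apply: (le_trans hh).
  have Y0 : 0 <= c / (1 - q) * `|x - x'|.
    by rewrite mulr_ge0 // divr_ge0.
  by have /andP[_ p2] := p_ge1 xe; move: (ler_wpM2l Y0 p2); rewrite /L; lra_only.
pose c' := A * (L * C) + Ca * (K1 + 1).
have c'0 : 0 <= c'.
  have K11 : 0 <= K1 + 1 by rewrite addr_ge0.
  by apply: addr_ge0; do !apply: mulr_ge0 => //.
pose N := c' / (1 - q * theta) * 2.
have N0 : 0 <= N by rewrite mulr_ge0 // divr_ge0.
have gN b b' x : 0 <= x <= eps -> `|g b x - g b' x| <= N * rho b b'.
  move=> xe.
  have := @discount R _ (fun z : B * B * R =>
    (T z.1.1, T z.1.2, lam z.1.1 * z.2)) (fun z => 0 <= z.2 <= eps).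
  move=> /(_ _ (fun z => `|g z.1.1 z.2 - g z.1.2 z.2|)
    (fun z => z.2 * p z.2) (fun z => z.2 * rho z.1.1 z.1.2 * p z.2)
    (fun z => `|a z.1.1 z.2|) (2 * K1) c' (q * theta)) HH.
  have {HH} : `|g b x - g b' x| <=
      c' / (1 - q * theta) * (x * rho b b' * p x).
    apply: (HH _ _ _ _ _ _ _ _ _ _ (b, b', x)) => {HH} //.
    - by move=> [[b1 b2] y] /= ye; exact: scale_eps.
    - by rewrite qth andbT mulr_ge0.
    - move=> [[b1 b2] y] /= ye; by have /andP[y0 _] := ye; apply: mulr_ge0; [rewrite mulr_ge0 | exact: p_ge0].
    - move=> [[b1 b2] y] /= ye.
      have [k1 _] := gP b1 _ ye; have [k2 _] := gP b2 _ ye.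
      apply: (le_trans (ler_normB _ _)).
      have /andP[p1 _] := p_ge1 ye; have /andP[y0 _] := ye.
      by move: k1 k2 (ler_wpM2l (mulr_ge0 K1p y0) p1); lra_only.
    - move=> [[b1 b2] y] /= ye; have /andP[y0 yle] := ye.
      have [_ E1] := gP b1 _ ye; have [_ E2] := gP b2 _ ye.
      have r0 := rho_ge0 b1 b2.
      have k2 := gK1 (T b2) _ (scale_eps b2 ye).
      have k3 : `|g (T b2) (lam b2 * y) + 1| <= K1 + 1.
        by apply: ler_normD2 => //; rewrite normr1.
      have [k4 _ _] := hA b1 b1 _ _ ye ye.
      have k5 := gL (T b2) _ _ (scale_eps b1 ye) (scale_eps b2 ye).
      rewrite -mulrBl normrM (ger0_norm y0) in k5.
      have k6 := ler_wpM2r y0 (lam_holder b1 b2).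
      have {k6} k5 := le_trans k5 (ler_wpM2l L0 k6).
      rewrite E1 E2 (_ : _ - _ =
        a b1 y * (g (T b1) (lam b1 * y) - g (T b2) (lam b1 * y)) +
        (a b1 y * (g (T b2) (lam b1 * y) - g (T b2) (lam b2 * y)) +
        (a b1 y - a b2 y) * (g (T b2) (lam b2 * y) + 1))); last by ring.
      apply: ler_normD2; first by rewrite normrM.
      apply: (le_trans (ler_normD2 (ler_normM k4 k5)
        (ler_normM (hCa b1 b2 y ye) k3))).
      have /andP[p1 _] := p_ge1 ye.
      by move: (ler_wpM2l (mulr_ge0 c'0 (mulr_ge0 y0 r0)) p1); rewrite /c'; lra_only.
    - move=> [[b1 b2] y] /= ye; have /andP[y0 _] := ye.
      apply: (le_trans (wt b1 y y ye y0)).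
      have px := p_ge0 ye.
      apply: ler_wpM2r; first by rewrite mulr_ge0.
      by rewrite ler_peMr // ltW.
    - move=> [[b1 b2] y] /= ye; have /andP[y0 _] := ye.
      have Y0 := mulr_ge0 y0 (rho_ge0 (T b1) (T b2)).
      have k1 := wt b1 y _ ye Y0.
      have px := p_ge0 ye.
      have k2 := ler_wpM2l (mulr_ge0 (mulr_ge0 (ltW q0') y0) px) (rhoT b1 b2).
      by rewrite -[lam b1 * y * _]mulrA; apply: (le_trans k1); move: k2; lra_only.
    - by rewrite mulr_ge0.
  move=> hh; apply: (le_trans hh).
  have Y0 : 0 <= c' / (1 - q * theta) * rho b b'.
    by rewrite mulr_ge0 // divr_ge0.
  have /andP[p1 p2] := p_ge1 xe; have /andP[x0 xle] := xe.
  have xle1 : x <= 1 by move: xle e1 e0; lra_only.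
  have x1 : x * p x <= 1 * 2 by apply: ler_pM => //; exact: p_ge0.
  by move: (ler_wpM2l Y0 x1); rewrite /N; lra_only.
exists (K1 + L + N); first by rewrite !addr_ge0.
move=> b b' x x' xe xe'.
have k1 := gK1 b _ xe; have k2 := gL b _ _ xe xe'; have k3 := gN b b' _ xe.
have r0 := rho_ge0 b b'; have n0 := normr_ge0 (x - x').
move: k1 k2 k3 L0 N0 (mulr_ge0 K1p r0) (mulr_ge0 L0 r0) (mulr_ge0 K1p n0)
  (mulr_ge0 N0 n0).
clear_facts; move=> k1 k2 k3 L0 N0 z1 z2 z3 z4; split; lra.
Qed.

Theorem conjugacy_smooth n : smooth_family rho n 1 f1 ->
  smooth_family rho n eps (fun b x => H b x).
Proof.
move=> hf; have [g gP] := shift_derivative_exists.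
(* Level 0 of [g] comes first, since [linear_smooth] starts from a Lipschitz solution. *)
have g0 : lipschitz_family rho eps g.
  exact: shift_derivative_lipschitz gP (smooth_family_le (leq0n n) hf).
have H0 := conjugacy_lipschitz.
suff : forall j, (j <= n)%N -> smooth_family rho j eps (fun b x => H b x).
  exact.
elim=> [|j IH] jn; first by split.
have Hj := IH (ltnW jn).
have aj := a_smooth (ltnW jn) hf Hj.
have gj : smooth_family rho j eps g.
  have cj : smooth_family rho j eps (fun b x => a b x + -1).
    by apply: smooth_add => //; exact: smooth_const.
  apply: (linear_smooth rho_ge0 rhoT theta_ge1 lamP0 q1 qtheta C0 lam_holder
    (p := fun x => p x) p_ge1 aj cj g0 a_weight).
  by move=> b x xe; have [_] := gP b x xe.
apply: (smooth_familyS (v := fun b x => 1 + g b x)) => //.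
  have [Ct Ct0 hCt] := shift_taylor gP.
  exists Ct => // b x x' xe xe'.
  rewrite (_ : H b x' - H b x - (1 + g b x) * (x' - x) =
    h b x' - h b x - g b x * (x' - x)); last by ring.
  exact: hCt.
by apply: smooth_add => //; exact: smooth_const.
Qed.

End Holder.
End Solution.
End Linearization.

(** * One-sided calculus on an interval *)

Section OneSidedCalculus.
Variables (R : realType) (a b : R).
Implicit Types (g : R -> R) (x y l : R).

(** Without the quotient, [y = x] is no longer an exception and remainders can be added. *)
Lemma is_derive_inP g x l : is_derive_in a b g x l <->
  forall e, 0 < e -> exists2 d, 0 < d & forall y, a <= y <= b ->
    `|y - x| < d -> `|g y - g x - l * (y - x)| <= e * `|y - x|.
Proof.
have eqq y : y != x -> `|l - (g y - g x) / (y - x)| * `|y - x| =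
    `|g y - g x - l * (y - x)|.
  move=> yx; rewrite -normrM -normrN; congr `|_|.
  by field; rewrite subr_eq0.
split=> [/cvgrPdist_le h e e0|h].
  have [d /= d0 hd] := h e e0; exists d => // y yab yd.
  have [->|yx] := eqVneq y x; first by rewrite !subrr mulr0 subr0 normr0 mulr0.
  rewrite -eqq // ler_wpM2r //; apply: hd => //=.
  by rewrite distrC.
apply/cvgrPdist_le => e e0; have [d d0 hd] := h e e0.
exists d => //= y /= yd yx yab.
have yx0 : 0 < `|y - x| by rewrite normr_gt0 subr_eq0.
rewrite -(ler_pM2r yx0) eqq //; apply: hd; last by rewrite distrC.
by rewrite in_itv in yab.
Qed.

(** Uniqueness of the limit defining [derive_in] rests on this. Test points are taken to the right
    of [x], except at [x = b]. *)
Lemma derive_in_proper x : a < b -> a <= x <= b ->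
  ProperFilter (within `[a, b] x^').
Proof.
move=> ab /andP[ax xb]; apply: Build_ProperFilter_ex.
move=> P [d /= d0 hd].
have [xb'|xb'] := ltP x b.
  pose t := Num.min (d / 2) (b - x).
  have t0 : 0 < t by rewrite lt_min; apply/andP; split; lra.
  have td : t <= d / 2 by rewrite ge_min lexx.
  have tb : t <= b - x by rewrite ge_min lexx orbT.
  exists (x + t); apply: hd => /=.
  - by rewrite opprD addrA subrr sub0r normrN gtr0_norm //; lra.
  - by rewrite -subr_eq0 addrAC subrr add0r gt_eqF.
  - by rewrite in_itv /=; apply/andP; split; lra.
pose t := Num.min (d / 2) (x - a).
have t0 : 0 < t by rewrite lt_min; apply/andP; split; lra.
have td : t <= d / 2 by rewrite ge_min lexx.
have tb : t <= x - a by rewrite ge_min lexx orbT.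
exists (x - t); apply: hd => /=.
- by rewrite opprB addrCA subrr addr0 gtr0_norm //; lra.
- by rewrite -subr_eq0 addrAC subrr add0r oppr_eq0 gt_eqF.
- by rewrite in_itv /=; apply/andP; split; lra.
Qed.

Lemma derive_inE g x l : a < b -> a <= x <= b ->
  is_derive_in a b g x l -> derive_in a b g x = l.
Proof.
by move=> ab xab; have := derive_in_proper ab xab => PF; apply: cvg_lim.
Qed.

Lemma eq_is_derive_in g g' x l : a <= x <= b ->
  (forall y, a <= y <= b -> g y = g' y) ->
  is_derive_in a b g x l -> is_derive_in a b g' x l.
Proof.
move=> xab gg' /is_derive_inP h; apply/is_derive_inP => e e0.
have [d d0 hd] := h e e0; exists d => // y yab yd.
by rewrite -!gg' //; exact: hd.
Qed.

Lemma is_derive_inB g g' x l l' :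
  is_derive_in a b g x l -> is_derive_in a b g' x l' ->
  is_derive_in a b (fun y => g y - g' y) x (l - l').
Proof.
move=> /is_derive_inP h /is_derive_inP h'; apply/is_derive_inP => e e0.
have e2 : 0 < e / 2 by lra.
have [d d0 hd] := h _ e2; have [d' d0' hd'] := h' _ e2.
exists (Num.min d d') => [|y yab]; first by rewrite lt_min d0.
rewrite lt_min => /andP[yd yd'].
rewrite (_ : _ - _ = (g y - g x - l * (y - x)) - (g' y - g' x - l' * (y - x)));
  last by ring.
apply: (le_trans (ler_normB _ _)).
by have := hd y yab yd; have := hd' y yab yd'; lra.
Qed.

Lemma is_derive_in_linear c x : is_derive_in a b (fun y => c * y) x c.
Proof.
apply/is_derive_inP => e e0; exists 1 => // y _ _.
by rewrite -mulrBr subrr normr0 mulr_ge0 // ltW.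
Qed.

Lemma quadratic_is_derive_in g g1 C : 0 <= C ->
  (forall x y, a <= x <= b -> a <= y <= b ->
     `|g y - g x - g1 x * (y - x)| <= C * `|y - x| ^+ 2) ->
  forall x, a <= x <= b -> is_derive_in a b g x (g1 x).
Proof.
move=> C0 h x xab; apply/is_derive_inP => e e0.
have C1 : 0 < C + 1 by lra.
exists (e / (C + 1)) => [|y yab yd]; first by rewrite divr_gt0.
apply: (le_trans (h x y xab yab)).
rewrite expr2 mulrA ler_wpM2r //.
rewrite ltr_pdivlMr // in yd; have := normr_ge0 (y - x); lra.
Qed.

Lemma lipschitz_within_continuous g C : 0 <= C ->
  (forall x y, a <= x <= b -> a <= y <= b -> `|g x - g y| <= C * `|x - y|) ->
  {within `[a, b], continuous g}.
Proof.
move=> C0 h; apply/subspace_continuousP => x /=; rewrite in_itv /= => xab.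
apply/cvgrPdist_le => e e0; have C1 : 0 < C + 1 by lra.
exists (e / (C + 1)) => /= [|y /= yd]; first by rewrite divr_gt0.
rewrite in_itv /= => yab; apply: (le_trans (h x y xab yab)).
rewrite ltr_pdivlMr // in yd; have := normr_ge0 (x - y); lra.
Qed.

Section MeanValue.
Variables (g g1 : R -> R).
Hypothesis gD : forall x, a <= x <= b -> is_derive_in a b g x (g1 x).

Lemma derivable_in_continuous : {within `[a, b], continuous g}.
Proof.
apply/subspace_continuousP => x /=; rewrite in_itv /= => xab.
have /is_derive_inP h := gD xab.
apply/cvgrPdist_le => e e0; have [d d0 hd] := h 1 ltr01.
have C1 : 0 < 1 + `|g1 x| by rewrite ltr_pwDl.
exists (Num.min d (e / (1 + `|g1 x|))) => /=.
  by rewrite lt_min d0 divr_gt0.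
move=> y /=; rewrite lt_min distrC => /andP[yd ye].
rewrite in_itv /= => yab; have k := hd y yab yd.
rewrite distrC (_ : g y - g x = (g y - g x - g1 x * (y - x)) + g1 x * (y - x));
  last by ring.
apply: (le_trans (ler_normD _ _)); rewrite normrM.
rewrite ltr_pdivlMr // in ye; lra.
Qed.

Lemma is_derive_in_interior x : a < x < b -> is_derive x 1 g (g1 x).
Proof.
move=> /andP[ax xb]; have xab : a <= x <= b by rewrite !ltW.
have /is_derive_inP h := gD xab.
have cv : h^-1 *: (g (h *: (1 : R) + x) - g x) @[h --> 0^'] --> g1 x.
  apply/cvgrPdist_le => e e0; have [d d0 hd] := h e e0.
  exists (Num.min d (Num.min (x - a) (b - x))) => /=.
    by rewrite !lt_min d0 !subr_gt0 ax xb.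
  move=> t /=; rewrite sub0r normrN !lt_min => /andP[td /andP[ta tb]] t0.
  have tt : (t *: (1 : R) + x) - x = t by rewrite addrK /GRing.scale /= mulr1.
  have yab : a <= t *: (1 : R) + x <= b.
    have := ler_norm t; have := ler_norm (- t); rewrite normrN.
    by rewrite /GRing.scale /= mulr1 => *; apply/andP; split; lra.
  have := hd _ yab; rewrite tt => /(_ td) k.
  have t1 : 0 < `|t| by rewrite normr_gt0.
  rewrite -(ler_pM2r t1); apply: le_trans k.
  rewrite -normrM -normrN le_eqVlt; apply/orP; left; apply/eqP; congr `|_|.
  by rewrite [_^-1 *: _]/GRing.scale /=; field.
by split; [apply/cvg_ex; exists (g1 x) | apply: cvg_lim].
Qed.

Lemma mean_value_bound x y C : a <= x <= b -> a <= y <= b ->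
  (forall t, Num.min x y <= t <= Num.max x y -> `|g1 t| <= C) ->
  `|g x - g y| <= C * `|x - y|.
Proof.
wlog xy : x y / x <= y.
  move=> H xab yab hC; have [xy|/ltW xy] := leP x y; first exact: H.
  by rewrite distrC [`|x - y|]distrC; apply: H => // t; rewrite minC maxC; apply: hC.
move=> /andP[ax xb] /andP[ay yb]; rewrite min_l // max_r // => hC.
have sub : `[x, y] `<=` `[a, b].
  move=> t /=; rewrite !in_itv /= => /andP[xt ty].
  by rewrite (le_trans ax) //= (le_trans ty).
have hD : forall t, t \in `]x, y[ -> is_derive t 1 g (g1 t).
  move=> t; rewrite in_itv /= => /andP[xt ty]; apply: is_derive_in_interior.
  by rewrite (le_lt_trans ax) //= (lt_le_trans ty).
have [c cxy E] := MVT_segment xy hD (continuous_subspaceW sub derivable_in_continuous).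
rewrite distrC E normrM [`|x - y|]distrC ler_wpM2r //; apply: hC.
by rewrite in_itv in cxy.
Qed.

End MeanValue.

(** The mean value bound for [g y - g1 x * y], whose derivative at [t] is at most [L * |t - x|]. *)
Lemma taylor_bound g g1 L : 0 <= L ->
  (forall x, a <= x <= b -> is_derive_in a b g x (g1 x)) ->
  (forall x y, a <= x <= b -> a <= y <= b -> `|g1 x - g1 y| <= L * `|x - y|) ->
  forall x y, a <= x <= b -> a <= y <= b ->
    `|g y - g x - g1 x * (y - x)| <= L * `|y - x| ^+ 2.
Proof.
move=> L0 gD hL x y xab yab.
have gD' t : a <= t <= b ->
    is_derive_in a b (fun y => g y - g1 x * y) t (g1 t - g1 x).
  by move=> tab; apply: is_derive_inB; [exact: gD | exact: is_derive_in_linear].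
rewrite expr2 mulrA (_ : _ - _ = (g y - g1 x * y) - (g x - g1 x * x)); last by ring.
apply: (mean_value_bound gD') => // t txy.
have hmin : Num.min x y <= y by rewrite ge_min lexx orbT.
have /andP[ax xb] := xab; have /andP[ay yb] := yab; have /andP[t1 t2] := txy.
have tab : a <= t <= b.
  apply/andP; split; first by apply: le_trans t1; rewrite le_min ax ay.
  by apply: le_trans t2 _; rewrite ge_max xb yb.
apply: (le_trans (hL t x tab xab)); rewrite ler_wpM2l //.
move: t1 t2; case: (leP x y) => xy t1 t2.
  by rewrite !ger0_norm; lra.
by rewrite !ler0_norm; lra.
Qed.

(** The iterated [derive_in] can be read off from any chain of functions known to be successive
    derivatives; this is the passage from families to [class_C] and [C_norm]. *)
Lemma derive_in_nE n (du : nat -> R -> R) : a < b ->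
  (forall j x, (j < n)%N -> a <= x <= b ->
     is_derive_in a b (du j) x (du j.+1 x)) ->
  forall g, (forall x, a <= x <= b -> g x = du 0%N x) ->
  forall j x, (j <= n)%N -> a <= x <= b -> derive_in_n a b j g x = du j x.
Proof.
move=> ab h g g0; elim=> [|j IH] x jn xab; first exact: g0.
rewrite /derive_in_n iterS; apply: derive_inE => //.
apply: (@eq_is_derive_in (du j)) => //; last exact: h.
by move=> y yab; rewrite -IH // ltnW.
Qed.

End OneSidedCalculus.

(** * Growth of integer matrices *)

(** The right factor [B] carries the induction: if [(A - z) B] is annihilated by the remaining
    factors, its growth is known, and [A^(k+1) B = A^k (A - z) B + z A^k B] transfers it to [B]. *)
Lemma annihilated_growth (C : numFieldType) n (A : 'M[C]_n.+1) (s : seq C)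
    (mu M : C) : 0 <= mu -> mu < M -> {in s, forall z, `|z| <= mu} ->
  forall B : 'M[C]_n.+1, horner_mx A (\prod_(z <- s) ('X - z%:P)) *m B = 0 ->
  exists2 c : C, 0 <= c & forall k i j, `|(A ^+ k *m B) i j| <= c * M ^+ k.
Proof.
move=> mu0 muM; have M0 : 0 <= M by apply: le_trans mu0 (ltW muM).
elim: s => [|z s IH] zs B.
  rewrite big_nil rmorph1 mul1mx => ->; exists 0 => // k i j.
  by rewrite mulmx0 mxE normr0 mul0r.
rewrite big_cons mulrC rmorphM /= -mulmxA => /IH [|c c0 hc].
  by move=> w ws; apply: zs; rewrite inE ws orbT.
have zmu : `|z| <= mu by apply: zs; rewrite inE eqxx.
have Mmu : 0 < M - mu by rewrite subr_gt0.
pose S := \sum_i \sum_j `|B i j|.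
have S0 : 0 <= S by apply: sumr_ge0 => i _; apply: sumr_ge0.
(* [S] settles [k = 0]; [c / (M - mu)] solves [c + mu t = M t], as the recursion demands. *)
exists (c / (M - mu) + S); first by rewrite addr_ge0 // divr_ge0 // ltW.
elim=> [|k IHk] i j.
  rewrite expr0 mul1mx mulr1; apply: (@le_trans _ _ S); last first.
    by rewrite lerDr divr_ge0 // ltW.
  rewrite /S (bigD1 i) //= (bigD1 j) //= -addrA lerDl addr_ge0 //.
    by apply: sumr_ge0.
  by apply: sumr_ge0 => i' _; apply: sumr_ge0.
have -> : A ^+ k.+1 *m B =
    A ^+ k *m (horner_mx A ('X - z%:P) *m B) + z *: (A ^+ k *m B).
  rewrite rmorphB /= horner_mx_X horner_mx_C mulmxBl mulmxBr.
  by rewrite mul_scalar_mx -scalemxAr subrK exprSr -mulmxA.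
rewrite mxE [X in _ + X]mxE; apply: (le_trans (ler_normD _ _)).
have h1 : `|z * (A ^+ k *m B) i j| <= mu * ((c / (M - mu) + S) * M ^+ k).
  by rewrite normrM; apply: ler_pM.
apply: (le_trans (lerD (hc k i j) h1)).
set q := c / (M - mu) + S.
have q0 : 0 <= q by rewrite addr_ge0 // divr_ge0 // ltW.
rewrite mulrA -mulrDl exprS mulrA; apply: ler_wpM2r; first exact: exprn_ge0.
rewrite -lerBrDr [mu * q]mulrC -mulrBr mulrDl divfK ?gt_eqF // lerDl.
by rewrite mulr_ge0 // ltW.
Qed.

Section IntegerMatrix.
Variables (R : realType) (d : nat) (A : 'M[int]_d.+1).
Local Notation AR := (map_mx intr A : 'M[R]_d.+1).

Lemma integer_matrix_growth (mu M : R) : 0 <= mu -> mu < M ->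
  (forall z : R[i], is_eigenvalue A z -> `|z| <= mu%:C%C) ->
  exists2 c : R, 0 <= c & forall k i j, `|(AR ^+ k) i j| <= c * M ^+ k.
Proof.
move=> mu0 muM hmu.
pose AC := map_mx intr A : 'M[R[i]]_d.+1.
have [s Es] := closed_field_poly_normal (char_poly AC).
rewrite (monicP (char_poly_monic AC)) scale1r in Es.
have [||z zs||c c0 hc] := @annihilated_growth _ _ AC s mu%:C%C M%:C%C _ _ _ 1%:M.
- by rewrite ler0c.
- by rewrite ltcR.
- by apply: hmu; rewrite /is_eigenvalue eigenvalue_root_char Es root_prod_XsubC.
- by rewrite -Es Cayley_Hamilton mul0mx.
exists (complex.Re c).
  by move: c0; rewrite lecE => /andP[].
move=> k i j; have := hc k i j; rewrite mulmx1.
have -> : AC ^+ k = map_mx (real_complex R) (AR ^+ k).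
  rewrite rmorphXn /=; congr (_ ^+ k).
  by apply/matrixP => i' j'; rewrite !mxE rmorph_int.
have -> : c * M%:C%C ^+ k = (complex.Re c * M ^+ k)%:C%C.
  by rewrite rmorphM rmorphXn /= RRe_real // ger0_real.
rewrite mxE.
rewrite normc_def /= expr0n /= addr0 sqrtr_sqr lecR.
by [].
Qed.

Lemma eucl_norm_ge0 n (v : 'cV[R]_n) : 0 <= eucl_norm v.
Proof. exact: sqrtr_ge0. Qed.

Lemma entry_le_eucl_norm n (v : 'cV[R]_n) i : `|v i 0| <= eucl_norm v.
Proof.
rewrite -sqrtr_sqr ler_sqrt; last by apply: sumr_ge0 => j _; exact: sqr_ge0.
rewrite (bigD1 i) //= lerDl; apply: sumr_ge0 => j _; exact: sqr_ge0.
Qed.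

Lemma eucl_norm_le n (v : 'cV[R]_n) (t : R) : 0 <= t ->
  (forall i, `|v i 0| <= t) -> eucl_norm v <= n%:R * t.
Proof.
move=> t0 h; rewrite -[X in _ <= X]ger0_norm ?mulr_ge0 // -sqrtr_sqr.
rewrite ler_sqrt ?sqr_ge0 //.
apply: (@le_trans _ _ (\sum_(i < n) t ^+ 2)).
  by apply: ler_sum => i _; rewrite -real_normK ?num_real // lerXn2r ?nnegrE.
rewrite sumr_const card_ord -[X in X <= _]mulr_natl exprMn ler_wpM2r ?sqr_ge0 //.
by rewrite -natrX ler_nat; case: n {v h} => // n; rewrite expnS leq_pmulr ?expn_gt0.
Qed.

Lemma eucl_norm_mulmx (B : 'M[R]_d.+1) (t : R) v : 0 <= t ->
  (forall i j, `|B i j| <= t) ->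
  eucl_norm (B *m v) <= (d.+1%:R * (d.+1%:R * t)) * eucl_norm v.
Proof.
move=> t0 h; rewrite -mulrA; apply: eucl_norm_le.
  by rewrite !mulr_ge0 // eucl_norm_ge0.
move=> i; rewrite mxE; apply: (le_trans (ler_norm_sum _ _ _)).
apply: (@le_trans _ _ (\sum_(j < d.+1) t * eucl_norm v)).
  apply: ler_sum => j _; rewrite normrM; apply: ler_pM => //.
  exact: entry_le_eucl_norm.
by rewrite sumr_const card_ord -[X in X <= _]mulr_natl mulrA.
Qed.

(** Growth at a rate [M'] strictly between [mu] and [M] lets [(M' / M)^N] absorb the constant, so
    that one power of [A] obeys the rate [M] with no constant in front. *)
Lemma integer_matrix_eventually_expansive_le (mu M : R) : 0 <= mu -> mu < M ->
  (forall z : R[i], is_eigenvalue A z -> `|z| <= mu%:C%C) ->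
  exists2 N : nat, (0 < N)%N & forall v : 'cV[R]_d.+1,
    eucl_norm (AR ^+ N *m v) <= M ^+ N * eucl_norm v.
Proof.
move=> mu0 muM hmu; pose M' := (mu + M) / 2.
have M'0 : 0 <= M' by rewrite /M'; lra.
have M0 : 0 < M by lra.
have [|c c0 hc] := integer_matrix_growth mu0 (_ : mu < M') hmu.
  by rewrite /M'; lra.
pose D : R := d.+1%:R * d.+1%:R * c.
have D0 : 0 <= D by rewrite !mulr_ge0.
have cv : D * (M' / M) ^+ n @[n --> \oo] --> (0 : R).
  rewrite -(mulr0 D); apply: cvgMl_tmp; apply: cvg_expr.
  rewrite ger0_norm; last by rewrite divr_ge0 // ltW.
  by rewrite ltr_pdivrMr // mul1r /M'; lra.
have /cvgrPdist_le /(_ 1 ltr01) [N _ hN] := cv.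
exists N.+1 => // v.
have := hN N.+1 (leqnSn N); rewrite /= sub0r normrN ger0_norm; last first.
  by rewrite mulr_ge0 // exprn_ge0 // divr_ge0 // ltW.
rewrite exprMn exprVn mulrA ler_pdivrMr ?exprn_gt0 // mul1r => h.
have cM : 0 <= c * M' ^+ N.+1 by rewrite mulr_ge0 // exprn_ge0.
apply: (le_trans (eucl_norm_mulmx _ cM (hc N.+1))).
apply: ler_wpM2r; first exact: eucl_norm_ge0.
by rewrite !mulrA.
Qed.

(** If [mu < 1], the integer matrices [A^n] tend to 0, so one of them vanishes, against
    invertibility; hyperbolicity excludes [mu = 1]. Hence [ln mu > 0] in the bound on the
    exponent. *)
Lemma hyperbolic_largest_modulus_gt1 (mu : R) : A \in unitmx ->
  hyperbolic R A -> largest_modulus A mu -> 1 < mu.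
Proof.
move=> Au hA [[z hz zmu] hmu].
have mu0 : 0 <= mu by rewrite -ler0c -zmu.
have mu1 : mu != 1.
  by have := hA z hz; rewrite zmu; apply: contraNneq => ->.
have [//|mule] := ltP 1 mu.
have {mule} mu1' : mu < 1 by rewrite lt_neqAle mu1.
have muM : mu < (mu + 1) / 2 by lra.
have [c c0 hc] := integer_matrix_growth mu0 muM hmu.
have cv : c * ((mu + 1) / 2) ^+ n @[n --> \oo] --> (0 : R).
  rewrite -(mulr0 c); apply: cvgMl_tmp; apply: cvg_expr.
  by rewrite ger0_norm; lra.
have h2 : (0 : R) < 2^-1 by rewrite invr_gt0.
have /cvgrPdist_le /(_ _ h2) [N _ hN] := cv.
have A0 : A ^+ N = 0.
  apply/matrixP => i j; rewrite [RHS]mxE.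
  have := hc N i j; rewrite -rmorphXn /= mxE => k1.
  have := hN N (leqnn N); rewrite /= sub0r normrN => k2.
  have k3 : `|((A ^+ N) i j)%:~R : R| < 1.
    by have := ler_norm (c * ((mu + 1) / 2) ^+ N); lra.
  move: k3; rewrite -intr_norm ltrz1; by move: ((A ^+ N) i j) => [[|n]|n].
have : A ^+ N \is a GRing.unit by rewrite unitrX.
by rewrite A0 unitr0.
Qed.

End IntegerMatrix.

(** * The torus *)

Lemma powR_small (R : realType) (C alpha e : R) : 0 <= C -> 0 < alpha -> 0 < e ->
  exists2 r : R, 0 < r & forall t, 0 <= t -> t < r -> C * t `^ alpha <= e.
Proof.
move=> C0 alpha0 e0; have C1 : 0 < C + 1 by lra.
pose r := (e / (C + 1)) `^ alpha^-1.
have r0 : 0 < r by rewrite powR_gt0 // divr_gt0.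
exists r => // t t0 tr.
have k : t `^ alpha <= e / (C + 1).
  have -> : e / (C + 1) = r `^ alpha.
    by rewrite /r -powRrM mulVf ?lt0r_neq0 // powRr1 // divr_ge0 // ltW.
  by apply: ge0_ler_powR; rewrite ?nnegrE ?(ltW alpha0) ?(ltW r0) // ltW.
apply: (le_trans (ler_wpM2l C0 k)).
by rewrite mulrA ler_pdivrMr // mulrC ler_wpM2l ?(ltW e0) //; lra.
Qed.

Section TorusDistance.
Local Open Scope quotient_scope.
Variables (R : realType) (d : nat).
Local Notation torus := (torus R d.+1).
Implicit Types (b : torus) (v w : 'cV[R]_d.+1).

Lemma pi_torus_eqP v w :
  \pi_torus v = \pi_torus w <-> v - w \in lattice (R := R) (d := d.+1).
Proof.
split=> [h|]; first by rewrite Quotient.idealrBE; apply/eqP.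
by rewrite Quotient.idealrBE => /eqP.
Qed.

Lemma torus_dist_set_lb b b' :
  lbound [set eucl_norm (v - v') | v in [set v | \pi_torus v = b]
                              & v' in [set v' | \pi_torus v' = b']] 0.
Proof. by move=> _ [v _] [v' _ <-]; exact: eucl_norm_ge0. Qed.

Lemma torus_dist_has_inf b b' :
  has_inf [set eucl_norm (v - v') | v in [set v | \pi_torus v = b]
                              & v' in [set v' | \pi_torus v' = b']].
Proof.
split; last by exists 0; exact: torus_dist_set_lb.
exists (eucl_norm (repr b - repr b')).
by exists (repr b); [exact: reprK | exists (repr b') => //; exact: reprK].
Qed.

Lemma torus_dist_ge0 b b' : 0 <= torus_dist b b'.
Proof.
by apply: lb_le_inf; [have [] := torus_dist_has_inf b b' | exact: torus_dist_set_lb].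
Qed.

Lemma torus_dist_pi v w :
  torus_dist (\pi_torus v) (\pi_torus w) <= eucl_norm (v - w).
Proof.
apply: ge_inf; first by exists 0; exact: torus_dist_set_lb.
by exists v => //; exists w.
Qed.

Lemma torus_dist_lipschitz (A : 'M[int]_d.+1) (n : nat) (t : R) : 0 <= t ->
  (forall v, eucl_norm ((map_mx intr A : 'M[R]__) ^+ n *m v) <= t * eucl_norm v) ->
  forall b b', torus_dist (iter n (torus_map A) b) (iter n (torus_map A) b') <=
    t * torus_dist b b'.
Proof.
move=> t0 ht b b'.
have iterE v : iter n (torus_map A) (\pi_torus v) =
    \pi_torus ((map_mx intr A : 'M[R]__) ^+ n *m v).
  elim: n {ht} v => [|n IH] v; first by rewrite expr0 mul1mx.
  by rewrite iterS IH torus_mapE exprS -mulmxA.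
apply/ler_addgt0Pr => e e0.
have t1 : 0 < t + 1 by lra.
have et : 0 < e / (t + 1) by rewrite divr_gt0.
(* Nearly optimal lifts; the margin [e / (t + 1)] also covers [t = 0]. *)
have [_ [v /= vb [v' /= vb' <-]] hv] := inf_adherent et (torus_dist_has_inf b b').
rewrite -vb -vb' !iterE.
apply: (le_trans (torus_dist_pi _ _)); rewrite -mulmxBr.
apply: (le_trans (ht _)).
rewrite -vb -vb' in hv.
have := ler_wpM2l t0 (ltW hv); rewrite -/(torus_dist _ _) => h.
apply: (le_trans h); rewrite mulrDr lerD2l mulrA ler_pdivrMr //.
by rewrite mulrC ler_wpM2l ?(ltW e0) //; lra.
Qed.

Lemma torus_repr_cube b :
  exists2 v, \pi_torus v = b & forall i, 0 <= v i 0 <= 1.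
Proof.
pose v : 'cV[R]_d.+1 := \col_i (repr b i 0 - (Num.floor (repr b i 0))%:~R).
exists v => [|i]; last first.
  rewrite mxE; have := floor_le (repr b i 0); have := floorD1_gt (repr b i 0).
  by rewrite intrD => *; apply/andP; split; lra.
rewrite -[b in RHS]reprK; apply/pi_torus_eqP.
apply/mxOverP => i j; rewrite !mxE ord1 addrAC subrr add0r rpredN.
exact: intr_int.
Qed.

Lemma torus_dist_le_diam b b' : torus_dist b b' <= d.+1%:R.
Proof.
have [v <- hv] := torus_repr_cube b; have [v' <- hv'] := torus_repr_cube b'.
apply: (le_trans (torus_dist_pi _ _)).
rewrite -[X in _ <= X]mulr1; apply: eucl_norm_le => // i.
rewrite !mxE; have := hv i; have := hv' i => *.
by rewrite ler_norml; apply/andP; split; lra.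
Qed.

Lemma eucl_norm_continuous v : continuous (fun w => eucl_norm (v - w)).
Proof.
have -> : (fun w => eucl_norm (v - w)) =
    Num.sqrt \o (fun w : 'cV[R]_d.+1 => \sum_i (v i 0 - w i 0) ^+ 2).
  apply/funext => w; rewrite /eucl_norm /=; congr Num.sqrt.
  by apply: eq_bigr => i _; rewrite !mxE.
have sum_cont : continuous (fun w : 'cV[R]_d.+1 => \sum_i (v i 0 - w i 0) ^+ 2).
  apply: (continuous_big (op := +%R)) => [|i _ w]; first exact: add_continuous.
  apply: (@continuous_comp _ _ _ (fun w : 'cV[R]_d.+1 => v i 0 - w i 0)
    (fun x : R => x ^+ 2)); last exact: exprn_continuous.
  by apply: (@continuousB _ _ _ (fun=> v i 0)); [apply: cst_continuous | exact: coord_continuous].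
by move=> w; apply: continuous_comp; [exact: sum_cont | exact: sqrt_continuous].
Qed.

(** [U] describes the ball by representatives, so that its preimage is the union of the open
    Euclidean balls around all lifts of [b]. *)
Lemma torus_dist_nbhs b (r : R) : 0 < r ->
  nbhs b [set b' | torus_dist b b' < r].
Proof.
move=> r0; pose U : set torus := [set b' | exists2 w, \pi_torus w = b' &
  exists2 v, \pi_torus v = b & eucl_norm (v - w) < r].
have Ub : U b.
  exists (repr b); first exact: reprK.
  exists (repr b); first exact: reprK.
  rewrite subrr; apply: le_lt_trans r0.
  by rewrite -[X in _ <= X](mulr0 d.+1%:R); apply: eucl_norm_le => // i; rewrite mxE normr0.
apply: (filterS (P := U)) => [_ [w <-] [v <- h]|]; first exact: le_lt_trans (torus_dist_pi v w) h.
suff oU : open U by exact: open_nbhs_nbhs.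
rewrite /open /= /quotient_open.
rewrite (_ : _ @^-1` U = \bigcup_(v in [set v | \pi_torus v = b])
  ((fun w => eucl_norm (v - w)) @^-1` [set x | x < r])).
  apply: bigcup_open => v _.
  by apply: open_comp; [move=> ? _; exact: eucl_norm_continuous | exact: open_lt].
apply/seteqP; split=> [w [w' ww' [v vb h]]|w [v vb h]]; last by exists w => //; exists v.
(* [w] may differ from the lift [w'] that is close to [v]; translating [v] by the lattice vector
   [w - w'] gives a lift of [b] close to [w]. *)
exists (v + w - w') => /=.
  rewrite -vb; apply/pi_torus_eqP.
  rewrite (_ : v + w - w' - v = w - w'); last first.
    by apply/matrixP => i j; rewrite !mxE; ring.
  by apply/pi_torus_eqP.
by rewrite (_ : v + w - w' - w = v - w') //; apply/matrixP => i j; rewrite !mxE; ring.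
Qed.

(** Compactness is used on the unit cube, which covers the torus: the lift of [l] is continuous and
    attains its minimum there. The cube consists of row vectors, as in [EVT_min_rV], whence the
    transposes. *)
Lemma torus_holder_min (l : torus -> R) (C beta : R) : 0 <= C -> 0 < beta ->
  (forall b b', `|l b - l b'| <= C * torus_dist b b' `^ beta) ->
  (forall b, 0 < l b) -> exists2 m : R, 0 < m & forall b, m <= l b.
Proof.
move=> C0 beta0 hl l0.
have cl : continuous l.
  move=> b; apply/(@cvgrPdist_le _ _ _ (nbhs b) (nbhs_filter b)) => e e0.
  have [r r0 hr] := powR_small C0 beta0 e0.
  apply: filterS (torus_dist_nbhs b r0) => b' /= h.
  exact: le_trans (hl b b') (hr _ (torus_dist_ge0 b b') h).
pose K := [set w : 'rV[R]_d.+1 | forall i, `[0 : R, 1]%classic (w ord0 i)].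
have cK : compact K.
  by apply: (@rV_compact R d.+1 (fun=> `[0 : R, 1]%classic)) => i; exact: segment_compact.
have K0 : K !=set0.
  by exists 0 => i /=; rewrite mxE in_itv /= lexx ler01.
pose F (w : 'rV[R]_d.+1) := l (\pi_torus w^T).
have cF : {within K, continuous F}.
  apply: continuous_subspaceT => w.
  apply: (@continuous_comp _ _ _ (fun w : 'rV[R]_d.+1 => \pi_torus w^T : torus) l);
    last exact: cl.
  apply: (@continuous_comp _ _ _ (fun w : 'rV[R]_d.+1 => w^T) (fun v => \pi_torus v : torus));
    last exact: pi_continuous.
  move=> S /= /(nbhs_ballP _) [e e0 es].
  apply/nbhs_ballP; exists e => //= N [_ MN]; apply: es; split => // i j.
  by rewrite !mxE; exact: MN.
have [w _ hw] := EVT_min_rV K0 cK cF.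
exists (F w) => [|b]; first exact: l0.
have [v vb hv] := torus_repr_cube b.
have := hw v^T; rewrite inE /F trmxK vb; apply => i /=.
by rewrite mxE in_itv /=; exact: hv.
Qed.

End TorusDistance.

(** * A distance adapted to the base map *)

Section AdaptedDistance.
Variables (R : realType) (d : nat) (A : 'M[int]_d.+1) (alpha M : R) (N : nat).
Hypothesis alpha0 : 0 < alpha.
Hypothesis M0 : 0 < M.
Hypothesis N0 : (0 < N)%N.
Hypothesis AN : forall v : 'cV[R]_d.+1,
  eucl_norm ((map_mx intr A : 'M[R]__) ^+ N *m v) <= M ^+ N * eucl_norm v.
Local Notation T := (torus_map A).
Implicit Types b : torus R d.+1.

Definition adapted_dist b b' : R :=
  \sum_(i < N) torus_dist (iter i T b) (iter i T b') `^ alpha / (M `^ alpha) ^+ i.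

Lemma adapted_dist_ge0 b b' : 0 <= adapted_dist b b'.
Proof.
apply: sumr_ge0 => i _; rewrite divr_ge0 ?powR_ge0 //.
by rewrite exprn_ge0 // powR_ge0.
Qed.

Lemma adapted_dist_map b b' :
  adapted_dist (T b) (T b') <= M `^ alpha * adapted_dist b b'.
Proof.
set th := M `^ alpha; have th0 : 0 < th by exact: powR_gt0.
pose F i := torus_dist (iter i T b) (iter i T b') `^ alpha / th ^+ i.
have -> : adapted_dist (T b) (T b') = th * \sum_(i < N) F i.+1.
  rewrite /adapted_dist mulr_sumr; apply: eq_bigr => i _.
  by rewrite -!iterSr /F -/th exprS invfM [RHS]mulrCA mulVKf // gt_eqF.
rewrite ler_pM2l //.
have : \sum_(i < N) F i.+1 + F 0%N = \sum_(i < N) F i + F N.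
  by rewrite -(big_ord_recr N (fun i => F i)) /= big_ord_recl addrC.
(* Applying the map trades the term [i = 0] for the term [i = N]; the choice of [N] makes the latter
   no larger. *)
have : F N <= F 0%N.
  rewrite /F expr0 divr1 /= ler_pdivrMr ?exprn_gt0 //.
  have -> : th ^+ N = (M ^+ N) `^ alpha.
    by rewrite -powR_mulrn ?powR_ge0 // powRAC powR_mulrn // ltW.
  rewrite -powRM ?torus_dist_ge0 ?exprn_ge0 ?(ltW M0) //.
  apply: ge0_ler_powR; rewrite ?nnegrE ?(ltW alpha0) ?torus_dist_ge0 //.
    by rewrite mulr_ge0 ?torus_dist_ge0 ?exprn_ge0 ?(ltW M0).
  by rewrite mulrC; apply: torus_dist_lipschitz => //; rewrite exprn_ge0 // ltW.
rewrite /adapted_dist -/th => h1 h2.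
have : \sum_(i < N) F i.+1 <= \sum_(i < N) F i by lra.
by [].
Qed.

Lemma torus_dist_le_adapted b b' : torus_dist b b' `^ alpha <= adapted_dist b b'.
Proof.
rewrite /adapted_dist -(prednK N0) big_ord_recl /= expr0 divr1 lerDl.
apply: sumr_ge0 => i _; rewrite divr_ge0 ?powR_ge0 //.
by rewrite exprn_ge0 // powR_ge0.
Qed.

Lemma adapted_dist_le : exists2 C : R, 0 <= C & forall b b',
  adapted_dist b b' <= C * torus_dist b b' `^ alpha.
Proof.
pose AR : 'M[R]_d.+1 := map_mx intr A.
pose s i := \sum_j \sum_l `|(AR ^+ i) j l|.
have s0 i : 0 <= s i by apply: sumr_ge0 => j _; apply: sumr_ge0.
pose t i := d.+1%:R * (d.+1%:R * s i).
have t0 i : 0 <= t i by rewrite !mulr_ge0.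
exists (\sum_(i < N) t i `^ alpha / (M `^ alpha) ^+ i).
  apply: sumr_ge0 => i _; rewrite divr_ge0 ?powR_ge0 //.
  by rewrite exprn_ge0 // powR_ge0.
move=> b b'; rewrite mulr_suml; apply: ler_sum => i _.
rewrite mulrAC ler_wpM2r ?invr_ge0 ?exprn_ge0 ?powR_ge0 //.
rewrite -powRM ?torus_dist_ge0 //.
apply: ge0_ler_powR; rewrite ?nnegrE ?(ltW alpha0) ?torus_dist_ge0 //.
  by rewrite mulr_ge0 ?torus_dist_ge0.
apply: torus_dist_lipschitz => // v; apply: eucl_norm_mulmx => // j l.
rewrite /s (bigD1 j) //= (bigD1 l) //= -addrA lerDl addr_ge0 //.
  by apply: sumr_ge0.
by apply: sumr_ge0 => i' _; apply: sumr_ge0.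
Qed.

End AdaptedDistance.

(** The diameter is finite, so the excess [beta - alpha] of the exponent costs only a constant. *)
Lemma torus_dist_powR_le (R : realType) d (alpha beta : R) : 0 < alpha -> alpha <= beta ->
  exists2 C : R, 0 <= C & forall b b' : torus R d.+1,
  torus_dist b b' `^ beta <= C * torus_dist b b' `^ alpha.
Proof.
move=> alpha0 ab; exists (d.+1%:R `^ (beta - alpha)); first exact: powR_ge0.
move=> b b'.
have -> : torus_dist b b' `^ beta =
    torus_dist b b' `^ (beta - alpha) * torus_dist b b' `^ alpha.
  rewrite -powRD ?subrK //; apply/implyP => /eqP h.
  by move: alpha0 ab; rewrite h; lra.
apply: ler_wpM2r; first exact: powR_ge0.
by apply: ge0_ler_powR; rewrite ?nnegrE ?subr_ge0 ?torus_dist_ge0 // torus_dist_le_diam.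
Qed.

(** * The theorem *)

(** Monotonicity would allow a zero derivative. Differentiability of the inverse at 0 excludes it:
    [y = g' (g y) <= c * g y] for small [y]. *)
Lemma or_diffeo_derive_gt0 (R : realType) (g : R -> R) :
  or_diffeo 0 1 g -> g 0 = 0 -> 0 < derive_in 0 1 g 0.
Proof.
move=> [inc [dg _] [g' [g01 _ gK _ [dg' _]]]] g0.
have z1 : (0 : R) \in `[0, 1] by rewrite in_itv /= lexx ler01.
have z1' : 0 <= (0 : R) <= 1 by rewrite lexx ler01.
have [l hl] := dg 0%N 0 isT z1; have [l' hl'] := dg' 0%N 0 isT z1.
rewrite (derive_inE ltr01 z1' hl).
have g'0 : g' 0 = 0 by rewrite -{1}g0 gK.
move/is_derive_inP: hl => hl; move/is_derive_inP: hl' => hl'.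
have [d' d'0 hd'] := hl' 1 ltr01.
pose c : R := `|l'| + 1; have c0 : 0 < c by rewrite ltr_wpDl.
have [//|l0] := ltP 0 l.
(* If [l <= 0], this precision gives [g y <= y / (2 * c)], incompatible with [y <= c * g y]. *)
have e0 : 0 < (2 * c)^-1 by rewrite invr_gt0 mulr_gt0.
have [d d0 hd] := hl _ e0; have [d1 d10 hd1] := hl 1 ltr01.
(* The last bound keeps [g y], at most [(|l| + 1) * y], below [d'], where the expansion of [g']
   holds. *)
pose y := Num.min 1 (Num.min (d / 2) (Num.min (d1 / 2) (d' / (2 * (`|l| + 1))))).
have l1 : 0 < `|l| + 1 by rewrite ltr_wpDl.
have y0 : 0 < y.
  rewrite /y !lt_min ltr01 /=; by do !(apply/andP; split); rewrite divr_gt0 // mulr_gt0.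
have y1 : y <= 1 by rewrite /y ge_min lexx.
have yd : y <= d / 2 by rewrite /y !ge_min lexx !orbT.
have yd1 : y <= d1 / 2 by rewrite /y !ge_min lexx !orbT.
have yd' : y <= d' / (2 * (`|l| + 1)) by rewrite /y !ge_min lexx !orbT.
have y01 : 0 <= y <= 1 by rewrite ltW.
have /andP[gy0 gy1] : 0 <= g y <= 1 by have := g01 y; rewrite !in_itv /=; apply.
have k1 : `|g y - g 0 - l * (y - 0)| <= (2 * c)^-1 * `|y - 0|.
  by apply: hd => //; rewrite subr0 gtr0_norm //; move: yd y0; clear; lra.
have k2 : `|g y - g 0 - l * (y - 0)| <= 1 * `|y - 0|.
  by apply: hd1 => //; rewrite subr0 gtr0_norm //; move: yd1 y0; clear; lra.
rewrite g0 !subr0 (gtr0_norm y0) in k1 k2.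
have k3 : `|g y| <= (`|l| + 1) * y.
  rewrite (_ : g y = (g y - l * y) + l * y); last by ring.
  apply: (le_trans (ler_normD _ _)); rewrite normrM (gtr0_norm y0).
  by move: k2; clear; lra.
have gyd' : `|g y - 0| < d'.
  rewrite subr0; apply: (le_lt_trans k3).
  have := ler_wpM2l (ltW l1) yd'.
  rewrite (_ : (`|l| + 1) * (d' / (2 * (`|l| + 1))) = d' / 2); first by move: d'0; clear; lra.
  by field; rewrite gt_eqF.
have gy01 : 0 <= g y <= 1 by rewrite gy0.
have k4 : `|g' (g y) - g' 0 - l' * (g y - 0)| <= 1 * `|g y - 0|.
  exact: hd'.
rewrite gK ?in_itv //= g'0 !subr0 (ger0_norm gy0) in k4.
have k5 : y <= c * g y.
  move: k4; rewrite ler_norml => /andP[_ k4].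
  by move: k4 (ler_wpM2r gy0 (ler_norm l')); rewrite /c; clear; lra.
have k6 : g y <= (2 * c)^-1 * y.
  move: k1; rewrite ler_norml => /andP[_ k1].
  by move: k1 (ler_wpM2r (ltW y0) l0); clear; lra.
have := ler_wpM2l (ltW c0) k6.
rewrite (_ : c * ((2 * c)^-1 * y) = y / 2); last by field; rewrite gt_eqF.
by move: k5 y0; clear; lra.
Qed.

Section DerivativesOfFamily.
Variables (R : realType) (k : nat) (g : R -> R).
Hypothesis gC : class_C 0 1 k g.

Lemma class_C_is_derive_in j x : (j < k)%N -> 0 <= x <= 1 ->
  is_derive_in 0 1 (derive_in_n 0 1 j g) x (derive_in_n 0 1 j.+1 g x).
Proof.
move=> jk x01; have [h _] := gC.
have [|l hl] := h j x jk; first by rewrite in_itv.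
by rewrite {2}/derive_in_n iterS (derive_inE ltr01 x01 hl).
Qed.

Lemma class_C_bounded j : (j <= k)%N ->
  exists C : R, forall x, 0 <= x <= 1 -> `|derive_in_n 0 1 j g x| <= C.
Proof.
move=> jk.
have c : {within `[0, 1], continuous (derive_in_n 0 1 j g)}.
  move: jk; rewrite leq_eqVlt => /orP[/eqP->|jk]; first by have [] := gC.
  apply: (@derivable_in_continuous _ _ _ _ (derive_in_n 0 1 j.+1 g)).
  by move=> x; exact: class_C_is_derive_in.
have [x1 _ h1] := EVT_max ler01 c; have [x2 _ h2] := EVT_min ler01 c.
exists (`|derive_in_n 0 1 j g x1| + `|derive_in_n 0 1 j g x2|) => x x01.
have xi : x \in `[0, 1] by rewrite in_itv.
have := h1 x xi; have := h2 x xi.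
have := ler_norm (derive_in_n 0 1 j g x1).
have := ler_norm (- derive_in_n 0 1 j g x2); rewrite normrN.
have := normr_ge0 (derive_in_n 0 1 j g x1).
have := normr_ge0 (derive_in_n 0 1 j g x2).
by rewrite ler_norml => *; apply/andP; split; lra.
Qed.

End DerivativesOfFamily.

Lemma C_normB_derive_in_n (R : realType) k (g g' : R -> R) (c : R) :
  class_C 0 1 k g -> class_C 0 1 k g' ->
  (C_norm 0 1 k (g \- g')%R <= c%:E)%E ->
  forall j x, (j <= k)%N -> 0 <= x <= 1 ->
  `|derive_in_n 0 1 j g x - derive_in_n 0 1 j g' x| <= c.
Proof.
move=> gC gC' h j x jk x01.
rewrite -(@derive_in_nE R 0 1 k
  (fun j x => derive_in_n 0 1 j g x - derive_in_n 0 1 j g' x) ltr01 _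
  (g \- g')) //; last first.
  by move=> i y ik y01; apply: is_derive_inB;
    [exact: (class_C_is_derive_in gC) | exact: (class_C_is_derive_in gC')].
rewrite -lee_fin; apply: le_trans h; apply: ereal_sup_ubound.
by exists (j, x) => //=; split => //=; rewrite in_itv.
Qed.

(** * From families to classes [C^n] and their norms *)

Section SmoothFamilyConclusion.
Variables (R : realType) (B : Type) (rho : B -> B -> R) (e : R).
Hypothesis e0 : 0 < e.

Lemma smooth_family_derivatives n u : smooth_family rho n e u ->
  exists du : nat -> B -> R -> R,
    [/\ forall b x, 0 <= x <= e -> u b x = du 0%N b x,
        forall j b x, (j < n)%N -> 0 <= x <= e ->
          is_derive_in 0 e (du j b) x (du j.+1 b x) &
        forall j, (j <= n)%N -> lipschitz_family rho e (du j)].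
Proof.
elim: n u => [|n IH] u hu.
  exists (fun=> u); split=> // j _.
  exact: smooth_lipschitz hu.
have [u0 [v [vs [C C0 hC]]]] := hu; have [dv [dv0 dvD dvb]] := IH v vs.
exists (fun j => if j is i.+1 then dv i else u); split => //.
- case=> [|j] b x jn xe; last exact: dvD.
  rewrite -dv0 //; exact: (quadratic_is_derive_in C0 (hC b)).
- by case=> [|j] jn; [exact: u0 | exact: dvb].
Qed.

Lemma smooth_family_class_C n u b : smooth_family rho n e u ->
  class_C 0 e n (u b).
Proof.
move=> /smooth_family_derivatives [du [du0 duD dub]].
have duE j x : (j <= n)%N -> 0 <= x <= e ->
    derive_in_n 0 e j (u b) x = du j b x.
  apply: (@derive_in_nE R 0 e n (fun j => du j b) e0) => [i y|y]; [exact: duD | exact: du0].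
split=> [j x jn|].
  rewrite in_itv /= => xe; exists (du j.+1 b x).
  apply: (@eq_is_derive_in _ _ _ (du j b)) => //; last exact: duD.
  by move=> y ye; rewrite duE // ltnW.
have [C C0 hC] := dub n (leqnn n).
apply: (@lipschitz_within_continuous _ _ _ _ C) => // x y xe ye.
by rewrite !duE //; have [] := hC b b x y xe ye.
Qed.

Lemma smooth_family_C_normB n u : smooth_family rho n e u ->
  (forall b b', 0 <= rho b b') ->
  exists2 C : R, 0 < C & forall b b',
    (C_norm 0 e n (u b \- u b')%R <= (C * rho b b')%:E)%E.
Proof.
move=> /smooth_family_derivatives [du [du0 duD dub]] rho0.
have [C C0 hC] : exists2 C : R, 0 < C & forall j b b' x, (j <= n)%N ->
    0 <= x <= e -> `|du j b x - du j b' x| <= C * rho b b'.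
  elim: n dub {duD} => [|n IH] dub.
    have [C C0 hC] := dub 0%N isT; exists (C + 1) => [|j b b' x]; first by lra.
    rewrite leqn0 => /eqP -> xe; have [_ _ h] := hC b b' x x xe xe.
    by have := rho0 b b'; lra.
  have [|C C0 hC] := IH; first by move=> j jn; exact: dub (leqW jn).
  have [C' C0' hC'] := dub n.+1 (leqnn _).
  exists (C + C') => [|j b b' x]; first by lra.
  have r0 := rho0 b b'; have z1 := mulr_ge0 (ltW C0) r0; have z2 := mulr_ge0 C0' r0.
  rewrite leq_eqVlt => /orP[/eqP ->|jn] xe.
    by have [_ _ h] := hC' b b' x x xe xe; lra.
  by have := hC j b b' x jn xe; lra.
exists C => // b b'; apply: ge_ereal_sup => _ [[j x] /= [jn xe] <-].
rewrite in_itv /= in xe; rewrite lee_fin.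
rewrite (@derive_in_nE R 0 e n (fun j x => du j b x - du j b' x) e0) //.
- exact: hC.
- by move=> i y ik ye; apply: is_derive_inB; exact: duD.
- by move=> y ye; rewrite -!du0.
Qed.

End SmoothFamilyConclusion.

(** The condition on [alpha] says [ln mu < - ln q / alpha]; the logarithm of [M] is the midpoint of
    this gap. *)
Lemma growth_rate (R : realType) (q mu alpha : R) : 0 < q -> 1 < mu ->
  0 < alpha < - (ln q / ln mu) ->
  exists M : R, [/\ mu < M, 1 <= M `^ alpha & q * M `^ alpha < 1].
Proof.
move=> q0 mu1 /andP[al0 al].
have lmu : 0 < ln mu by rewrite ln_gt0.
have h : alpha * ln mu < - ln q.
  by rewrite -ltr_pdivlMr // mulNr.
pose m := (ln mu - ln q / alpha) / 2.
have ma : m * alpha = (alpha * ln mu - ln q) / 2.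
  by rewrite /m; field; lra.
have h2 : ln mu < - ln q / alpha by rewrite ltr_pdivlMr // mulrC.
exists (expR m); rewrite -expRM; split.
- rewrite -[X in X < _](lnK (x := mu)); last by rewrite posrE; lra.
  by rewrite ltr_expR /m; lra.
- rewrite -expR0 ler_expR ma; have := mulr_gt0 al0 lmu; lra.
- rewrite -[X in X * _](lnK (x := q)) ?posrE // -expRD expR_lt1 ma; lra.
Qed.

(** * Skew products over the torus *)

Section TorusFamily.
Variables (R : realType) (d k : nat) (f : torus R d.+1 -> R -> R).
Variables (C_k beta : R).
Hypothesis k2 : (2 <= k)%N.
Hypothesis hf : boundary_preserving f.
Hypothesis hfk : forall b, class_C 0 1 k (f b).
Hypothesis C_k0 : 0 < C_k.
Hypothesis beta0 : 0 < beta.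
Hypothesis hholder : forall b b',
  (C_norm 0 1 k (f b \- f b')%R <= (C_k * torus_dist b b' `^ beta)%:E)%E.
Implicit Types (b : torus R d.+1) (x y : R).

Local Notation F j := (fun b => derive_in_n 0 1 j (f b)).
Local Notation lam := (multiplier f).

Local Lemma FD j b x : (j < k)%N -> 0 <= x <= 1 ->
  is_derive_in 0 1 (F j b) x (F j.+1 b x).
Proof. exact: (class_C_is_derive_in (hfk b)). Qed.

Local Lemma F_holder j b b' x : (j <= k)%N -> 0 <= x <= 1 ->
  `|F j b x - F j b' x| <= C_k * torus_dist b b' `^ beta.
Proof. exact: (C_normB_derive_in_n (hfk b) (hfk b') (hholder b b')). Qed.

(** Continuity on [[0, 1]] bounds one fibre; the Hoelder condition and the finite diameter carry the
    bound to all others. *)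
Local Lemma F_bounded j : (j <= k)%N -> exists2 C : R, 0 < C &
  forall b x, 0 <= x <= 1 -> `|F j b x| <= C.
Proof.
move=> jk; pose b0 : torus R d.+1 := (\pi_(torus R d.+1) 0)%qT.
have [C hC] := class_C_bounded (hfk b0) jk.
exists (`|C| + C_k * d.+1%:R `^ beta) => [|b x x01].
  by rewrite ltr_wpDl // mulr_gt0 // powR_gt0.
rewrite -[F j b x](subrK (F j b0 x)) addrC; apply: ler_normD2.
  by apply: (le_trans (hC x x01)); exact: ler_norm.
apply: (le_trans (F_holder b b0 jk x01)); rewrite ler_wpM2l ?(ltW C_k0) //.
apply: ge0_ler_powR; rewrite ?nnegrE ?(ltW beta0) ?torus_dist_ge0 //.
exact: torus_dist_le_diam.
Qed.

Local Lemma F_lip j : (j < k)%N -> exists2 C : R, 0 < C & forall b x y,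
  0 <= x <= 1 -> 0 <= y <= 1 -> `|F j b x - F j b y| <= C * `|x - y|.
Proof.
move=> jk; have [C C0 hC] := F_bounded jk; exists C => // b x y x01 y01.
apply: (@mean_value_bound _ 0 1 _ (F j.+1 b)) => // [t|t /andP[t1 t2]].
  exact: FD.
apply: hC; have /andP[x0 x1] := x01; have /andP[y0 y1] := y01; apply/andP; split.
  by apply: le_trans t1; rewrite le_min x0.
by apply: (le_trans t2); rewrite ge_max x1.
Qed.

Local Lemma F_taylor j : (j.+1 < k)%N -> exists2 C : R, 0 < C & forall b x y,
  0 <= x <= 1 -> 0 <= y <= 1 ->
  `|F j b y - F j b x - F j.+1 b x * (y - x)| <= C * `|y - x| ^+ 2.
Proof.
move=> jk; have [C C0 hC] := F_lip jk; exists C => // b.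
apply: (taylor_bound (ltW C0)) => [x|x y]; last exact: hC.
by apply: FD; exact: ltnW.
Qed.

(** The [.+1] is the derivative consumed by the Lipschitz bound on the top derivative
    [F (j + n)]. *)
Lemma family_smooth (rho : torus R d.+1 -> torus R d.+1 -> R) (C : R) n j :
  0 <= C -> (forall b b', 0 <= rho b b') ->
  (forall b b', C_k * torus_dist b b' `^ beta <= C * rho b b') ->
  (j + n.+1 <= k)%N -> smooth_family rho n 1 (F j).
Proof.
move=> C0 rho0 hC.
have bil i : (i < k)%N -> lipschitz_family rho 1 (F i).
  move=> ik; have [C1 C10 h1] := F_bounded (ltnW ik); have [C2 C20 h2] := F_lip ik.
  exists (C1 + C2 + C); first by lra.
  move=> b b' x x' xe xe'; have n0 := normr_ge0 (x - x'); have r0 := rho0 b b'.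
  have k1 := h1 b x xe; have k2' := h2 b x x' xe xe'.
  have k3 := le_trans (F_holder b b' (ltnW ik) xe) (hC b b').
  have z1 := mulr_ge0 (ltW C10) n0; have z2 := mulr_ge0 C0 n0.
  have z3 := mulr_ge0 (ltW C10) r0; have z4 := mulr_ge0 (ltW C20) r0.
  by split; lra.
elim: n j => [|n IH] j; first by rewrite addn1 => jk; split => //; exact: bil.
move=> jk; have j1k : (j.+1 < k)%N by apply: leq_trans jk; rewrite !addnS !ltnS leq_addr.
have [C1 C10 h1] := F_taylor j1k.
apply: (smooth_familyS (v := F j.+1)).
- by apply: bil; exact: ltnW.
- by exists C1; [exact: ltW | exact: h1].
- by apply: IH; rewrite addSnnS.
Qed.

Local Lemma multiplier_holder b b' :
  `|lam b - lam b'| <= C_k * torus_dist b b' `^ beta.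
Proof. by apply: (@F_holder 1 b b' 0); rewrite ?lexx ?ler01 // ltnW. Qed.

Local Lemma F1_holder b b' y : 0 <= y <= 1 ->
  `|(F 1%N b y - lam b) - (F 1%N b' y - lam b')| <=
    C_k * torus_dist b b' `^ beta * y.
Proof.
move=> y01; have h0 : 0 <= (0 : R) <= 1 by rewrite lexx ler01.
have D x : 0 <= x <= 1 ->
    is_derive_in 0 1 (fun y => F 1%N b y - F 1%N b' y) x (F 2%N b x - F 2%N b' x).
  by move=> x01; apply: is_derive_inB; apply: FD.
have := @mean_value_bound _ 0 1 _ _ D y 0 (C_k * torus_dist b b' `^ beta) y01 h0.
have /andP[y0 y1] := y01; rewrite subr0 (ger0_norm y0) => h.
rewrite (_ : _ - _ = F 1%N b y - F 1%N b' y - (F 1%N b 0 - F 1%N b' 0)).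
  by apply: h => t; rewrite min_r // max_l // => /andP[t0 t1]; apply: F_holder => //;
    rewrite t0 (le_trans t1).
by rewrite /derive_in_n /= /multiplier; ring.
Qed.

(** The Hoelder bound on second derivatives, integrated twice from 0, gains the factor [y ^+ 2] that
    the weight of [h] requires. *)
Local Lemma remainder_holder b b' y : 0 <= y <= 1 ->
  `|(f b y - lam b * y) - (f b' y - lam b' * y)| <=
    C_k * torus_dist b b' `^ beta * y ^+ 2.
Proof.
move=> y01; have h0 : 0 <= (0 : R) <= 1 by rewrite lexx ler01.
pose G b := fun x => f b x - lam b * x.
have k0 : (0 < k)%N by apply: leq_trans k2.
have D1 b1 x : 0 <= x <= 1 -> is_derive_in 0 1 (G b1) x (F 1%N b1 x - lam b1).
  by move=> x01; exact: (is_derive_inB (FD (b := b1) k0 x01)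
    (@is_derive_in_linear R 0 1 (lam b1) x)).
have D x : 0 <= x <= 1 -> is_derive_in 0 1 (fun y => G b y - G b' y) x
    ((F 1%N b x - lam b) - (F 1%N b' x - lam b')).
  by move=> x01; apply: is_derive_inB; exact: D1.
have := @mean_value_bound _ 0 1 _ _ D y 0 (C_k * torus_dist b b' `^ beta * y) y01 h0.
have /andP[y0 y1] := y01; rewrite subr0 (ger0_norm y0).
have [_ fb0 _] := hf b; have [_ fb0' _] := hf b'.
rewrite /G fb0 fb0' !mulr0 !subrr subr0 expr2 mulrA; apply => t.
rewrite min_r // max_l // => /andP[t0 t1].
apply: (le_trans (F1_holder b b' (_ : 0 <= t <= 1))).
  by rewrite t0 (le_trans t1).
by rewrite ler_wpM2l // mulr_ge0 ?powR_ge0 // ltW.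
Qed.

Lemma multiplier_lower_bound : exists2 m : R, 0 < m & forall b, m <= lam b.
Proof.
apply: (torus_holder_min (ltW C_k0) beta0 multiplier_holder) => b.
by have [df f0 _] := hf b; exact: or_diffeo_derive_gt0.
Qed.

Variables (A : 'M[int]_d.+1) (mu q : R).
Hypothesis hmu : largest_modulus A mu.
Hypothesis mu1 : 1 < mu.
Hypothesis hlambda : forall b, lam b <= q.
Hypothesis q1 : q < 1.

(** [eps], [h] and [K1] are fixed before [alpha], while [M], [N] and [rho] depend on it: one and the
    same conjugacy satisfies the estimates for all exponents. *)
Lemma torus_linearization : exists (eps : R) (h : torus R d.+1 -> R -> R) (K1 : R),
  [/\ 0 < eps, 0 <= K1,
      forall b x, 0 <= x <= eps -> [/\ `|h b x| <= K1 * x ^+ 2,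
        lam b * h b x = h (torus_map A b) (lam b * x) -
          (f b (x + h b x) - lam b * (x + h b x)) & 0 <= x + h b x <= 1],
      forall b x x', 0 <= x <= eps -> 0 <= x' <= eps ->
        4 * `|h b x - h b x'| <= `|x - x'| &
      forall alpha, 0 < alpha < Num.min beta (- (ln q / ln mu)) ->
        exists rho C, [/\ forall b b', 0 <= rho b b', 0 <= C,
          forall b b', rho b b' <= C * torus_dist b b' `^ alpha &
          smooth_family rho (k - 2) eps (fun b x => x + h b x)]].
Proof.
have [m m0 hm] := multiplier_lower_bound.
pose b0 : torus R d.+1 := (\pi_(torus R d.+1) 0)%qT.
have q0 : 0 < q by apply: lt_le_trans (hlambda b0); apply: lt_le_trans (hm b0).
have [Ka Ka0 hKa] := F_lip k2; have [Kb Kb0 hKb] := F_taylor k2.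
pose K := Ka + Kb; have K0 : 0 < K by rewrite addr_gt0.
pose eta := 4 * K / m; have eta0 : 0 < eta by rewrite divr_gt0 ?mulr_gt0.
pose K1 := 2 * eta / (1 - q).
have q1' : 0 < 1 - q by rewrite subr_gt0.
have K10 : 0 < K1 by rewrite /K1 divr_gt0 // mulr_gt0.
(* The [+ 1] makes [8 * eps <= 1 - q] hold together with [8 * (eta * eps) <= 1 - q], so that
   [2 * eps <= 1]. *)
pose eps := (1 - q) / (8 * (eta + 1)).
have etaE : eta * m = 4 * K by rewrite divfK // gt_eqF.
have K1E : K1 * (1 - q) = 2 * eta by rewrite divfK // gt_eqF.
have eta1 : 0 < eta + 1 by rewrite addr_gt0.
have eps0 : 0 < eps by rewrite /eps divr_gt0 // mulr_gt0.
have epsE : 8 * (eta * eps) + 8 * eps = 1 - q by rewrite /eps; field; lra.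
have eta_eps0 : 0 < eta * eps by rewrite mulr_gt0.
have eps1 : 2 * eps <= 1 by lra.
have eta_eps : 8 * (eta * eps) <= 1 - q by lra.
have lamP b : m <= lam b <= q by rewrite hm hlambda.
have f_0 b : f b 0 = 0 by have [] := hf b.
have f1_0 b : F 1%N b 0 = lam b by [].
have f1_lip b y y' : 0 <= y <= 1 -> 0 <= y' <= 1 ->
    `|F 1%N b y - F 1%N b y'| <= K * `|y - y'|.
  move=> h1 h2; apply: (le_trans (hKa b y y' h1 h2)).
  by rewrite ler_wpM2r // lerDl ltW.
have f_taylor b y y' : 0 <= y <= 1 -> 0 <= y' <= 1 ->
    `|f b y' - f b y - F 1%N b y * (y' - y)| <= K * `|y' - y| ^+ 2.
  move=> h1 h2; apply: (le_trans (hKb b y y' h1 h2)).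
  by rewrite ler_wpM2r ?exprn_ge0 // lerDr ltW.
have [h hP] := conjugacy_shift_exists (torus_map A) m0 lamP q0 q1 K0 f_0 f1_0
  f1_lip f_taylor etaE K1E eps0 eps1 eta_eps.
exists eps, h, K1; split => //; first exact: ltW.
- move=> b x xe; have [h1 h2] := hP b x xe; split => //.
  exact: (H_dom1 m0 q1 K0 etaE K1E eps1 eta_eps hP).
- exact: (shift_half_lip m0 lamP q0 q1 K0 f1_0 f1_lip f_taylor etaE K1E
    eps1 eta_eps hP).
move=> alpha /andP[al0]; rewrite lt_min => /andP[alb alq].
have alP : 0 < alpha < - (ln q / ln mu) by rewrite al0.
have [M [muM th1 qth]] := growth_rate q0 mu1 alP.
have mu_gt0 : 0 < mu by apply: lt_trans mu1.
have M0 : 0 < M by exact: lt_trans muM.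
have mu0 := ltW mu_gt0.
have [N N0 AN] := integer_matrix_eventually_expansive_le mu0 muM (proj2 hmu).
pose rho := adapted_dist A alpha M N.
have [C C0 rhoC] := adapted_dist_le A M N al0.
have [C' C'0 hC'] := @torus_dist_powR_le R d alpha beta al0 (ltW alb).
have rho0 : forall b b', 0 <= rho b b' by exact: adapted_dist_ge0.
exists rho, C; split => //.
have hol b b' : C_k * torus_dist b b' `^ beta <= C_k * C' * rho b b'.
  rewrite -mulrA ler_wpM2l ?(ltW C_k0) //; apply: (le_trans (hC' b b')).
  by rewrite ler_wpM2l //; exact: torus_dist_le_adapted.
have CC0 : 0 <= C_k * C' by rewrite mulr_ge0 // ltW.
have rhoT : forall b b', rho (torus_map A b) (torus_map A b') <=
    M `^ alpha * rho b b'.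
  exact: adapted_dist_map.
have lamH b b' : `|lam b - lam b'| <= C_k * C' * rho b b'.
  exact: le_trans (multiplier_holder b b') (hol b b').
have rH b b' y : 0 <= y <= 1 -> `|(f b y - lam b * y) - (f b' y - lam b' * y)| <=
    C_k * C' * (y ^+ 2 * rho b b').
  move=> y01; apply: (le_trans (remainder_holder b b' y01)).
  by have := ler_wpM2r (sqr_ge0 y) (hol b b'); lra.
have f1H b b' y : 0 <= y <= 1 ->
    `|(F 1%N b y - lam b) - (F 1%N b' y - lam b')| <= C_k * C' * (y * rho b b').
  move=> y01; apply: (le_trans (F1_holder b b' y01)); have /andP[y0 _] := y01.
  by have := ler_wpM2r y0 (hol b b'); lra.
apply: (conjugacy_smooth m0 lamP q0 q1 K0 f1_0 f1_lip f_taylor etaE K1E eps0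
    eps1 eta_eps hP rho0 rhoT th1 qth CC0 lamH rH f1H).
(* [f'] is the member [j = 1] of the chain, hence of level [k - 2]. *)
have kk : (1 + (k - 2).+1 <= k)%N by rewrite addnS add1n -addn2 subnK.
exact: (family_smooth CC0 rho0 hol kk).
Qed.

End TorusFamily.

(** * The conjugacy is a homeomorphism onto its image *)

Section Homeomorphism.
Variables (R : realType) (d : nat).
Implicit Types (b : torus R d.+1).

Lemma cvg_within_strip (D : set (torus R d.+1 * R))
    (F : torus R d.+1 * R -> torus R d.+1 * R) p0 :
  (forall p, (F p).1 = p.1) ->
  (forall e : R, 0 < e -> exists r s : R, [/\ 0 < r, 0 < s & forall p, D p ->
     torus_dist p0.1 p.1 < r -> `|p0.2 - p.2| < s -> `|(F p0).2 - (F p).2| <= e]) ->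
  F @ within D (nbhs p0) --> F p0.
Proof.
move=> F1 F2 S /= [[U V] /= [FU FV] UV].
move: FV => /nbhs_ballP [e /= e0 eV].
have e2 : 0 < e / 2 by lra.
have [r [s [r0 s0 h]]] := F2 _ e2.
rewrite F1 in FU.
exists (U `&` [set b | torus_dist p0.1 b < r], ball p0.2 s) => /=.
  split; first by apply: filterI => //; exact: torus_dist_nbhs.
  exact: nbhsx_ballx.
move=> p /= [[Up rp] sp] Dp; apply: UV => /=; split; first by rewrite F1.
apply: eV; rewrite /ball /=.
by apply: (le_lt_trans (h p Dp rp sp)); lra.
Qed.

Lemma homeo_fiber_shift (eps : R) (h : torus R d.+1 -> R -> R) (C alpha : R) :
  0 <= C -> 0 < alpha ->
  (forall b b' x, 0 <= x <= eps -> `|h b x - h b' x| <= C * torus_dist b b' `^ alpha) ->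
  (forall b x x', 0 <= x <= eps -> 0 <= x' <= eps ->
     4 * `|h b x - h b x'| <= `|x - x'|) ->
  homeo_onto_image (strip d.+1 eps) (fiber_shift h).
Proof.
move=> C0 al0 hC hL.
have stripP p : strip d.+1 eps p <-> 0 <= p.2 <= eps.
  by rewrite /strip /= in_itv /=; split=> [[]|].
split.
  apply/subspace_continuousP => p0 /stripP x0e.
  apply: cvg_within_strip => // e e0.
  have e4 : 0 < e / 4 by lra.
  have [r r0 hr] := powR_small C0 al0 e4.
  exists r, (e / 4); split => // p /stripP xe hd hx /=.
  have k1 := hr _ (torus_dist_ge0 _ _) hd.
  have k2 := hC p0.1 p.1 p0.2 x0e.
  have k3 := hL p.1 p0.2 p.2 x0e xe.
  rewrite (_ : _ - _ = (p0.2 - p.2) + ((h p0.1 p0.2 - h p.1 p0.2) +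
    (h p.1 p0.2 - h p.1 p.2))); last by ring.
  apply: (le_trans (ler_normD2 (lexx _) (ler_normD _ _))); lra.
(* On the image the fibre preimage exists and is unique, so the default 0 of [xget] can occur only
   off it. *)
pose G (p : torus R d.+1 * R) : torus R d.+1 * R :=
  (p.1, xget 0 [set x | 0 <= x <= eps /\ x + h p.1 x = p.2]).
have GK p : strip d.+1 eps p -> G (fiber_shift h p) = p.
  move=> /stripP xe; case: p xe => b x /= xe; rewrite /G /=; congr pair.
  case: xgetP => [y _ [ye hy]|/(_ x)]; last by case.
  have := hL b x y xe ye; rewrite (_ : h b x - h b y = - (x - y)).
    rewrite normrN => k; have n0 := normr_ge0 (x - y).
    by apply/esym/eqP; rewrite -subr_eq0 -normr_eq0; apply/eqP; lra.
  by rewrite opprB; lra.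
exists G; split => //.
apply/subspace_continuousP => _ [p0 p0D <-].
apply: (@cvg_within_strip _ G (fiber_shift h p0)) => // e e0.
have e4 : 0 < e / 4 by lra.
have [r r0 hr] := powR_small C0 al0 e4.
exists r, (e / 4); split => // _ [p pD <-] hd hx.
rewrite !GK //; move/stripP: p0D => x0e; move/stripP: pD => xe.
rewrite /= in hd hx.
have k1 := hr _ (torus_dist_ge0 _ _) hd.
have k2 := hC p0.1 p.1 p.2 xe.
have k3 := hL p0.1 p0.2 p.2 x0e xe.
(* The first difference of [h] is at most a quarter of the left-hand side and is absorbed by it. *)
have k4 : `|p0.2 - p.2| <= `|p0.2 + h p0.1 p0.2 - (p.2 + h p.1 p.2)| +
   (`|h p0.1 p0.2 - h p0.1 p.2| + `|h p0.1 p.2 - h p.1 p.2|).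
  rewrite (_ : p0.2 - p.2 = (p0.2 + h p0.1 p0.2 - (p.2 + h p.1 p.2)) -
    ((h p0.1 p0.2 - h p0.1 p.2) + (h p0.1 p.2 - h p.1 p.2))); last by ring.
  by apply: (le_trans (ler_normB _ _)); rewrite lerD2l; exact: ler_normD.
lra.
Qed.

End Homeomorphism.

Theorem theorem3 (R : realType) (d k : nat) (A : 'M[int]_d)
    (f : torus R d -> R -> R) (C_k beta mu q : R)
    (hk : (2 <= k)%N)
    (hAGL : A \in unitmx)
    (hAhyp : hyperbolic R A)
    (hmu : largest_modulus A mu)
    (hf : boundary_preserving f)
    (hfk : forall b, class_C 0 1 k (f b))
    (hCk : 0 < C_k) (hbeta : 0 < beta)
    (hholder : forall b b',
       (C_norm 0 1 k (f b \- f b')%R <= (C_k * torus_dist b b' `^ beta)%:E)%E)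
    (hlambda : forall b, multiplier f b <= q) (hq : q < 1) :
  exists (eps : R) (h : torus R d -> R -> R),
    [/\ 0 < eps,
        homeo_onto_image (strip d eps) (fiber_shift h),
        fiber_shift h @` strip d eps `<=` strip d 1 &
        forall b, h b 0 = 0 /\ is_derive_in 0 eps (h b) 0 0] /\
    [/\ {in strip d eps, skew_product A f \o fiber_shift h
                         =1 fiber_shift h \o linear_part A f},
        forall alpha : R, 0 < alpha < Num.min beta (- (ln q / ln mu)) ->
          exists C0 : R, forall b b',
            (ereal_sup [set `|h b x - h b' x|%:E | x in `[0%R, eps]]
               <= (C0 * torus_dist b b' `^ alpha)%:E)%E,
        forall b, class_C 0 eps (k - 2) (fun x => x + h b x) &
        exists C_k2 alpha : R,
          [/\ 0 < C_k2, 0 < alpha < Num.min beta (- (ln q / ln mu)) &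
              forall b b',
                (C_norm 0 eps (k - 2) (h b \- h b')%R
                   <= (C_k2 * torus_dist b b' `^ alpha)%:E)%E]].
Proof.
case: d A f hAGL hAhyp hmu hf hfk hholder hlambda
  => [|d] A f hAGL hAhyp hmu hf hfk hholder hlambda.
  (* In dimension 0 there is no nonzero eigenvector, hence no largest modulus. *)
  have [[z /eigenvalueP[v _] /eqP[]]] := hmu.
  by rewrite thinmx0.
have mu1 := hyperbolic_largest_modulus_gt1 hAGL hAhyp hmu.
have [eps [h [K1 [eps0 K10 hP hL hS]]]] :=
  torus_linearization hk hf hfk hCk hbeta hholder hmu mu1 hlambda hq.
have [m m0 hm] := multiplier_lower_bound hk hf hfk hCk hbeta hholder.
pose b0 : torus R d.+1 := (\pi_(torus R d.+1) 0)%qT.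
have q0 : 0 < q by apply: lt_le_trans (hlambda b0); apply: lt_le_trans (hm b0).
have C_norm_h (alpha : R) : 0 < alpha < Num.min beta (- (ln q / ln mu)) ->
    exists2 C : R, 0 < C & forall b b',
      (C_norm 0 eps (k - 2) (h b \- h b')%R <= (C * torus_dist b b' `^ alpha)%:E)%E.
  move=> /hS [rho [C [rho0 C0 rhoC Hs]]].
  have hs : smooth_family rho (k - 2) eps h.
    apply: (@eq_smooth_family _ _ _ _ _ (fun b x => (x + h b x) + -1 * x)).
      by move=> b x _; ring.
    apply: smooth_add => //; apply: smooth_mul; first exact: smooth_const.
    by apply: smooth_id => //; exact: ltW.
  have [C1 C10 hC1] := smooth_family_C_normB eps0 hs rho0.
  exists (C1 * (C + 1)) => [|b b']; first by rewrite mulr_gt0 //; lra.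
  apply: (le_trans (hC1 b b')); rewrite lee_fin -mulrA ler_wpM2l ?(ltW C10) //.
  apply: (le_trans (rhoC b b')); rewrite ler_wpM2r ?powR_ge0 //; lra.
have sup_h (alpha : R) : 0 < alpha < Num.min beta (- (ln q / ln mu)) ->
    exists2 C : R, 0 < C & forall b b' (x : R), 0 <= x <= eps ->
      `|h b x - h b' x| <= C * torus_dist b b' `^ alpha.
  move=> /C_norm_h [C C0 hC]; exists C => // b b' x xe.
  rewrite -lee_fin; apply: le_trans (hC b b'); apply: ereal_sup_ubound.
  by exists (0%N, x) => //=; split => //=; rewrite in_itv.
(* The range of exponents is nonempty because [0 < q < 1 < mu]; its midpoint serves wherever one
   exponent suffices. *)
have al1 : exists alpha : R, 0 < alpha < Num.min beta (- (ln q / ln mu)).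
  have l0 : 0 < - (ln q / ln mu).
    by rewrite -mulNr divr_gt0 ?ln_gt0 // oppr_gt0 ln_lt0 // q0 hq.
  have : 0 < Num.min beta (- (ln q / ln mu)) by rewrite lt_min hbeta.
  by exists (Num.min beta (- (ln q / ln mu)) / 2); apply/andP; split; lra.
have [alpha alP] := al1; have /andP[al0 _] := alP.
have [C C0 hC] := sup_h alpha alP.
have h0 b : h b 0 = 0.
  have [|k1 _ _] := hP b 0; first by rewrite lexx ltW.
  by apply/eqP; rewrite -normr_le0; move: k1; rewrite expr0n /= mulr0.
exists eps, h; split; split => //.
- exact: homeo_fiber_shift (ltW C0) al0 hC hL.
- move=> _ [[b x] [_ /= xe] <-]; rewrite in_itv /= in xe; split => //=.
  by have [_ _] := hP b x xe; rewrite in_itv.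
- move=> b; split; first exact: h0.
  apply/is_derive_inP => e e0; have K11 : 0 < K1 + 1 by lra.
  exists (e / (K1 + 1)) => [|y ye]; first by rewrite divr_gt0.
  rewrite h0 mul0r !subr0 => yd; have [k1 _ _] := hP b y ye.
  have /andP[y0 _] := ye; rewrite (ger0_norm y0) in yd *.
  apply: (le_trans k1); rewrite expr2 mulrA ler_wpM2r //.
  rewrite ltr_pdivlMr // in yd; lra.
- move=> [b x]; rewrite inE => -[_ /=]; rewrite in_itv /= => xe.
  have [_ k2 _] := hP b x xe.
  rewrite /skew_product /fiber_shift /linear_part /skew_product /=.
  congr pair.
  have -> : h (torus_map A b) (multiplier f b * x) = multiplier f b * h b x +
      (f b (x + h b x) - multiplier f b * (x + h b x)) by rewrite k2; ring.
  ring.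
- move=> a /sup_h [Ca Ca0 hCa]; exists Ca => b b'.
  apply: ge_ereal_sup => _ [x /= xe <-]; rewrite in_itv /= in xe.
  by rewrite lee_fin; exact: hCa.
- move=> b; have [rho [C1 [_ _ _ Hs]]] := hS alpha alP.
  exact: (smooth_family_class_C eps0 b Hs).
- have [C1 C10 hC1] := C_norm_h alpha alP.
  by exists C1, alpha.
Qed.
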